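(* Assume that either $\gamma=\frac{2n-2}{n}$ and $Gn^{\frac{2-n}{n}}M^{\frac2n}<2A$, or $\gamma>\frac{2n-2}{n}$. Assume also that $\theta\ge 0$, $c_1>0$, $2c_1+nc_2>0$ and $$[2c_1\alpha+c_2(2n-2+\alpha)]^2-4(2c_1+c_2)[2c_1(n-1)+c_2(n-1)(n-1+\alpha)]<0,\qquad \alpha=\tfrac32-n .$$ For $i=1,2$, let $(\rho_i,u_i,r_i)$ be the solution to the initial-boundary value problem (IBVP) of the context with initial data $(\rho_{0i},u_{0i},r_{0i})$ in place of $(\rho_0,u_0,r_0)$, and suppose that, for all $t\ge0$ and $x\in[0,M]$, $$\rho_i(x,t)\in\left[\tfrac12\underline{\rho},\tfrac32\bar\rho\right],\qquad r_i^n(x,t)\in[C^{-1}x,Cx],$$ $$\left\|\frac{u_i}{r_i}(\cdot,t)\right\|_{L^\infty}\le C\|\partial_x(r_i^{n-1}u_i)(\cdot,t)\|_{L^\infty}\le C\epsilon_0,\qquad B[\rho_i,u_i,r_i](t)\le C\epsilon_0^2 ,$$ where $\epsilon_0>0$ is the constant described in the context. Then, for all $t\ge0$, $$\int_0^M\left[(u_1-u_2)^2+(\rho_1-\rho_2)^2+x^{-\frac2n}(r_1-r_2)^2\right](x,t)\,dx\le Ce^{Ct}\int_0^M\left[(u_{01}-u_{02})^2+(\rho_{01}-\rho_{02})^2+x^{-\frac2n}(r_{01}-r_{02})^2\right]dx .$$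
   Context: Parameters: $n\ge2$ is an integer; $A>0$, $\gamma>1$, $G>0$, $P_\infty>0$, $M>0$ (total mass), $\theta$, $c_1$, $c_2$ are real constants. $P(\rho)=A\rho^\gamma$, $\mu(\rho)=c_1\rho^\theta$, $\lambda(\rho)=c_2\rho^\theta$, $\mathbb{R}_+=[0,\infty)$. $C$ denotes a generic positive constant depending only on the data, independent of time. External pressure and force (the same for both solutions): $P_\Gamma(t)=P_\infty+\Delta P(t)$, $P_\Gamma\in C^1(\mathbb{R}_+)$, and $f(x,r,t)=\frac{Gx}{r^{n-1}}+\Delta f(x,r,t)$ with $\Delta f\in C^1(\mathbb{R}_+\times\mathbb{R}_+\times\mathbb{R}_+)$, $\|\Delta f(\cdot,\cdot,t)\|_{L^\infty(\mathbb{R}_+\times\mathbb{R}_+)}\le f_1(t)$, $\|(\partial_r\Delta f,\partial_t\Delta f)(\cdot,\cdot,t)\|_{L^\infty(\mathbb{R}_+\times\mathbb{R}_+)}\le f_2(t)$, where $f_1,\Delta P\in L^\infty\cap L^1(\mathbb{R}_+)$ and $(\Delta P)',f_2\in L^2(\mathbb{R}_+)$. Stationary state: $\rho_\infty>0$ on $[0,M]$ is the (unique, under the stated hypotheses on $\gamma$) positive solution of $A r_\infty^{n-1}(\rho_\infty^\gamma)_x=-\frac{Gx}{r_\infty^{n-1}}$, $r_\infty^n(x)=n\int_0^x\rho_\infty^{-1}(y)\,dy$, $x\in(0,M)$, $\rho_\infty(M)=(P_\infty/A)^{1/\gamma}$. Put $\underline{\rho}=\min_{[0,M]}\rho_\infty$,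 $\bar\rho=\max_{[0,M]}\rho_\infty$. (IBVP): for unknowns $(\rho,u,r)(x,t)$, $(x,t)\in(0,M)\times(0,\infty)$, $\partial_t\rho=-\rho^2\partial_x(r^{n-1}u)$, $\partial_tu=r^{n-1}\left\{\partial_x[\rho(\lambda+2\mu)\partial_x(r^{n-1}u)-P]-2(n-1)\frac ur\partial_x\mu\right\}-f(x,r,t)$, $r^n(x,t)=n\int_0^x\rho^{-1}(y,t)\,dy$, with initial data $(\rho,u)|_{t=0}=(\rho_0,u_0)(x)$, $r|_{t=0}=r_0(x)=\left(n\int_0^x\rho_0^{-1}(y)\,dy\right)^{1/n}$, and boundary conditions $u(0,t)=0$ and $\left\{P-\rho(\lambda+2\mu)\partial_x(r^{n-1}u)+2(n-1)\mu\frac ur\right\}\big|_{x=M}=P_\Gamma(t)$, $t>0$. Solutions are global weak solutions: triples $(\rho,u,r)$ such that for every $T>0$: $\rho,u\in L^\infty([0,M]\times[0,T])\cap C^1([0,T];L^2([0,M]))$; $r\in C^1([0,T];L^\infty([0,M]))$; $(r^{n-2}u)_x,(r^{n-1})_x\in L^\infty([0,T];L^{n-\frac12}([0,M]))$; $(r^{n-1}u)_x\in L^\infty([0,M]\times[0,T])\cap C^{\frac12}([0,T];L^2([0,M]))$; and moreover $\rho_t+\rho^2(r^{n-1}u)_x=0$, $\rho(x,0)=\rho_0(x)$ a.e.; $r_t=u$, $r^n(x,t)=n\int_0^x\rho^{-1}(y,t)\,dy$, $r(x,0)=r_0(x)$ a.e.; and for every $\psi\in C_0^\infty(\Omega)$,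 $\Omega=\{(x,t):0<x\le M,\ t\ge0\}$, $\int_0^\infty\int_0^M\left[u\psi_t+(P-\rho(\lambda+2\mu)(r^{n-1}u)_x)(r^{n-1}\psi)_x+2(n-1)\mu(r^{n-2}u\psi)_x-f(x,r,t)\psi\right]dx\,dt=\int_0^\infty P_\Gamma(r^{n-1}\psi)(M,t)\,dt-\int_0^Mu_0(x)\psi(x,0)\,dx.$ Functional: with $\alpha=\frac32-n$, $B[\rho,u,r]=\int_0^M\left[(\rho-\rho_\infty)^2+r^{2n-2+\alpha}(\rho-\rho_\infty)_x^2+\frac{u^2}{r^2}+r^{2n-2}u_x^2+r^{2n-2+\alpha}\left(\rho^{1+\theta}(r^{n-1}u)_x\right)_x^2\right]dx$, evaluated at each fixed time. The constant $\epsilon_0>0$ is a small constant such that, whenever $\|(f_1,\Delta P)\|_{L^\infty\cap L^1}+\|(\Delta P)'\|_{L^2}+\|f_2\|_{L^2}\le\epsilon_0$ and $\|\rho_0-\rho_\infty\|^2_{L^\infty}+B[\rho_0,u_0,r_0]\le\epsilon_0^2$, (IBVP) has a unique global weak solution satisfying the bounds displayed in the claim. *)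

(* Defs.v *)
From HB Require Import structures.
From mathcomp Require Import all_boot all_order all_algebra.
From mathcomp Require Import all_classical all_reals all_analysis.

Set Implicit Arguments.
Unset Strict Implicit.
Unset Printing Implicit Defensive.

Import Order.TTheory GRing.Theory Num.Theory.
Import numFieldNormedType.Exports.

Local Open Scope classical_set_scope.
Local Open Scope ring_scope.

Section FunctionSpaces.
Context {R : realType}.
Implicit Types (M T : R) (p : \bar R).

Notation mu := (@lebesgue_measure R).

Definition half_line : set R := `[0, +oo[.

Definition normLp (D : set R) p (g : R -> R) : \bar R :=
  'N[mu]_p[EFin \o (g \_ D)]%E.

Definition in_Lp (D : set R) p (g : R -> R) : Prop :=
  measurable_fun D g /\ (normLp D p g < +oo)%E.

Definition test_fun M (phi : R -> R) : Prop :=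
  (forall (k : nat) (x : R), derivable (derive1n k phi) x 1) /\
  (exists a b : R, [/\ 0 < a, b < M &
     forall x : R, (x < a) || (b < x) -> phi x = 0]).

(* [h] is the distributional derivative of [g] on the open interval (0, M) *)
Definition is_wderiv M (g h : R -> R) : Prop :=
  [/\ locally_integrable `]0, M[ g, locally_integrable `]0, M[ h &
    forall phi : R -> R, test_fun M phi ->
      (\int[mu]_(x in `]0%R, M[) (g x * derive1 phi x))%R =
      - (\int[mu]_(x in `]0%R, M[) (h x * phi x))%R].

Definition wderivable M (g : R -> R) : Prop := exists h, is_wderiv M g h.

(* A representative of the distributional derivative, the zero function when
   there is none; it only makes sense up to equality a.e. on (0, M). *)
Definition wderiv M (g : R -> R) : R -> R :=
  xget (cst 0) [set h | is_wderiv M g h].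

(* Functions of (x, t), x being the first argument. *)
Definition wderivx M (g : R -> R -> R) : R -> R -> R :=
  fun x t => wderiv M (g^~ t) x.

(* for a.e. t >= 0 and a.e. x in [0, M] *)
Definition ae_xt M (P : R -> R -> Prop) : Prop :=
  {ae mu, forall t : R, 0 <= t ->
    {ae mu, forall x : R, 0 <= x <= M -> P x t}}.

(* L^oo([0,T]; L^p([0,M])), as classes: [g] has a version which is jointly
   measurable. For p = +oo this is L^oo([0,M] x [0,T]). *)
Definition LooLp M T p (g : R -> R -> R) : Prop :=
  (exists2 h : R * R -> R,
     measurable_fun (`[0, M] `*` `[0, T] : set (R * R)) h &
     {ae mu, forall t : R, 0 <= t <= T ->
       {ae mu, forall x : R, 0 <= x <= M -> g x t = h (x, t)}}) /\
  (exists K : R,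
     {ae mu, forall t : R, 0 <= t <= T ->
       (normLp `[0%R, M] p (g^~ t) <= K%:E)%E}).

(* C([0,T]; L^p([0,M])) *)
Definition CLp M T p (g : R -> R -> R) : Prop :=
  forall t : R, 0 <= t <= T ->
    in_Lp `[0%R, M] p (g^~ t) /\
    (normLp `[0%R, M] p (fun x => g x s - g x t)%R
       @[s --> within `[0, T] (nbhs t)] --> 0%E).

(* [g] is in C^1([0,T]; L^p([0,M])) with derivative [g_t] *)
Definition C1Lp M T p (g g_t : R -> R -> R) : Prop :=
  [/\ CLp M T p g, CLp M T p g_t &
    forall t : R, 0 <= t <= T ->
      normLp `[0%R, M] p (fun x => (g x s - g x t) / (s - t) - g_t x t)%R
        @[s --> within `[0, T] t^'] --> 0%E].

(* C^{1/2}([0,T]; L^p([0,M])) *)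
Definition ChalfLp M T p (g : R -> R -> R) : Prop :=
  (forall t : R, 0 <= t <= T -> in_Lp `[0%R, M] p (g^~ t)) /\
  (exists K : R, forall s t : R, 0 <= s <= T -> 0 <= t <= T ->
    (normLp `[0%R, M] p (fun x => g x s - g x t)%R
       <= (K * Num.sqrt `|s - t|)%:E)%E).

(* derivative relative to [D]: one-sided at the end points *)
Definition is_deriv_in (D : set R) (g : R -> R) (x d : R) : Prop :=
  (g y - g x) / (y - x) @[y --> within D x^'] --> d.

Definition C1_half_line (g : R -> R) : Prop :=
  exists2 dg : R -> R,
    {within half_line, continuous dg} &
    forall t : R, 0 <= t -> is_deriv_in half_line g t (dg t).

Definition continuous_octant (g : R -> R -> R -> R) : Prop :=
  {within [set z : R * R * R | [/\ 0 <= z.1.1, 0 <= z.1.2 & 0 <= z.2]],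
    continuous (fun z : R * R * R => g z.1.1 z.1.2 z.2)}.

(* [g] is C^1 on [0,oo)^3, with the given partial derivatives *)
Definition C1_octant (g gx gr gt : R -> R -> R -> R) : Prop :=
  [/\ continuous_octant g, continuous_octant gx,
      continuous_octant gr, continuous_octant gt &
    forall x r t : R, 0 <= x -> 0 <= r -> 0 <= t ->
    [/\ is_deriv_in half_line (fun y => g y r t) x (gx x r t),
        is_deriv_in half_line (fun s => g x s t) r (gr x r t) &
        is_deriv_in half_line (fun s => g x r s) t (gt x r t)]].

(* C^oo on the plane: [d i j] is the partial derivative of order i in the
   first variable and j in the second. *)
Definition smooth2 (psi : R -> R -> R) : Prop :=
  exists d : nat -> nat -> R -> R -> R,
    d 0%N 0%N = psi /\
    forall i j : nat,
      continuous (fun z : R * R => d i j z.1 z.2) /\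
      forall x t : R,
        is_derive x 1 (fun y => d i j y t) (d i.+1 j x t) /\
        is_derive t 1 (fun s => d i j x s) (d i j.+1 x t).

(* C_0^oo(Omega), Omega = {0 < x <= M, t >= 0}: restrictions to Omega of smooth
   functions on the plane, whose support in Omega is compact. They need not
   vanish at x = M nor at t = 0. *)
Definition test_fun2 M (psi : R -> R -> R) : Prop :=
  smooth2 psi /\
  exists a b : R, 0 < a /\
    forall x t : R, 0 < x <= M -> 0 <= t -> (x < a) || (b < t) -> psi x t = 0.

End FunctionSpaces.

(* The constants n, A, gamma, G, P_oo, M, theta, c_1, c_2. *)
Record params (R : realType) := Params {
  ndim : nat;
  Apr : R;
  gam : R;
  Gr : R;
  Pinf : R;
  mass : R;
  theta : R;
  c1 : R;
  c2 : R }.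

(* Delta P, Delta f and the functions f_1, f_2 of t that bound Delta f and its
   derivatives; see [admissible_forcing]. *)
Record forcing (R : realType) := Forcing {
  dP : R -> R;
  df : R -> R -> R -> R;
  maj1 : R -> R;
  maj2 : R -> R }.

Section Model.
Context {R : realType} (p : params R).

Notation mu := (@lebesgue_measure R).
Local Notation n := (ndim p).
Local Notation M := (mass p).
Local Notation I := (`[0, mass p]%classic : set R).

Definition pressure (rho : R) : R := Apr p * rho `^ gam p.
Definition viscmu (rho : R) : R := c1 p * rho `^ theta p.
Definition visclambda (rho : R) : R := c2 p * rho `^ theta p.

Definition alpha : R := 3%:R / 2%:R - n%:R.

Definition lag_radius (rho : R -> R) (x : R) : R :=
  (n%:R * (\int[mu]_(y in `[0, x]) (rho y)^-1)%R) `^ (n%:R^-1).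

Record stationary (rhoi : R -> R) : Prop := Stationary {
  stat_cont : {within I, continuous rhoi};
  stat_pos : forall x : R, 0 <= x <= M -> 0 < rhoi x;
  stat_der : forall x : R, 0 < x < M ->
    derivable (fun y => rhoi y `^ gam p) x 1;
  stat_eq : forall x : R, 0 < x < M ->
    Apr p * lag_radius rhoi x ^+ n.-1 * derive1 (fun y => rhoi y `^ gam p) x =
    - (Gr p * x / lag_radius rhoi x ^+ n.-1);
  stat_bc : rhoi M = (Pinf p / Apr p) `^ ((gam p)^-1) }.

Definition rhomin (rhoi : R -> R) : R := inf (rhoi @` I).
Definition rhomax (rhoi : R -> R) : R := sup (rhoi @` I).

(* The functional B at a fixed time; +oo if one of the derivatives that it
   involves does not exist as a locally integrable function. *)
Definition Bfun (rhoi rho u r : R -> R) : \bar R :=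
  let v := wderiv M (fun x => r x ^+ n.-1 * u x) in
  let flux := fun x => rho x `^ (1 + theta p) * v x in
  let drho := fun x => rho x - rhoi x in
  let w := fun x => r x `^ (2%:R * n%:R - 2%:R + alpha) in
  if `[< [/\ wderivable M drho, wderivable M u,
            wderivable M (fun x => r x ^+ n.-1 * u x) &
            wderivable M flux] >]
  then (\int[mu]_(x in I)
    (drho x ^+ 2 + w x * wderiv M drho x ^+ 2 + u x ^+ 2 / r x ^+ 2
     + r x ^+ (2 * n - 2)%N * wderiv M u x ^+ 2
     + w x * wderiv M flux x ^+ 2)%:E)%E
  else +oo%E.

Definition PGamma (F : forcing R) (t : R) : R := Pinf p + dP F t.

Definition force (F : forcing R) (x r t : R) : R :=
  Gr p * x / r ^+ n.-1 + df F x r t.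

(* The L^oo norm of the pair (d_r Delta f, d_t Delta f) is the max of the two
   norms; sup and ess sup agree for continuous functions. *)
Definition admissible_forcing (F : forcing R) : Prop :=
  [/\ C1_half_line (dP F),
      exists fx fr ft : R -> R -> R -> R, C1_octant (df F) fx fr ft /\
        {ae mu, forall t : R, 0 <= t -> forall x r : R, 0 <= x -> 0 <= r ->
          [/\ `|df F x r t| <= maj1 F t,
              `|fr x r t| <= maj2 F t & `|ft x r t| <= maj2 F t]},
      in_Lp half_line +oo%E (maj1 F) /\ in_Lp half_line 1%E (maj1 F),
      in_Lp half_line +oo%E (dP F) /\ in_Lp half_line 1%E (dP F) &
      in_Lp half_line 2%:E (derive1 (dP F)) /\ in_Lp half_line 2%:E (maj2 F)].

(* ||(f_1, Delta P)||_{L^oo cap L^1} + ||(Delta P)'||_{L^2} + ||f_2||_{L^2} *)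
Definition forcing_norm (F : forcing R) : \bar R :=
  (normLp half_line +oo (maj1 F) + normLp half_line 1 (maj1 F)
   + normLp half_line +oo (dP F) + normLp half_line 1 (dP F)
   + normLp half_line 2%:E (derive1 (dP F)) + normLp half_line 2%:E (maj2 F))%E.

(* Here (r^{n-1} psi)(M, t) is meaningful since [r] is the representative which
   is continuous in x, see [ws_radius]. *)
Definition weak_momentum (F : forcing R) (u0 : R -> R)
    (rho u r psi : R -> R -> R) : Prop :=
  let v := wderivx M (fun x t => r x t ^+ n.-1 * u x t) in
  let dpsi1 := wderivx M (fun x t => r x t ^+ n.-1 * psi x t) in
  let dpsi2 := wderivx M (fun x t => r x t ^+ (n - 2)%N * u x t * psi x t) in
  (\int[mu]_(t in half_line) (\int[mu]_(x in I)
    (u x t * derive1 (psi x) t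
     + (pressure (rho x t)
        - rho x t * (visclambda (rho x t) + 2%:R * viscmu (rho x t)) * v x t)
       * dpsi1 x t
     + 2%:R * (n%:R - 1) * viscmu (rho x t) * dpsi2 x t
     - force F x (r x t) t * psi x t))%R)%R
  = (\int[mu]_(t in half_line) (PGamma F t * (r M t ^+ n.-1 * psi M t)))%R
    - (\int[mu]_(x in I) (u0 x * psi x 0))%R.

Record weak_solution (F : forcing R) (rho0 u0 : R -> R)
    (rho u r : R -> R -> R) : Prop := WeakSolution {
  ws_data : in_Lp I 2%:E rho0 /\ in_Lp I 2%:E u0;
  ws_bounded : forall T : R, 0 < T ->
    LooLp M T +oo%E rho /\ LooLp M T +oo%E u;
  ws_rho : exists2 rho_t : R -> R -> R,
    forall T : R, 0 < T -> C1Lp M T 2%:E rho rho_t &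
    ae_xt M (fun x t => rho_t x t + rho x t ^+ 2
      * wderivx M (fun x t => r x t ^+ n.-1 * u x t) x t = 0);
  ws_u : exists u_t : R -> R -> R,
    forall T : R, 0 < T -> C1Lp M T 2%:E u u_t;
  ws_r : exists2 r_t : R -> R -> R,
    forall T : R, 0 < T -> C1Lp M T +oo%E r r_t &
    ae_xt M (fun x t => r_t x t = u x t);
  ws_dx_low : forall T : R, 0 < T ->
    {ae mu, forall t : R, 0 <= t <= T ->
      wderivable M (fun x => r x t ^+ (n - 2)%N * u x t) /\
      wderivable M (fun x => r x t ^+ n.-1)} /\
    (LooLp M T (n%:R - 2%:R^-1)%:E
      (wderivx M (fun x t => r x t ^+ (n - 2)%N * u x t)) /\
     LooLp M T (n%:R - 2%:R^-1)%:E
      (wderivx M (fun x t => r x t ^+ n.-1)));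
  ws_dx_high : forall T : R, 0 < T ->
    (forall t : R, 0 <= t <= T ->
      wderivable M (fun x => r x t ^+ n.-1 * u x t)) /\
    (LooLp M T +oo%E (wderivx M (fun x t => r x t ^+ n.-1 * u x t)) /\
     ChalfLp M T 2%:E (wderivx M (fun x t => r x t ^+ n.-1 * u x t)));
  ws_radius : forall x t : R, 0 <= x <= M -> 0 <= t ->
    0 <= r x t /\
    r x t ^+ n = n%:R * (\int[mu]_(y in `[0, x]) (rho y t)^-1)%R;
  ws_init : {ae mu, forall x : R, 0 <= x <= M ->
    rho x 0 = rho0 x /\ r x 0 = lag_radius rho0 x};
  ws_momentum : forall psi : R -> R -> R, test_fun2 M psi ->
    weak_momentum F u0 rho u r psi }.

(* The a priori bounds, with generic constant [C]. The generic chain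
   "|u/r| <= C |v| <= C eps0" is read as |u/r| <= C |v| and |v| <= C eps0. *)
Definition solution_bounds (C eps0 : R) (rhoi : R -> R)
    (rho u r : R -> R -> R) : Prop :=
  forall t : R, 0 <= t ->
  [/\ forall x : R, 0 <= x <= M ->
        rhomin rhoi / 2%:R <= rho x t <= 3%:R / 2%:R * rhomax rhoi,
      forall x : R, 0 <= x <= M -> C^-1 * x <= r x t ^+ n <= C * x,
      (normLp I +oo (fun x => u x t / r x t)%R <=
       C%:E * normLp I +oo (wderiv M (fun x => r x t ^+ n.-1 * u x t)%R))%E,
      (normLp I +oo (wderiv M (fun x => r x t ^+ n.-1 * u x t)%R)
       <= (C * eps0)%:E)%E &
      (Bfun rhoi (rho^~ t) (u^~ t) (r^~ t) <= (C * eps0 ^+ 2)%:E)%E].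

(* The boundary condition at x = M, read at t = 0 on the initial data, in the
   sense of traces. *)
Definition compatible (F : forcing R) (rho0 u0 : R -> R) : Prop :=
  exists2 g : R -> R,
    {ae mu, forall x : R, 0 <= x <= M ->
      g x = pressure (rho0 x)
        - rho0 x * (visclambda (rho0 x) + 2%:R * viscmu (rho0 x))
          * wderiv M (fun y => lag_radius rho0 y ^+ n.-1 * u0 y) x
        + 2%:R * (n%:R - 1) * viscmu (rho0 x) * (u0 x / lag_radius rho0 x)} &
    g x @[x --> M^'-] --> PGamma F 0.

(* [eps0] is a smallness threshold for global well-posedness, with bounds of
   constant [C]. Without compatibility of the data at (x, t) = (M, 0) no
   solution is C^1 in time with values in L^2 up to t = 0, hence that
   restriction. *)
Definition small_constant (C eps0 : R) (rhoi : R -> R) : Prop :=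
  0 < eps0 /\
  forall (F : forcing R) (rho0 u0 : R -> R),
    admissible_forcing F ->
    in_Lp I 2%:E rho0 -> in_Lp I 2%:E u0 ->
    compatible F rho0 u0 ->
    (forcing_norm F <= eps0%:E)%E ->
    (normLp I +oo (fun x => rho0 x - rhoi x)%R ^+ 2
      + Bfun rhoi rho0 u0 (lag_radius rho0) <= (eps0 ^+ 2)%:E)%E ->
    (exists rho u r : R -> R -> R,
      weak_solution F rho0 u0 rho u r /\ solution_bounds C eps0 rhoi rho u r) /\
    (forall rho u r rho' u' r' : R -> R -> R,
      weak_solution F rho0 u0 rho u r -> solution_bounds C eps0 rhoi rho u r ->
      weak_solution F rho0 u0 rho' u' r' ->
      solution_bounds C eps0 rhoi rho' u' r' ->
      ae_xt M (fun x t =>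
        [/\ rho x t = rho' x t, u x t = u' x t & r x t = r' x t])).

Definition distance2 (rho1 u1 r1 rho2 u2 r2 : R -> R) : \bar R :=
  (\int[mu]_(x in I)
    ((u1 x - u2 x) ^+ 2 + (rho1 x - rho2 x) ^+ 2
     + x `^ (- (2%:R / n%:R)) * (r1 x - r2 x) ^+ 2)%:E)%E.

End Model.

(* Main.v *)
Require Import Defs.
From HB Require Import structures.
From mathcomp Require Import all_boot all_order all_algebra.
From mathcomp Require Import all_classical all_reals all_analysis.
From mathcomp Require Import measurable_realfun ess_sup_inf.
From mathcomp Require Import ring lra.

Set Implicit Arguments.
Unset Strict Implicit.
Unset Printing Implicit Defensive.

Import Order.TTheory GRing.Theory Num.Theory.
Import numFieldNormedType.Exports.

Local Open Scope classical_set_scope.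
Local Open Scope ring_scope.

(** Two solutions are compared by an energy estimate. Write [w = u1 - u2] and
    consider, for a cut-off [eps > 0] of the weight near the centre,
      [E(t) = int_0^M (w^2 + (rho1 - rho2)^2 + 1_(x > eps) x^(-2/n) (r1 - r2)^2)].
    With [Y] and [U] the scaled velocity variables defined below, [E'] is at
    most [-k int ((Y1 - Y2)^2 + (U1 - U2)^2)] plus terms that are bilinear in
    the differences of the two states, hence can be absorbed: for almost
    every [t],
      [E' <= K (1 + m(t)^2) (E + c eps)],  [m] the bound of the derivatives of
    the force. As [m] is square integrable, Gronwall's inequality ([gronwall],
    [energy_growth]) gives [E(t) <= exp (K (t + N^2)) (E(0) + c eps)], and [eps]
    tends to [0] on the left-hand side by Fatou's lemma ([distance2_le]).

    Testing the difference of the momentum equations against [w] needs some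
    care, since [w] is no test function and the stress is merely bounded.
    - Test functions [phi (x) eta (t)] and the continuity in time of the
      solutions give the equation at each time, tested with [phi] only
      ([weak_momentum_at]). The value of [phi] at the free boundary carries the
      external pressure, which is rewritten as a bulk integral
      ([area_boundary]). The equation then reads [int (A phi' + B phi) = 0].
    - As [phi] vanishes near [0] but is free at [M], this means that [A] is a.e.
      the primitive of [B] that vanishes at [M] ([du_bois_reymond]).
    - The velocity is [r^(1-n)] times a primitive of the bounded function
      [(r^(n-1) u)_x] ([wderiv_prim], [velocity_version]), so that the product
      rule for absolutely continuous functions ([primM]) applies to [A w] on
      every [[d, M]]. The boundary term at [d] vanishes with [d] because
      [u = O(x^(1/n))]: the difference of the two equations does no work on [w]
      ([no_net_work]).

    All the integrands become uniform up to the centre in the scaled variables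
    [X = x^(1/n)], [R = r / X], [U = u / X], [Y = X^(n-1) u_x]: the a priori
    bounds say that [(rho, R, Y, U)] stays in a fixed box ([scaled_box]), on
    which the fluxes are Lipschitz. In these variables the viscous terms form the
    quadratic form [2 mu (p^2 + (n-1) q^2) + lambda (p + (n-1) q)^2], positive
    definite as [c1 > 0] and [2 c1 + n c2 > 0] ([elliptic], [dissipation]), and
    the required inequality between the integrands becomes a pointwise one on
    the box ([energy_pointwise], [energy_at]). *)

(** * Integrals of real functions on the line *)

Section Integrals.
Context {R : realType}.
Local Notation mu := (@lebesgue_measure R).
Implicit Types (D : set R) (f g h : R -> R).

Lemma aeS (P Q : set R) : (forall x, P x -> Q x) ->
  {ae mu, forall x, P x} -> {ae mu, forall x, Q x}.
Proof. by apply: filterS; exact: (ae_filter_ringOfSetsType mu). Qed.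

Lemma aeS2 (P Q S : set R) : (forall x, P x -> Q x -> S x) ->
  {ae mu, forall x, P x} -> {ae mu, forall x, Q x} -> {ae mu, forall x, S x}.
Proof. by apply: filterS2; exact: (ae_filter_ringOfSetsType mu). Qed.

Lemma aeS3 (P Q S T : set R) : (forall x, P x -> Q x -> S x -> T x) ->
  {ae mu, forall x, P x} -> {ae mu, forall x, Q x} -> {ae mu, forall x, S x} ->
  {ae mu, forall x, T x}.
Proof. by apply: filterS3; exact: (ae_filter_ringOfSetsType mu). Qed.

Lemma aeI (P Q : set R) : {ae mu, forall x, P x} -> {ae mu, forall x, Q x} ->
  {ae mu, forall x, P x /\ Q x}.
Proof. by apply: aeS2 => x Px Qx; split. Qed.

Lemma aeI3 (P Q S : set R) : {ae mu, forall x, P x} -> {ae mu, forall x, Q x} ->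
  {ae mu, forall x, S x} -> {ae mu, forall x, [/\ P x, Q x & S x]}.
Proof. by apply: aeS3 => x Px Qx Sx; split. Qed.

Lemma aeW (P : set R) : (forall x, P x) -> {ae mu, forall x, P x}.
Proof. by move=> h; exists set0; split=> // x /=; case. Qed.

Lemma ae_neq (c : R) : {ae mu, forall x, x != c}.
Proof.
exists [set c]; split => //; first by rewrite lebesgue_measure_set1.
by move=> x /= /negP; rewrite negbK => /eqP.
Qed.

Definition intg D f : Prop := mu.-integrable D (EFin \o f).

Lemma intgm D f : intg D f -> measurable_fun D f.
Proof. by move=> /(measurable_int mu) /measurable_EFinP. Qed.

Lemma le_intg D f g : measurable D -> measurable_fun D f -> intg D g ->
  {ae mu, forall x, D x -> `|f x| <= g x} -> intg D f.
Proof.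
move=> mD mf ig fg; apply/integrableP; split; first exact/measurable_EFinP.
have /integrableP[mg oog] := ig.
apply: le_lt_trans oog; apply: ae_ge0_le_integral => //=.
- apply/measurable_EFinP; exact: measurableT_comp mf.
- by apply/measurable_EFinP; apply: measurableT_comp => //; exact: intgm ig.
- apply: aeS fg => x + Dx => /(_ Dx) fg; rewrite lee_fin.
  by rewrite (le_trans fg)// ler_norm.
Qed.

Lemma intg_cst D k : measurable D -> (mu D < +oo)%E -> intg D (fun=> k).
Proof.
move=> mD Doo; apply: measurable_bounded_integrable => //.
by exists `|k|; split => // M kM x _ /=; rewrite ltW.
Qed.

Lemma bnd_intg D f K : measurable D -> (mu D < +oo)%E -> measurable_fun D f ->
  {ae mu, forall x, D x -> `|f x| <= K} -> intg D f.
Proof. by move=> mD Doo mf fK; apply: (le_intg mD mf (intg_cst K mD Doo)). Qed.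

Lemma intgD D f g : measurable D -> intg D f -> intg D g ->
  intg D (fun x => f x + g x).
Proof.
by move=> mD hf hg; exact: (@integrableD _ _ _ mu _ mD _ _ hf hg).
Qed.

Lemma intgB D f g : measurable D -> intg D f -> intg D g ->
  intg D (fun x => f x - g x).
Proof.
by move=> mD hf hg; exact: (@integrableB _ _ _ mu _ mD _ _ hf hg).
Qed.

Lemma intgZ D f k : measurable D -> intg D f -> intg D (fun x => k * f x).
Proof.
by move=> mD hf; exact: (@integrableZl _ _ _ mu _ mD k _ hf).
Qed.

Lemma intg_norm D f : measurable D -> intg D f -> intg D (fun x => `|f x|).
Proof. by move=> mD hf; exact: integrable_norm. Qed.

Lemma intgS (A B : set R) f : measurable A -> measurable B -> B `<=` A ->
  intg A f -> intg B f.
Proof. exact: (@integrableS _ _ _ mu). Qed.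

Lemma intgM D f g K : measurable D -> intg D f -> measurable_fun D g ->
  {ae mu, forall x, D x -> `|g x| <= K} -> intg D (fun x => f x * g x).
Proof.
move=> mD hf mg gK.
apply: (le_intg mD _ (intgZ K mD (intg_norm mD hf))).
  by apply: measurable_funM => //; exact: intgm.
apply: aeS gK => x + Dx => /(_ Dx) gK.
by rewrite normrM mulrC ler_wpM2r.
Qed.

Lemma eq_intg D f g : measurable D -> {in D, f =1 g} -> intg D f -> intg D g.
Proof.
by move=> mD fg; apply: (@eq_integrable _ _ _ mu _ mD (EFin \o f)) => x xD /=; rewrite fg.
Qed.

Lemma ae_eq_Rint D f g : measurable D -> measurable_fun D f ->
  measurable_fun D g -> {ae mu, forall x, D x -> f x = g x} ->
  \int[mu]_(x in D) f x = \int[mu]_(x in D) g x.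
Proof.
move=> mD mf mg fg; rewrite /Rintegral; congr fine.
apply: ae_eq_integral => //; [exact/measurable_EFinP|exact/measurable_EFinP|].
by apply: aeS fg => x + Dx => /(_ Dx) ->.
Qed.

Lemma ae_le_Rint D f g : measurable D -> intg D f -> intg D g ->
  {ae mu, forall x, D x -> f x <= g x} ->
  \int[mu]_(x in D) f x <= \int[mu]_(x in D) g x.
Proof.
move=> mD hf hg fg.
(* an integrable function that is above [f] everywhere and equal to [g] a.e. *)
have hm : intg D (fun x => Num.max (f x) (g x)).
  apply: (le_intg mD _ (intgD mD (intg_norm mD hf) (intg_norm mD hg))).
    by apply: measurable_maxr; exact: intgm.
  apply: aeW => x _.
  by rewrite maxEle; case: ifP => _; rewrite ?lerDl ?lerDr normr_ge0.
apply: (@le_trans _ _ (\int[mu]_(x in D) Num.max (f x) (g x))).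
  by apply: le_Rintegral => // x _; rewrite le_max lexx.
rewrite (@ae_eq_Rint _ _ g)//; [exact: intgm|exact: intgm|].
by apply: aeS fg => x + Dx => /(_ Dx) fg; rewrite max_r.
Qed.

Lemma norm_Rint_le D f g : measurable D -> intg D f -> intg D g ->
  {ae mu, forall x, D x -> `|f x| <= g x} ->
  `|\int[mu]_(x in D) f x| <= \int[mu]_(x in D) g x.
Proof.
move=> mD hf hg fg; apply: (le_trans (le_normr_Rintegral _ _)) => //.
by apply: ae_le_Rint => //; exact: intg_norm.
Qed.

Lemma subitv (a b c d : R) : a <= c -> d <= b -> `[c, d] `<=` `[a, b].
Proof.
move=> ac db x /=; rewrite !in_itv/= => /andP[cx xd].
by rewrite (le_trans ac)// (le_trans xd).
Qed.

Lemma mu_itvcc (a b : R) : a <= b -> mu `[a, b] = (b - a)%:E.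
Proof.
move=> ab; rewrite lebesgue_measure_itv/= lte_fin.
by case: ltgtP ab => // -> _; rewrite subrr.
Qed.

Lemma mu_itv_lty (a b : R) : (mu `[a, b] < +oo)%E.
Proof.
rewrite lebesgue_measure_itv/=; case: ifP => _; last by rewrite ltey.
by rewrite -EFinB ltey.
Qed.

Lemma Rint_cst_itv (a b k : R) : a <= b ->
  \int[mu]_(x in `[a, b]) (fun=> k) x = k * (b - a).
Proof.
move=> ab; rewrite Rintegral_cst//; congr (k * _).
exact: (congr1 fine (mu_itvcc ab)).
Qed.

Lemma Rint_pt (a : R) f : \int[mu]_(x in `[a, a]) f x = 0.
Proof. by rewrite set_itv1 Rintegral_set1. Qed.

Lemma Rint_chasles (a b c : R) f : a <= b -> b <= c -> intg `[a, c] f ->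
  \int[mu]_(x in `[a, c]) f x =
  \int[mu]_(x in `[a, b]) f x + \int[mu]_(x in `[b, c]) f x.
Proof.
move=> ab bc hf; have := @Rintegral_itvB R f (BLeft a) (BRight c) b.
move=> /(_ hf); rewrite !bnd_simp => /(_ ab bc).
rewrite Rintegral_itv_obnd_cbnd => [<-|]; first by rewrite addrC subrK.
by apply: integrableS hf => //; move=> x /=; rewrite !in_itv/= => /andP[bx ->];
  rewrite (le_trans ab)//= ltW.
Qed.

Lemma Rint_oo_cc (a b : R) f : measurable_fun `]a, b[ f ->
  \int[mu]_(x in `]a, b[) f x = \int[mu]_(x in `[a, b]) f x.
Proof.
move=> mf; rewrite /Rintegral; congr fine.
transitivity (\int[mu]_(x in `]a, b[) (EFin \o f) x)%E => //.
by rewrite -(@integral_itv_bndoo _ _ _ _ true false)//; exact/measurable_EFinP.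
Qed.

(** At Lebesgue points [f] is the derivative of its primitive, which is the
    zero function. *)
Lemma ae0_of_Rint0 (a b : R) f : intg `[a, b] f ->
  (forall x, a <= x <= b -> \int[mu]_(y in `[a, x]) f y = 0) ->
  {ae mu, forall x, a <= x <= b -> f x = 0}.
Proof.
move=> hf F0; pose g := f \_ `[a, b].
have locg : locally_integrable setT g by exact: integrable_locally.
have ig : intg setT g.
  by rewrite /intg /g -restrict_EFin; apply/(integrable_mkcond _ _).1.
have := lebesgue_differentiation locg; apply: aeS3 (ae_neq a) (ae_neq b) => x xa xb.
move=> lx /andP[]; rewrite le_eqVlt eq_sym (negbTE xa)/= => ax.
rewrite le_eqVlt (negbTE xb)/= => xltb.
have [||dF F'] := @FTC1_lebesgue_pt R g (BLeft a) x b xltb _ _ lx.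
- by apply: intgS ig.
- by first [exact: (ltW ax) | rewrite (@lte_fin R) | rewrite /Order.lt/= ltW].
have <- : g x = f x by rewrite /g patchE mem_set//= in_itv/= !ltW.
rewrite -F'; set F := (X in derive1 X); rewrite derive1E.
have FE : \forall y \near x, F y = cst 0 y.
  near=> y.
  have ay : a <= y by apply/ltW; near: y; exact: lt_nbhsr.
  have yb : y <= b by apply/ltW; near: y; exact: lt_nbhsl.
  rewrite /F/= -[RHS](F0 y) ?ay//; apply: eq_Rintegral => z; rewrite inE/= in_itv/=.
  by move=> /andP[az zy]; rewrite /g patchE mem_set//= in_itv/= az (le_trans zy).
by rewrite (near_eq_derive _ FE) ?oner_neq0// derive_cst.
Unshelve. all: by end_near. Qed.

End Integrals.

(** * Absolutely continuous functions *)

Section Primitives.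
Context {R : realType}.
Local Notation mu := (@lebesgue_measure R).
Implicit Types (g h k : R -> R) (c d e x y : R).

(** Absolute continuity on [[c, d]], encoded by the integral formula rather than
    by differentiability a.e. *)
Definition prim (c d : R) g g' : Prop :=
  intg `[c, d] g' /\ forall x y, c <= x -> x <= y -> y <= d ->
    g y - g x = \int[mu]_(s in `[x, y]) g' s.

(** Over a subdivision into [N] equal steps the bounds telescope to
    [(d - c) / N * (m d - m c)]. In the product and chain rules this replaces
    the differentiation of absolutely continuous functions a.e. *)
Lemma eq_of_small_increments (c d : R) h (m : R -> R) : c <= d ->
  (forall x y, c <= x -> x <= y -> y <= d ->
     `|h y - h x| <= (y - x) * (m y - m x)) -> h d = h c.
Proof.
move=> cd hm.
have cdge0 : 0 <= d - c by rewrite subr_ge0.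
have key (N : nat) : `|h d - h c| <= (d - c) / N.+1%:R * (m d - m c).
  pose e := (d - c) / N.+1%:R.
  have e0 : 0 <= e by rewrite divr_ge0.
  have eN : N.+1%:R * e = d - c by rewrite /e mulrC divfK.
  have H (i : nat) : (i <= N.+1)%N ->
      `|h (c + i%:R * e) - h c| <= e * (m (c + i%:R * e) - m c).
    elim: i => [|i IH] iN; first by rewrite mul0r addr0 !subrr normr0 mulr0.
    have := IH (ltnW iN); set x := c + i%:R * e; set y := c + i.+1%:R * e.
    have yx : y = x + e by rewrite /y /x -natr1; ring.
    have cx : c <= x by rewrite lerDl mulr_ge0.
    have xy : x <= y by rewrite yx lerDl.
    have yd : y <= d.
      by rewrite -lerBrDl -eN ler_wpM2r// ler_nat.
    have := hm x y cx xy yd; rewrite {1 2}yx.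
    have -> : x + e - x = e by ring.
    have -> : h y - h c = (h y - h x) + (h x - h c) by ring.
    move=> h1 h2; rewrite (le_trans (ler_normD _ _))//.
    have -> : e * (m y - m c) = e * (m y - m x) + e * (m x - m c) by ring.
    by rewrite -yx in h1; exact: lerD.
  by have := H N.+1 (leqnn _); rewrite eN subrKC.
apply/eqP; rewrite -subr_eq0 -normr_le0; apply/ler_addgt0Pl => e e0.
rewrite addr0; set B := (d - c) * (m d - m c).
have BN := @truncnS_gt R (`|B| / e); set N := Num.trunc (`|B| / e) in BN.
apply: (le_trans (key N)).
rewrite mulrAC -/B ler_pdivrMr// (le_trans (ler_norm _))//.
by rewrite mulrC -ler_pdivrMr// ltW.
Qed.

Lemma prim_sub c d c' d' g g' : c <= c' -> d' <= d ->
  prim c d g g' -> prim c' d' g g'.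
Proof.
move=> cc dd [ig hg]; split.
  by apply: intgS ig => //; exact: subitv.
move=> x y cx xy yd; apply: hg => //; first exact: le_trans cx.
exact: le_trans dd.
Qed.

Lemma prim_Rint c d g' : intg `[c, d] g' ->
  prim c d (fun x => \int[mu]_(s in `[c, x]) g' s) g'.
Proof.
move=> ig; split => // x y cx xy yd.
rewrite (@Rint_chasles _ c x y)//; first by ring.
by apply: intgS ig => //; exact: subitv.
Qed.

Lemma prim_Rint_tail c d g' : intg `[c, d] g' ->
  prim c d (fun x => - \int[mu]_(s in `[x, d]) g' s) g'.
Proof.
move=> ig; split => // x y cx xy yd.
rewrite (@Rint_chasles _ x y d)// ?opprK; first by ring.
by apply: intgS ig => //; exact: subitv.
Qed.

Lemma prim_cont c d g g' : prim c d g g' -> {within `[c, d], continuous g}.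
Proof.
move=> [ig hg]; have [cd|dc] := leP c d; last first.
  rewrite set_itv_ge; first exact: continuous_subspace0.
  by rewrite bnd_simp -ltNge.
have := parameterized_integral_continuous cd ig.
move=> h; apply: (@subspace_eq_continuous _ _ _
    (fun x => g c + \int[mu]_(s in `[c, x]) g' s)).
  move=> x; rewrite inE/= in_itv/= => /andP[cx xd].
  by rewrite -hg// subrKC.
move=> x; apply: cvgD; first exact: cvg_cst.
exact: h.
Qed.

Lemma prim_meas c d g g' : prim c d g g' -> measurable_fun `[c, d] g.
Proof. by move=> /prim_cont h; exact: subspace_continuous_measurable_fun. Qed.

Lemma prim_osc c d g g' x y : prim c d g g' -> c <= x -> x <= y -> y <= d ->
  `|g y - g x| <= \int[mu]_(s in `[x, y]) `|g' s|.
Proof.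
move=> [ig hg] cx xy yd; rewrite hg//; apply: le_normr_Rintegral => //.
by apply: intgS ig => //; exact: subitv.
Qed.

Lemma prim_bnd c d g g' : prim c d g g' ->
  exists2 K, 0 <= K & forall x, c <= x <= d -> `|g x| <= K.
Proof.
move=> pg; exists (`|g c| + \int[mu]_(s in `[c, d]) `|g' s|).
  by rewrite addr_ge0// Rintegral_ge0.
move=> x /andP[cx xd]; rewrite -[g x](subrKC (g c)).
rewrite (le_trans (ler_normD _ _))// lerD2l.
rewrite (le_trans (prim_osc pg _ cx xd))//.
have ig := intg_norm (measurable_itv _) (proj1 pg).
by rewrite (@Rint_chasles _ c x d)// lerDl Rintegral_ge0.
Qed.

Lemma prim_lip c d g g' L x y : prim c d g g' -> 0 <= L ->
  (forall s, c <= s <= d -> `|g' s| <= L) ->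
  c <= x -> x <= y -> y <= d -> `|g y - g x| <= L * (y - x).
Proof.
move=> pg L0 hL cx xy yd; rewrite (le_trans (prim_osc pg cx xy yd))//.
have ig := intg_norm (measurable_itv _) (proj1 pg).
rewrite -Rint_cst_itv//; apply: ae_le_Rint => //.
- by apply: intgS ig => //; exact: subitv.
- by apply: intg_cst => //; exact: mu_itv_lty.
- apply: aeW => s /=; rewrite in_itv/= => /andP[xs sy].
  by apply: hL; rewrite (le_trans cx)//= (le_trans sy).
Qed.

Lemma prim_ext c d g g' k k' : prim c d g g' ->
  (forall x, c <= x <= d -> g x = k x) -> measurable_fun `[c, d] k' ->
  {ae mu, forall x, c <= x <= d -> g' x = k' x} -> prim c d k k'.
Proof.
move=> [ig hg] gk mk gk'.
have ik : intg `[c, d] k'.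
  apply: (le_intg _ mk (intg_norm _ ig)) => //.
  by apply: aeS gk' => x; rewrite /= in_itv/= => + /[dup] h => /(_ h) ->.
split => // x y cx xy yd.
have cy := le_trans cx xy; have xd := le_trans xy yd.
rewrite -(gk y) ?cy// -(gk x) ?cx//.
rewrite hg//; have sxy := subitv cx yd.
apply: ae_eq_Rint => //; [exact: measurable_funS (intgm ig)|
  exact: measurable_funS mk|].
apply: aeS gk' => s + /=; rewrite in_itv/= => + /andP[xs sy]; apply.
by rewrite (le_trans cx)//= (le_trans sy).
Qed.

Lemma prim_cst c d (k : R) : prim c d (fun=> k) (fun=> 0).
Proof.
split; first by apply: intg_cst => //; exact: mu_itv_lty.
by move=> x y _ xy _; rewrite Rint_cst_itv// mul0r subrr.
Qed.

Lemma primD c d g g' h h' : prim c d g g' -> prim c d h h' ->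
  prim c d (fun x => g x + h x) (fun x => g' x + h' x).
Proof.
move=> [ig hg] [ih hh]; split; first exact: intgD.
move=> x y cx xy yd; have sxy := subitv cx yd.
rewrite RintegralD//; [|exact: intgS ig|exact: intgS ih].
by rewrite -hg// -hh//; ring.
Qed.

Lemma primZ c d g g' (a : R) : prim c d g g' ->
  prim c d (fun x => a * g x) (fun x => a * g' x).
Proof.
move=> [ig hg]; split; first exact: intgZ.
move=> x y cx xy yd; have sxy := subitv cx yd.
by rewrite RintegralZl//; [rewrite -hg// mulrBr|exact: intgS ig].
Qed.

Lemma primB c d g g' h h' : prim c d g g' -> prim c d h h' ->
  prim c d (fun x => g x - h x) (fun x => g' x - h' x).
Proof.
move=> pg /(primZ (-1)) /(primD pg).
by under eq_fun do rewrite mulN1r; under [X in prim _ _ _ X]eq_fun do rewrite mulN1r.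
Qed.

Lemma prim_continuous_FTC c d g g' : c <= d ->
  (forall x, c <= x <= d -> is_derive x 1 g (g' x)) ->
  {within `[c, d], continuous g'} -> prim c d g g'.
Proof.
move=> cd dg cg'; split.
  by apply: continuous_compact_integrable => //; exact: segment_compact.
move=> x y cx xy yd; have := xy; rewrite le_eqVlt => /predU1P[->|ltxy].
  by rewrite Rint_pt subrr.
have cg z : c <= z <= d -> {for z, continuous g}.
  move=> /dg [dz _]; apply: differentiable_continuous.
  exact/derivable1_diffP.
have xcd : c <= x <= d by rewrite cx (le_trans xy).
have ycd : c <= y <= d by rewrite yd (le_trans cx).
rewrite /Rintegral (@continuous_FTC2 _ g' g x y)//.
- by apply: continuous_subspaceW cg'; exact: subitv.
- split.
  + move=> z; rewrite in_itv/= => /andP[xz zy].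
    have /dg[] // : c <= z <= d.
    by rewrite (le_trans cx (ltW xz)) (le_trans (ltW zy)).
  + by apply: cvg_at_right_filter; exact: cg.
  + by apply: cvg_at_left_filter; exact: cg.
- move=> z; rewrite in_itv/= => /andP[xz zy].
  have /dg[_] : c <= z <= d.
    by rewrite (le_trans cx (ltW xz)) (le_trans (ltW zy)).
  by rewrite derive1E.
Qed.

(** Product rule when one factor is Lipschitz: the defect of the integral formula
    on [[a, b]] is at most [2 L (b - a)] times the integral of [`|g'|], to which
    [eq_of_small_increments] applies. *)
Lemma primM c d g g' h h' L : prim c d g g' -> prim c d h h' ->
  (forall s, c <= s <= d -> `|h' s| <= L) ->
  prim c d (fun x => g x * h x) (fun x => g' x * h x + g x * h' x).
Proof.
move=> pg ph hL; have [dc|cd] := ltP d c.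
  split.
    by rewrite /intg set_itv_ge ?bnd_simp -?ltNge//; exact: integrable_set0.
  move=> x y cx xy yd; exfalso; move: dc; rewrite ltNge => /negP; apply.
  by rewrite (le_trans cx)// (le_trans xy).
have L0 : 0 <= L by rewrite (le_trans (normr_ge0 _) (hL c _))// lexx.
have [Kg Kg0 gK] := prim_bnd pg; have [Kh Kh0 hK] := prim_bnd ph.
have ig'h : intg `[c, d] (fun x => g' x * h x).
  apply: (@intgM _ _ _ _ Kh) => //; [exact: (proj1 pg)|exact: prim_meas ph|].
  by apply: aeW => x /=; rewrite in_itv/=; exact: hK.
have igh' : intg `[c, d] (fun x => g x * h' x).
  have : intg `[c, d] (fun x => h' x * g x).
    apply: (@intgM _ _ _ _ Kg) => //; [exact: (proj1 ph)|exact: prim_meas pg|].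
    by apply: aeW => x /=; rewrite in_itv/=; exact: gK.
  by apply: eq_intg => // x _; rewrite mulrC.
have iF := intgD (measurable_itv _) ig'h igh'.
split=> // x y cx xy yd.
set F := fun x => g' x * h x + g x * h' x.
have cy := le_trans cx xy; have xd := le_trans xy yd.
have ig'n := intg_norm (measurable_itv _) (proj1 pg).
suff H : g y * h y - \int[mu]_(s in `[c, y]) F s
       = g x * h x - \int[mu]_(s in `[c, x]) F s.
  have := proj2 (prim_Rint iF) x y cx xy yd; rewrite -/F => <-.
  by rewrite -[g y * h y](subrK (\int[mu]_(s in `[c, y]) F s)) H; ring.
apply: (@eq_of_small_increments x y
  (fun z => g z * h z - \int[mu]_(s in `[c, z]) F s)
  (fun z => 2%:R * L * \int[mu]_(s in `[c, z]) `|g' s|)) => //.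
move=> a b xa ab yb.
have ca := le_trans cx xa; have bd := le_trans yb yd.
have ad := le_trans ab bd; have cb := le_trans ca ab.
have sab := subitv ca bd.
have [ig hg] := pg; have [ih hh] := ph.
have -> : g b * h b - \int[mu]_(s in `[c, b]) F s -
   (g a * h a - \int[mu]_(s in `[c, a]) F s) =
   (g b - g a) * h a + g b * (h b - h a) -
   (\int[mu]_(s in `[c, b]) F s - \int[mu]_(s in `[c, a]) F s) by ring.
have := proj2 (prim_Rint iF) a b ca ab bd; rewrite -/F => ->.
have -> : 2%:R * L * \int[mu]_(s in `[c, b]) `|g' s| -
   2%:R * L * \int[mu]_(s in `[c, a]) `|g' s| =
   2%:R * L * \int[mu]_(s in `[a, b]) `|g' s|.
  by rewrite -mulrBr (proj2 (prim_Rint ig'n) a b).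
have iab k : intg `[c, d] k -> intg `[a, b] k by move=> ?; exact: intgS sab _.
rewrite hg// hh//.
rewrite -(RintegralZr (h a))//; last exact: iab.
rewrite -(RintegralZl (g b))//; last exact: iab.
rewrite -RintegralD//; last 2 first.
- by apply: iab; have := intgZ (h a) (measurable_itv _) ig;
    apply: eq_intg => // z _; rewrite mulrC.
- by apply: iab; exact: intgZ.
rewrite -RintegralB//; last 2 first.
- apply: (@intgD _ `[a, b] (fun s => g' s * h a) (fun s => g b * h' s)) => //.
    by apply: iab; have := intgZ (h a) (measurable_itv _) ig;
      apply: eq_intg => // z _; rewrite mulrC.
  by apply: iab; exact: intgZ.
- exact: iab.
set m := \int[mu]_(s in `[a, b]) `|g' s|.
have -> : (b - a) * (2%:R * L * m) =
    L * (b - a) * m + (L * m) * (b - a) by ring.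
rewrite -(RintegralZl (L * (b - a)))//; last exact: iab.
rewrite -(Rint_cst_itv (L * m))// -RintegralD//; last 2 first.
- by apply: intgZ => //; exact: iab.
- by apply: intg_cst => //; exact: mu_itv_lty.
apply: norm_Rint_le => //.
- apply: intgB => //; last exact: iab.
  apply: intgD => //; apply: iab; last exact: intgZ.
  by have := intgZ (h a) (measurable_itv _) ig;
    apply: eq_intg => // z _; rewrite mulrC.
- apply: intgD => //; first by apply: intgZ => //; exact: iab.
  by apply: intg_cst => //; exact: mu_itv_lty.
apply: aeW => s /=; rewrite in_itv/= => /andP[sa sb].
have -> : g' s * h a + g b * h' s - F s =
   - (g' s * (h s - h a)) + (g b - g s) * h' s by rewrite /F; ring.
rewrite (le_trans (ler_normD _ _))// normrN !normrM.
have cs := le_trans ca sa; have sd := le_trans sb bd.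
have b1 : `|h s - h a| <= L * (b - a).
  rewrite (le_trans (prim_lip ph L0 hL ca sa sd))// ler_wpM2l// lerB//.
have b2 : `|g b - g s| <= m.
  rewrite (le_trans (prim_osc pg cs sb bd))// /m (@Rint_chasles _ a s b)//.
    by rewrite lerDr Rintegral_ge0.
  exact: iab.
have b3 : `|h' s| <= L by rewrite hL// cs.
rewrite lerD//; first by rewrite mulrC ler_wpM2r.
by rewrite [leRHS]mulrC ler_pM.
Qed.

(** Chain rule, by the same argument with a quadratic defect. The Taylor bound on
    [phi] is asked on a set [S] that contains the values of [g], so that
    powers and inverses are covered away from [0]. *)
Lemma prim_comp c d g g' (S : set R) (phi dphi : R -> R) (K L : R) :
  prim c d g g' -> 0 <= K ->
  (forall s, c <= s <= d -> `|g' s| <= L) ->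
  (forall s, c <= s <= d -> S (g s)) ->
  (forall a b, S a -> S b ->
     `|phi b - phi a - dphi a * (b - a)| <= K * (b - a) ^+ 2 /\
     `|dphi b - dphi a| <= K * `|b - a|) ->
  measurable_fun `[c, d] (dphi \o g) ->
  prim c d (phi \o g) (fun x => dphi (g x) * g' x).
Proof.
move=> pg K0 hL gS hphi mdphi; have [dc|cd] := ltP d c.
  split.
    by rewrite /intg set_itv_ge ?bnd_simp -?ltNge//; exact: integrable_set0.
  move=> x y cx xy yd; exfalso; move: dc; rewrite ltNge => /negP; apply.
  by rewrite (le_trans cx)// (le_trans xy).
have L0 : 0 <= L by rewrite (le_trans (normr_ge0 _) (hL c _))// lexx.
have [Kg Kg0 gK] := prim_bnd pg; have [ig hg] := pg.
pose K1 := `|dphi (g c)| + K * (Kg + Kg).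
have dK s : c <= s <= d -> `|dphi (g s)| <= K1.
  move=> csd; rewrite -[dphi (g s)](subrKC (dphi (g c))).
  have ccd : c <= c <= d by rewrite lexx.
  rewrite (le_trans (ler_normD _ _))// lerD2l.
  rewrite (le_trans (proj2 (hphi _ _ (gS _ ccd) (gS _ csd))))// ler_wpM2l//.
  by rewrite (le_trans (ler_normB _ _))// lerD// gK.
have iF : intg `[c, d] (fun x => dphi (g x) * g' x).
  have : intg `[c, d] (fun x => g' x * dphi (g x)).
    apply: (@intgM _ _ _ _ K1) => //.
    by apply: aeW => x /=; rewrite in_itv/=; exact: dK.
  by apply: eq_intg => // x _; rewrite mulrC.
split=> // x y cx xy yd; set F := (fun x => dphi (g x) * g' x).
have cy := le_trans cx xy; have xd := le_trans xy yd.
suff H : phi (g y) - \int[mu]_(s in `[c, y]) F s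
       = phi (g x) - \int[mu]_(s in `[c, x]) F s.
  have := proj2 (prim_Rint iF) x y cx xy yd; rewrite -/F => <-.
  by rewrite /= -[phi (g y)](subrK (\int[mu]_(s in `[c, y]) F s)) H; ring.
apply: (@eq_of_small_increments x y
  (fun z => phi (g z) - \int[mu]_(s in `[c, z]) F s)
  (fun z => 2%:R * K * L ^+ 2 * z)) => //.
move=> a b xa ab yb.
have ca := le_trans cx xa; have bd := le_trans yb yd.
have ad := le_trans ab bd; have cb := le_trans ca ab.
have sab := subitv ca bd.
have iab k : intg `[c, d] k -> intg `[a, b] k by move=> ?; exact: intgS sab _.
have -> : phi (g b) - \int[mu]_(s in `[c, b]) F s -
   (phi (g a) - \int[mu]_(s in `[c, a]) F s) =
   (phi (g b) - phi (g a) - dphi (g a) * (g b - g a)) + (dphi (g a) * (g b - g a) -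
   (\int[mu]_(s in `[c, b]) F s - \int[mu]_(s in `[c, a]) F s)) by ring.
have := proj2 (prim_Rint iF) a b ca ab bd; rewrite -/F => ->.
have acd : c <= a <= d by rewrite ca.
have bcd : c <= b <= d by rewrite cb.
have -> : (b - a) * (2%:R * K * L ^+ 2 * b - 2%:R * K * L ^+ 2 * a) =
  K * (L * (b - a)) ^+ 2 + (K * (L * (b - a)) * L) * (b - a) by ring.
have lipg s t : a <= s -> s <= t -> t <= b -> `|g t - g s| <= L * (b - a).
  move=> as_ st tb; have := prim_lip pg L0 hL (le_trans ca as_) st (le_trans tb bd).
  by move=> /le_trans; apply; rewrite ler_wpM2l// lerB.
rewrite (le_trans (ler_normD _ _))// lerD//.
  rewrite (le_trans (proj1 (hphi _ _ (gS _ acd) (gS _ bcd))))// ler_wpM2l//.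
  rewrite -(real_normK (num_real _)) ler_sqr ?nnegrE//; first exact: lipg.
  by rewrite mulr_ge0// subr_ge0.
rewrite hg// -RintegralZl//; last exact: iab.
rewrite -RintegralB//; [|by apply: iab; exact: intgZ|exact: iab].
rewrite -(Rint_cst_itv (K * (L * (b - a)) * L))//.
apply: norm_Rint_le => //.
- by apply: iab; apply: intgB => //; exact: intgZ.
- by apply: intg_cst => //; exact: mu_itv_lty.
apply: aeW => s /=; rewrite in_itv/= => /andP[sa sb].
have scd : c <= s <= d by rewrite (le_trans ca)//= (le_trans sb).
rewrite /F -mulrBl normrM ler_pM// ?hL//.
rewrite distrC (le_trans (proj2 (hphi _ _ (gS _ acd) (gS _ scd))))//.
by rewrite ler_wpM2l// lipg.
Qed.

Lemma measurable_invr : measurable_fun [set: R] (fun x : R => x^-1).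
Proof.
rewrite -(setvU [set 0 : R]); apply/measurable_funU => //.
  exact: measurableC.
split; last exact: measurable_fun_set1.
apply: open_continuous_measurable_fun.
  by rewrite openC; exact: closed_eq.
move=> x /[!inE]/= /eqP x0; exact: inv_continuous.
Qed.

Lemma measurable_funV (D : set R) g : measurable_fun D g ->
  measurable_fun D (fun x => (g x)^-1).
Proof. exact: measurableT_comp measurable_invr. Qed.

Lemma measurable_fun_powR (D : set R) (p : R) g : measurable_fun D g ->
  measurable_fun D (fun x => g x `^ p).
Proof. exact: measurableT_comp (measurable_powR p). Qed.

Lemma prim_inv c d g g' e L : 0 < e -> prim c d g g' ->
  (forall s, c <= s <= d -> `|g' s| <= L) ->
  (forall s, c <= s <= d -> e <= g s) ->
  prim c d (fun x => (g x)^-1) (fun x => - (g' x / g x ^+ 2)).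
Proof.
move=> e0 pg hL ge.
have inv_le s : e <= s -> s^-1 <= e^-1.
  by move=> es; rewrite lef_pV2// posrE// (lt_le_trans e0).
pose K := e^-1 ^+ 2 * e^-1 + e^-1 * (e^-1 ^+ 2 + e^-1 ^+ 2).
have ei0 : 0 <= e^-1 by rewrite invr_ge0 ltW.
have mgV := measurable_funV (prim_meas pg).
have mg2 : measurable_fun `[c, d] ((fun y : R => - (y^-1 * y^-1)) \o g).
  by rewrite /comp; apply: measurableT_comp => //; exact: measurable_funM.
suff pk : prim c d (fun x => (g x)^-1)
    (fun x => - ((g x)^-1 * (g x)^-1) * g' x).
  apply: (prim_ext pk) => //.
  - apply: measurableT_comp => //; apply: measurable_funM; first exact: intgm (proj1 pg).
    by apply: measurable_funV; apply: measurable_funX; exact: prim_meas pg.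
  - by apply: aeW => x _; rewrite mulNr mulrC expr2 invfM.
apply: (@prim_comp c d g g' [set y | e <= y] (fun y => y^-1)
  (fun y => - (y^-1 * y^-1)) K L) => //.
  by rewrite /K addr_ge0// mulr_ge0// ?addr_ge0// sqr_ge0.
move=> a b /= ea eb; have a0 := lt_le_trans e0 ea; have b0 := lt_le_trans e0 eb.
have ia := inv_le _ ea; have ib := inv_le _ eb.
have ia0 : 0 <= a^-1 by rewrite invr_ge0 ltW.
have ib0 : 0 <= b^-1 by rewrite invr_ge0 ltW.
split.
  have -> : b^-1 - a^-1 - - (a^-1 * a^-1) * (b - a) =
    (a^-1 ^+ 2 * b^-1) * (b - a) ^+ 2 by field; rewrite !gt_eqF.
  rewrite normrM [`|_ ^+ 2|]ger0_norm ?sqr_ge0// ler_wpM2r ?sqr_ge0//.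
  rewrite ger0_norm ?mulr_ge0 ?sqr_ge0// /K.
  apply: (@le_trans _ _ (e^-1 ^+ 2 * e^-1)).
    by rewrite ler_pM ?sqr_ge0// ler_sqr.
  by rewrite lerDl mulr_ge0// addr_ge0// sqr_ge0.
have -> : - (b^-1 * b^-1) - - (a^-1 * a^-1) =
  (a^-1 * (a^-1 * b^-1 + b^-1 * b^-1)) * (b - a) by field; rewrite !gt_eqF.
rewrite normrM ler_wpM2r// ger0_norm ?mulr_ge0 ?addr_ge0 ?mulr_ge0//.
rewrite /K; apply: (@le_trans _ _ (e^-1 * (e^-1 ^+ 2 + e^-1 ^+ 2))).
  by rewrite !expr2 ler_pM// ?addr_ge0 ?mulr_ge0// lerD// ler_pM.
by rewrite lerDr mulr_ge0// sqr_ge0.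
Qed.

End Primitives.

(** * Smooth functions *)

Section Smooth.
Context {R : realType}.
Local Notation mu := (@lebesgue_measure R).
Implicit Types (f g : R -> R) (x : R).

Fixpoint Ck (k : nat) (f : R -> R) : Prop :=
  if k is k'.+1 then (forall x, derivable f x 1) /\ Ck k' (derive1 f) else True.

Definition smooth f := forall k, Ck k f.

Lemma smooth_derivable f x : smooth f -> derivable f x 1.
Proof. by move=> /(_ 1%N)[]. Qed.

Lemma smooth_derive1 f : smooth f -> smooth (derive1 f).
Proof. by move=> h k; have [] := h k.+1. Qed.

Lemma smooth_derive1n f k : smooth f -> smooth (derive1n k f).
Proof. by move=> h; elim: k => // k IH; rewrite derive1nS; exact: smooth_derive1. Qed.

Lemma smooth_is_derive f x : smooth f -> is_derive x 1 f (derive1 f x).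
Proof.
by move=> h; apply: DeriveDef; [exact: smooth_derivable|rewrite derive1E].
Qed.

Lemma smooth_continuous f : smooth f -> continuous f.
Proof.
move=> h x; apply: differentiable_continuous.
exact/derivable1_diffP/smooth_derivable.
Qed.

Lemma derive1_is f df : (forall x, is_derive x 1 f (df x)) -> derive1 f = df.
Proof. by move=> h; apply/funext => x; rewrite derive1E; have [] := h x. Qed.

Lemma CkS k f df : (forall x, is_derive x 1 f (df x)) -> Ck k df -> Ck k.+1 f.
Proof. by move=> h c /=; rewrite (derive1_is h); split => // x; have [] := h x. Qed.

Lemma CkW k f : Ck k.+1 f -> Ck k f.
Proof. by elim: k f => // k IH f [h1 h2]; split => //; exact: IH. Qed.

Lemma Ck_is_derive k f x : Ck k.+1 f -> is_derive x 1 f (derive1 f x).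
Proof. by move=> [h _]; apply: DeriveDef => //; rewrite derive1E. Qed.

Lemma Ck_cst k (c : R) : Ck k (fun=> c).
Proof.
elim: k c => // k IH c; exact: (CkS (df := fun=> 0)).
Qed.

Lemma CkD k f g : Ck k f -> Ck k g -> Ck k (fun x => f x + g x).
Proof.
elim: k f g => // k IH f g cf cg.
apply: (CkS (df := fun x => derive1 f x + derive1 g x)); last first.
  by apply: IH; [exact: (proj2 cf)|exact: (proj2 cg)].
by move=> x; apply: is_deriveD; [exact: Ck_is_derive cf|exact: Ck_is_derive cg].
Qed.

Lemma CkM k f g : Ck k f -> Ck k g -> Ck k (fun x => f x * g x).
Proof.
elim: k f g => // k IH f g cf cg.
apply: (CkS (df := fun x => f x * derive1 g x + g x * derive1 f x)).
  by move=> x; apply: is_deriveM; [exact: Ck_is_derive cf|exact: Ck_is_derive cg].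
have [[_ cf'] [_ cg']] := (cf, cg).
by apply: CkD; apply: IH => //; exact: CkW.
Qed.

Lemma is_derive_affine f df (a b x : R) : is_derive (a * x + b) 1 f df ->
  is_derive x 1 (fun y => f (a * y + b)) (a * df).
Proof.
move=> h.
have hl : is_derive x 1 (fun y : R => a * y + b) a.
  have : is_derive x 1 (fun y : R => a *: (id y) + cst b y) (a *: 1 + 0).
    by apply: is_deriveD; apply: is_deriveZ.
  by rewrite addr0 [a *: 1]mulr1.
by rewrite mulrC; apply: (@is_derive1_comp _ f _ x df a).
Qed.

Lemma Ck_affine k f (a b : R) : Ck k f -> Ck k (fun x => f (a * x + b)).
Proof.
elim: k f => // k IH f cf.
apply: (CkS (df := fun x => a * derive1 f (a * x + b))).
  by move=> x; apply: is_derive_affine; exact: Ck_is_derive cf.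
by apply: CkM; [exact: Ck_cst|apply: IH; exact: (proj2 cf)].
Qed.

(** The functions [x^-m * exp (-1/x)] on the positive axis, extended by [0]: their
    linear combinations are stable under derivation, which makes them smooth. *)
Definition expinv (m : nat) (x : R) : R :=
  if 0 < x then x^-1 ^+ m * expR (- x^-1) else 0.

(** From [exp y >= y^(m+2) / (m+2)!] at [y = 1/x]; the quadratic decay gives a
    zero derivative at the origin. *)
Lemma expinv_le m (x : R) : `|expinv m x| <= (m.+2)`!%:R * x ^+ 2.
Proof.
rewrite /expinv; case: ifPn => [x0|_]; last by rewrite normr0 mulr_ge0// sqr_ge0.
have y0 : 0 < x^-1 by rewrite invr_gt0.
rewrite ger0_norm; last by rewrite mulr_ge0 ?expR_ge0 ?exprn_ge0 ?(ltW y0).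
rewrite expRN ler_pdivrMr ?expR_gt0//.
have h := expR_ge1Dxn m.+1 (ltW y0).
apply: (@le_trans _ _ ((m.+2)`!%:R * x ^+ 2 * (x^-1 ^+ m.+2 / (m.+2)`!%:R))).
  have f0 : (m.+2)`!%:R != 0 :> R by rewrite pnatr_eq0 -lt0n fact_gt0.
  rewrite [leRHS](_ : _ = x^-1 ^+ m)// !(exprS x^-1).
  by set z := x^-1 ^+ m; field; rewrite f0 gt_eqF.
rewrite ler_wpM2l ?mulr_ge0 ?(ltW x0)//.
by apply: le_trans h; rewrite lerDr.
Qed.

Lemma is_derive0_sq f (C : R) : (forall x, `|f x| <= C * x ^+ 2) ->
  is_derive (0 : R) (1 : R) f 0.
Proof.
move=> hf; have f0 : f 0 = 0.
  by apply/eqP; rewrite -normr_le0 (le_trans (hf 0))// expr0n/= mulr0.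
have h : h^-1 *: (f (h *: 1 + 0) - f 0) @[h --> 0^'] --> (0 : R).
  apply: (@cvg_to_0_linear _ _ C 1) => // h /andP[h0 _].
  rewrite addr0 [h *: 1]mulr1 f0 subr0 normrM normfV.
  rewrite ler_pdivrMl// (le_trans (hf h))// -real_normK ?num_real//.
  by rewrite expr2 mulrCA.
apply: DeriveDef; first by apply/cvg_ex; exists 0.
by apply/cvg_lim => //; exact: h.
Qed.

Lemma expinv_is_derive m (x : R) :
  is_derive x 1 (expinv m) (expinv m.+2 x - m%:R * expinv m.+1 x).
Proof.
have [x0|x0|->] := ltgtP x 0.
- rewrite /expinv !ltNge (ltW x0)/= mulr0 subrr.
  apply: (@near_eq_is_derive _ _ _ (cst 0)); rewrite ?oner_neq0//.
  near=> y; rewrite ifF//; apply/negbTE; rewrite -leNgt ltW//.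
  by near: y; exact: lt_nbhsl.
- rewrite /expinv x0.
  set D := (X in is_derive _ _ _ X).
  suff H : is_derive x 1 (fun y : R => y^-1 ^+ m * expR (- y^-1)) D.
    apply: near_eq_is_derive H; near=> y; rewrite ifT//.
    by near: y; exact: lt_nbhsr.
  have dV : is_derive x 1 (fun y : R => y^-1) (- (x ^- 2)).
    have := @is_deriveV R id x 1 1; rewrite /= gt_eqF// => /(_ isT _).
    by rewrite [_ *: 1]mulr1; apply.
  have dE : is_derive x 1 (fun y : R => expR (- y^-1)) (expR (- x^-1) * x ^- 2).
    have -> : expR (- x^-1) * x ^- 2 = expR (- x^-1) * (- - x ^- 2).
      by rewrite opprK.
    apply: (@is_derive1_comp _ expR (fun y => - y^-1)).
  have dX : is_derive x 1 (fun y : R => y^-1 ^+ m) (m%:R * x^-1 ^+ m.-1 * (- x ^- 2)).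
    have h := is_deriveX m dV; rewrite exprfctE in h; exact: h.
  have [d1 d2] := is_deriveM dX dE; apply: DeriveDef; first exact: d1.
  apply: (etrans d2).
  rewrite /D /GRing.scale/= -exprVn; case: m {dX d1 d2 D} => [|m] /=.
    by rewrite !mul0r !mulr0 subr0 expr0 mul1r addr0 mulrC.
  by rewrite !exprS expr0; ring.
- rewrite /expinv ltxx mulr0 subrr; exact: (is_derive0_sq (@expinv_le m)).
Unshelve. all: by end_near. Qed.

Lemma expinv_smooth m : smooth (expinv m).
Proof.
move=> k; elim: k m => // k IH m; apply: (CkS (@expinv_is_derive m)).
apply: CkD => //; under eq_fun do rewrite -mulNr.
by apply: CkM => //; exact: Ck_cst.
Qed.

Lemma smoothM f g : smooth f -> smooth g -> smooth (fun x => f x * g x).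
Proof. by move=> hf hg k; exact: CkM. Qed.

Lemma smoothD f g : smooth f -> smooth g -> smooth (fun x => f x + g x).
Proof. by move=> hf hg k; exact: CkD. Qed.

Lemma smooth_cst (c : R) : smooth (fun=> c).
Proof. by move=> k; exact: Ck_cst. Qed.

Lemma smooth_affine f (a b : R) : smooth f -> smooth (fun x => f (a * x + b)).
Proof. by move=> hf k; exact: Ck_affine. Qed.

Lemma smooth_prim F f : (forall x, is_derive x 1 F (f x)) -> smooth f -> smooth F.
Proof. by move=> h sf [//|k]; apply: (CkS h). Qed.

(** Smooth approximations of the indicator of [a < x], from below as [k]
    grows. *)
Definition step (k : nat) (a x : R) : R := expinv 0 (k.+1%:R * (x - a)).

Lemma step_smooth k a : smooth (step k a).
Proof.
have := @smooth_affine _ k.+1%:R (- (k.+1%:R * a)) (expinv_smooth 0).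
by congr smooth; apply/funext => x; rewrite /step mulrBr.
Qed.

Lemma step_le0 k a x : x <= a -> step k a x = 0.
Proof.
move=> xa; rewrite /step /expinv ifF//; apply/negbTE.
by rewrite -leNgt pmulr_rle0// subr_le0.
Qed.

Lemma step_ge0 k a x : 0 <= step k a x.
Proof. by rewrite /step /expinv; case: ifP => // _; rewrite mul1r expR_ge0. Qed.

Lemma step_le1 k a x : step k a x <= 1.
Proof.
rewrite /step /expinv; case: ifP => // x0.
by rewrite mul1r -[leRHS]expR0 ler_expR oppr_le0 invr_ge0 ltW.
Qed.

Lemma step_cvg a x : step k a x @[k --> \oo] --> (if a < x then 1 else 0 : R).
Proof.
case: ifPn => [ax|]; last first.
  by rewrite -leNgt => xa; under eq_fun do rewrite step_le0//; exact: cvg_cst.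
rewrite -[X in _ --> X](@expR0 R) /step.
have xa0 : 0 < x - a by rewrite subr_gt0.
under eq_fun do rewrite /expinv mulr_gt0// mul1r invfM.
apply: (@cvg_comp _ _ _ (fun k : nat => - (k.+1%:R^-1 / (x - a))) expR _ (nbhs 0)).
  rewrite -oppr0 -(mul0r (x - a)^-1); apply: cvgN; apply: cvgMl.
  exact: cvg_harmonic.
exact: continuous_expR.
Qed.

(** For [f] that vanishes on the left of [a], the primitive with that property;
    it starts at [a - 1] for [a] to be an interior point of its domain. *)
Definition lprim (a : R) f x : R := \int[mu]_(s in `[a - 1, x]) f s.

Lemma lprim_is_derive a f x : continuous f -> (forall y, y <= a -> f y = 0) ->
  is_derive x 1 (lprim a f) (f x).
Proof.
move=> cf f0; have [xa|xa] := ltP x a.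
  rewrite f0 ?ltW//; apply: (@near_eq_is_derive _ _ _ (cst 0)).
  near=> y; have ya : y < a by near: y; exact: lt_nbhsl.
  rewrite /lprim/= (@eq_Rintegral _ _ _ mu _ (cst 0)) ?Rintegral_cst// ?mul0r//.
  move=> s; rewrite inE/= in_itv/= => /andP[_ sy].
  by rewrite f0// (le_trans sy)// ltW.
have [||||d1 d2] := @continuous_FTC1_closed R f (a - 1) x (x + 1).
- by rewrite ltrDl.
- apply: continuous_compact_integrable; first exact: segment_compact.
  exact: continuous_subspaceT.
- by rewrite (lt_le_trans _ xa)// ltrBlDr ltrDl.
- exact: cf.
- by apply: DeriveDef => //; rewrite -d2 derive1E.
Unshelve. all: by end_near. Qed.

Lemma lprim_le a f x : (forall y, y <= a -> f y = 0) -> x <= a -> lprim a f x = 0.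
Proof.
move=> f0 xa.
rewrite /lprim (@eq_Rintegral _ _ _ mu _ (cst 0)) ?Rintegral_cst// ?mul0r//.
move=> s; rewrite inE/= in_itv/= => /andP[_ sx].
by rewrite f0// (le_trans sx).
Qed.

Lemma smooth_test M f (a b : R) : smooth f -> 0 < a -> b < M ->
  (forall x, (x < a) || (b < x) -> f x = 0) -> test_fun M f.
Proof.
move=> sf a0 bM f0; split; last by exists a, b; rewrite a0 bM.
by move=> k x; apply: smooth_derivable; exact: smooth_derive1n.
Qed.

Lemma test_smooth M f : test_fun M f -> smooth f.
Proof.
move=> [h _] k.
suff H j : Ck k (derive1n j f) by exact: (H 0%N).
elim: k j => // k IH j; split; first by move=> x; exact: h.
by rewrite -derive1nS; exact: IH.
Qed.

Lemma prim_smooth f (a b : R) : a <= b -> smooth f -> prim a b f (derive1 f).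
Proof.
move=> ab sf; apply: prim_continuous_FTC => //.
  by move=> x _; exact: smooth_is_derive.
by apply: continuous_subspaceT; apply: smooth_continuous; exact: smooth_derive1.
Qed.

Lemma smooth_bnd f (a b : R) : smooth f ->
  exists2 K, 0 <= K & forall x, a <= x <= b -> `|f x| <= K.
Proof.
move=> sf; have [ab|ba] := leP a b; first exact: prim_bnd (prim_smooth ab sf).
by exists 0 => // x /andP[ax xb]; have := le_trans ax xb; rewrite leNgt ba.
Qed.

Lemma derive1_near0 f x : (\forall y \near x, f y = 0) -> derive1 f x = 0.
Proof.
by move=> f0; rewrite derive1E (@near_eq_derive _ _ _ _ (cst 0)) ?derive_cst.
Qed.

Lemma smooth_meas f (D : set R) : smooth f -> measurable D -> measurable_fun D f.
Proof.
move=> sf mD; apply: measurable_funTS; apply: continuous_measurable_fun.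
exact: smooth_continuous sf.
Qed.

Lemma test_derive1 M f : test_fun M f -> test_fun M (derive1 f).
Proof.
move=> tf; have [a [b [a0 bM f0]]] := proj2 tf.
apply: (smooth_test (smooth_derive1 (test_smooth tf)) a0 bM) => x xo.
apply: derive1_near0; case/orP: xo => xo; near=> y; apply: f0; apply/orP.
  by left; near: y; exact: lt_nbhsl.
by right; near: y; exact: lt_nbhsr.
Unshelve. all: by end_near. Qed.

End Smooth.

(** * Weak derivatives and fundamental lemmas *)

Section Weak.
Context {R : realType}.
Local Notation mu := (@lebesgue_measure R).
Implicit Types (f g h : R -> R) (x M : R).

Lemma Rint_supp (D E : set R) f : E `<=` D ->
  (forall x, D x -> ~ E x -> f x = 0) ->
  \int[mu]_(x in D) f x = \int[mu]_(x in E) f x.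
Proof.
move=> ED f0; rewrite Rintegral_mkcond [RHS]Rintegral_mkcond.
congr (Rintegral _ _ _); apply/funext => x; rewrite !patchE.
case: ifPn => [/set_mem Dx|nD]; case: ifPn => [/set_mem Ex|nE] //.
  by apply: f0 => // Ex; move/negP: nE; apply; exact: mem_set.
by move/negP: nD; case; apply: mem_set; exact: ED.
Qed.

Lemma Rint_cvg (D : set R) (f_ : nat -> R -> R) f g : measurable D ->
  (forall k, measurable_fun D (f_ k)) -> measurable_fun D f -> intg D g ->
  {ae mu, forall x, D x -> f_ k x @[k --> \oo] --> f x} ->
  (forall k x, D x -> `|f_ k x| <= g x) ->
  \int[mu]_(x in D) f_ k x @[k --> \oo] --> \int[mu]_(x in D) f x.
Proof.
move=> mD mf_ mf ig cf bf.
have [|||||H1 _ H3] := @dominated_convergence _ _ _ mu D mD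
  (fun k => EFin \o f_ k) (EFin \o f) (EFin \o g).
- by move=> k; apply/measurable_EFinP; exact: mf_.
- exact/measurable_EFinP.
- apply: aeS cf => x + Dx => /(_ Dx) cf.
  by apply/fine_cvgP; split; [exact: nearW|exact: cf].
- exact: ig.
- by apply: aeW => x k Dx; rewrite lee_fin; exact: bf.
apply: fine_cvg; move: H3; rewrite /Rintegral fineK//.
exact: integrable_fin_num.
Qed.

(** Fatou's lemma, in the form that removes a cut-off: a bound that is uniform
    in the cut-off passes to the limit. *)
Lemma intg_le_lim (D : set R) (f_ : nat -> R -> R) f (B : R) : measurable D ->
  measurable_fun D f -> (forall x, D x -> 0 <= f x) ->
  (forall k, intg D (f_ k)) -> (forall k x, D x -> 0 <= f_ k x) ->
  (forall x, D x -> f_ k x @[k --> \oo] --> f x) ->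
  (forall k, \int[mu]_(x in D) f_ k x <= B) ->
  intg D f /\ (\int[mu]_(x in D) (f x)%:E <= B%:E)%E.
Proof.
move=> mD mf f0 i_ f_0 cf hB.
have mf_ k : measurable_fun D (EFin \o f_ k).
  by apply/measurable_EFinP; exact: intgm.
have := @fatou _ _ _ mu D mD (fun k => EFin \o f_ k) mf_.
move=> /(_ (fun k x Dx => f_0 k x Dx)) h.
have {}h : (\int[mu]_(x in D) (f x)%:E <= B%:E)%E.
  have -> : (\int[mu]_(x in D) (f x)%:E =
      \int[mu]_(x in D) limn_einf (fun k => (f_ k x)%:E))%E.
    apply: eq_integral => x /set_mem Dx; apply/esym.
    have c : (f_ k x)%:E @[k --> \oo] --> (f x)%:E.
      by apply: cvg_EFin; [exact: nearW|exact: cf].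
    by rewrite is_cvg_limn_einfE; [exact/cvg_lim|apply/cvg_ex; exists (f x)%:E].
  apply: (le_trans h); rewrite limn_einf_lim; apply: lime_le.
    exact: is_cvg_einfs.
  apply: nearW => k; apply: (@le_trans _ _ (\int[mu]_(x in D) (f_ k x)%:E)%E).
    by apply: ereal_inf_lbound; exists k => /=.
  rewrite -(@fineK _ (\int[mu]_(x in D) _)%E) ?lee_fin; first exact: hB.
  exact: (@integrable_fin_num _ _ _ mu _ mD _ (i_ k)).
split=> //; apply/integrableP; split; first exact/measurable_EFinP.
under eq_integral => x /set_mem Dx do rewrite /= ger0_norm ?f0//.
exact: le_lt_trans h (ltry _).
Qed.

Lemma step_meas (D : set R) k a : measurable D -> measurable_fun D (step k a).
Proof.
move=> mD; apply: measurable_funTS; apply: continuous_measurable_fun.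
exact: smooth_continuous (step_smooth k a).
Qed.

Lemma step_norm k a x : `|step k a x| <= 1.
Proof. by rewrite ger0_norm ?step_ge0// step_le1. Qed.

Lemma meas_ind (D : set R) (a b c : R) :
  measurable_fun D (fun x => if a < x then b else c).
Proof.
apply: measurable_funTS; apply: measurable_fun_ifT => //.
exact: measurable_fun_ltr.
Qed.

Lemma Rint_step_cvg (a c d : R) g : c <= a -> a <= d -> intg `[c, d] g ->
  \int[mu]_(x in `[c, d]) (g x * step k a x) @[k --> \oo]
  --> \int[mu]_(x in `[a, d]) g x.
Proof.
move=> ca ad ig.
have -> : \int[mu]_(x in `[a, d]) g x =
    \int[mu]_(x in `[c, d]) (g x * (if a < x then 1 else 0)).
  rewrite (@Rint_supp `[c, d] `[a, d]); last 2 first.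
  - exact: subitv.
  - move=> x /=; rewrite !in_itv/= => /andP[_ xd] /negP.
    by rewrite xd andbT -ltNge => xa; rewrite ifF ?mulr0//; apply/negbTE;
      rewrite -leNgt ltW.
  apply: ae_eq_Rint => //.
  - by apply: measurable_funS (intgm ig) => //; exact: subitv.
  - apply: measurable_funM.
      by apply: measurable_funS (intgm ig) => //; exact: subitv.
    exact: meas_ind.
  - apply: aeS (ae_neq a) => x xa; rewrite /= in_itv/= => /andP[ax _].
    by rewrite lt_def xa ax mulr1.
have ms k := step_meas k a (measurable_itv `[c, d]).
apply: (Rint_cvg (g := fun x => `|g x|)) => //.
- by move=> k; apply: measurable_funM => //; exact: intgm.
- apply: measurable_funM; first exact: intgm.
  exact: meas_ind.
- exact: intg_norm.
- by apply: aeW => x _; apply: cvgMr; exact: step_cvg.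
- by move=> k x _; rewrite normrM ler_piMr// step_norm.
Qed.

Lemma Rint_small (M : R) g : 0 <= M -> intg `[0, M] g -> forall e : R, 0 < e ->
  exists2 d : R, 0 < d & forall a, 0 <= a -> a <= M -> a < d ->
    `|\int[mu]_(x in `[0, a]) g x| < e.
Proof.
move=> M0 ig e e0; have /= cg := prim_cont (prim_Rint ig).
move/subspace_continuousP: cg => /(_ 0); rewrite /= in_itv/= lexx M0 => /(_ isT).
move=> /cvgrPdist_lt/(_ e e0); rewrite near_withinE => -[d /= d0 hd].
exists d => // a a0 aM ad; have := hd a; rewrite /from_subspace /= Rint_pt !sub0r !normrN.
by apply; rewrite ?ger0_norm// in_itv/= a0.
Qed.

(** Let [b] be the primitive of [B] that vanishes at [M]. Integration by parts
    turns the hypothesis into [int (A - b) step = 0], and for [k -> oo] the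
    integrals of [A - b] over all [[a, M]] vanish. The test functions are free
    at [M], which excludes the usual additive constant. *)
Lemma du_bois_reymond (M : R) A B : 0 < M ->
  intg `[0, M] A -> intg `[0, M] B ->
  (forall k (a : R), 0 < a -> a < M ->
    \int[mu]_(x in `[0, M]) (A x * step k a x + B x * lprim a (step k a) x) = 0) ->
  {ae mu, forall x, 0 <= x <= M -> A x = - \int[mu]_(y in `[x, M]) B y}.
Proof.
move=> M0 iA iB H.
pose b x := - \int[mu]_(y in `[x, M]) B y.
have pb : prim 0 M b B by exact: prim_Rint_tail.
have ib : intg `[0, M] b.
  have [K _ bK] := prim_bnd pb.
  apply: (@bnd_intg _ _ _ K) => //; [exact: mu_itv_lty|exact: prim_meas pb|].
  by apply: aeW => x /=; rewrite in_itv/=; exact: bK.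
pose g x := A x - b x.
have ig : intg `[0, M] g by exact: intgB.
have g_step k (a : R) : 0 < a -> a < M -> \int[mu]_(x in `[0, M]) (g x * step k a x) = 0.
  move=> a0 aM; have a0' := ltW a0; have aM' := ltW aM.
  pose phi := lprim a (step k a).
  have cs := smooth_continuous (step_smooth k a).
  have s0 y : y <= a -> step k a y = 0 by exact: step_le0.
  have pphi : prim a M phi (step k a).
    apply: prim_continuous_FTC => //; last exact: continuous_subspaceT.
    by move=> x _; exact: lprim_is_derive.
  have pbphi : prim a M (fun x => b x * phi x)
      (fun x => B x * phi x + b x * step k a x).
    apply: (@primM _ _ _ _ _ _ _ 1) => //.
      by apply: prim_sub pb => //; exact: ltW.
    by move=> s _; exact: step_norm.
  have E : \int[mu]_(x in `[a, M]) (B x * phi x + b x * step k a x) = 0.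
    have pa : phi a = 0 by exact: lprim_le.
    by rewrite -(proj2 pbphi a M)// pa /b Rint_pt !(oppr0, mul0r, mulr0, addr0).
  have E' : \int[mu]_(x in `[0, M]) (B x * phi x + b x * step k a x) = 0.
    rewrite -[RHS]E; apply: Rint_supp; first exact: subitv.
    move=> x /=; rewrite !in_itv/= => /andP[_ xM]; rewrite xM andbT => /negP.
    by rewrite -ltNge => /ltW xa; rewrite /phi lprim_le// s0// !mulr0 addr0.
  have sphi : smooth phi.
    by apply: smooth_prim (step_smooth k a) => x; exact: lprim_is_derive.
  have [Kp _ phiK] := smooth_bnd 0 M sphi.
  have mphi : measurable_fun `[0, M] phi by exact: smooth_meas.
  have ms := step_meas k a (measurable_itv `[0, M]).
  have i1 : intg `[0, M] (fun x => A x * step k a x).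
    by apply: (@intgM _ _ _ _ 1) => //; apply: aeW => x _; exact: step_norm.
  have i2 : intg `[0, M] (fun x => B x * phi x).
    apply: (@intgM _ _ _ _ Kp) => //; apply: aeW => x /=.
    by rewrite in_itv/=; exact: phiK.
  have i3 : intg `[0, M] (fun x => b x * step k a x).
    by apply: (@intgM _ _ _ _ 1) => //; apply: aeW => x _; exact: step_norm.
  have := H k a a0 aM; rewrite -/phi => HE.
  have -> : \int[mu]_(x in `[0, M]) (g x * step k a x) =
    \int[mu]_(x in `[0, M]) (A x * step k a x + B x * phi x) -
    \int[mu]_(x in `[0, M]) (B x * phi x + b x * step k a x).
    rewrite -RintegralB//; [|exact: intgD|exact: intgD].
    by apply: eq_Rintegral => x _; rewrite /g; ring.
  by rewrite HE E' subrr.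
have gt (a : R) : 0 < a -> a < M -> \int[mu]_(x in `[a, M]) g x = 0.
  move=> a0 aM; have := @Rint_step_cvg a 0 M g (ltW a0) (ltW aM) ig.
  under eq_fun do rewrite g_step//.
  by move=> /cvg_lim => /(_ (@Rhausdorff _)) <-; rewrite lim_cst.
have gh (a : R) : 0 < a -> a < M ->
    \int[mu]_(x in `[0, a]) g x = \int[mu]_(x in `[0, M]) g x.
  by move=> a0 aM; rewrite (@Rint_chasles _ 0 a M) ?ltW// gt// addr0.
have gM : \int[mu]_(x in `[0, M]) g x = 0.
  apply/eqP; rewrite -normr_le0; apply/ler_addgt0Pl => e e0; rewrite addr0.
  have [d d0 hd] := Rint_small (ltW M0) ig e0.
  pose a := Num.min (M / 2%:R) (d / 2%:R).
  have a0 : 0 < a by rewrite lt_min !divr_gt0.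
  have aM : a < M by rewrite gt_min ltr_pdivrMr// ltr_pMr// ltr1n.
  rewrite -(gh a a0 aM) ltW// hd ?ltW//.
  by rewrite gt_min [X in _ || X]ltr_pdivrMr// ltr_pMr// ltr1n orbT.
have := ae0_of_Rint0 ig; rewrite /g => h.
have : {ae mu, forall x, 0 <= x <= M -> A x - b x = 0}.
  apply: h => x /andP[]; rewrite le_eqVlt => /predU1P[<-|x0]; first by rewrite Rint_pt.
  rewrite le_eqVlt => /predU1P[->//|xM].
  by rewrite -/(g _) gh.
by apply: aeS => x /[apply] /eqP; rewrite subr_eq0 => /eqP.
Qed.

Lemma sub_itv_oo_cc (M a b : R) : 0 < a -> b < M -> `[a, b] `<=` `]0, M[.
Proof.
move=> a0 bM x /=; rewrite !in_itv/= => /andP[ax xb].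
by rewrite (lt_le_trans a0)//= (le_lt_trans xb).
Qed.

Lemma locally_intg (M a b : R) g : 0 < a -> b < M ->
  locally_integrable `]0, M[ g -> intg `[a, b] g.
Proof.
move=> a0 bM [mg _ h]; have sub := sub_itv_oo_cc a0 bM.
apply/integrableP; split.
  by apply/measurable_EFinP; exact: measurable_funS mg.
by apply: h => //; exact: segment_compact.
Qed.

Lemma compact_sub_itv (M : R) (K : set R) : compact K -> K `<=` `]0, M[ ->
  K = set0 \/ exists a b : R, [/\ 0 < a, b < M & K `<=` `[a, b]].
Proof.
move=> cK KM; have [->|K0] := eqVneq K set0; [by left|right].
have {}K0 : K !=set0 by exact/set0P.
have ci : {within K, continuous (id : R -> R)}.
  by apply: continuous_subspaceT => x; exact: cvg_id.
have [a /set_mem Ka ha] := compact_EVT_min K0 cK ci.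
have [b /set_mem Kb hb] := compact_EVT_max K0 cK ci.
exists a, b; split.
- by have := KM _ Ka; rewrite /= in_itv/= => /andP[].
- by have := KM _ Kb; rewrite /= in_itv/= => /andP[].
- by move=> x Kx; rewrite /= in_itv/= ha ?hb//; exact: mem_set.
Qed.

Lemma locally_integrable_itv (M : R) g : measurable_fun `]0, M[ g ->
  (forall a b : R, 0 < a -> b < M -> intg `[a, b] g) ->
  locally_integrable `]0, M[ g.
Proof.
move=> mg ig; split => //.
move=> K KM cK; have [->|[a [b [a0 bM Kab]]]] := compact_sub_itv cK KM.
  by rewrite integral_set0.
have mK : measurable K by exact: compact_measurable.
by have /integrableP[] : intg K g by apply: intgS (ig a b a0 bM).
Qed.

Lemma ae_itv_oo (M : R) (P : R -> Prop) :
  (forall a b : R, 0 < a -> b < M ->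
    {ae mu, forall x, a <= x <= b -> P x}) ->
  {ae mu, forall x, 0 < x < M -> P x}.
Proof.
move=> h.
have H (k : nat) :
    {ae mu, forall x, k.+1%:R^-1 <= x <= M - k.+1%:R^-1 -> P x}.
  by apply: h; rewrite ?invr_gt0// ltrBlDr ltrDl invr_gt0.
move/ae_foralln: H; apply: aeS => x hx /andP[x0 xM].
have d0 : 0 < Num.min x (M - x) by rewrite lt_min x0 subr_gt0.
have := @truncnS_gt R (Num.min x (M - x))^-1; set k := Num.trunc _ => hk.
apply: (hx k).
have : k.+1%:R^-1 < Num.min x (M - x).
  by rewrite -[ltRHS]invrK ltf_pV2// posrE ?invr_gt0.
rewrite lt_min => /andP[h1 h2]; rewrite ltW//= lerBrDr -lerBrDl ltW//.
Qed.

(** Smooth functions that approximate the indicator of an interval. *)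
Definition bump (k : nat) (a b x : R) : R := step k a x * step k (- b) (- x).

Lemma bump_smooth k (a b : R) : smooth (bump k a b).
Proof.
apply: smoothM; first exact: step_smooth.
have := @smooth_affine _ _ (-1) 0 (step_smooth k (- b)).
by congr smooth; apply/funext => x; rewrite mulN1r addr0.
Qed.

Lemma bump_out k (a b x : R) : (x <= a) || (b <= x) -> bump k a b x = 0.
Proof.
move=> /orP[xa|bx]; rewrite /bump; first by rewrite step_le0// mul0r.
by rewrite [X in _ * X]step_le0 ?mulr0// lerN2.
Qed.

Lemma bump_test M k (a b : R) : 0 < a -> b < M -> test_fun M (bump k a b).
Proof.
move=> a0 bM; apply: (@smooth_test _ _ _ a b) => //; first exact: bump_smooth.
by move=> x /orP[/ltW xa|/ltW bx]; rewrite bump_out// ?xa ?bx ?orbT.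
Qed.

Lemma bump_norm k (a b x : R) : `|bump k a b x| <= 1.
Proof. by rewrite /bump normrM mulr_ile1// step_norm. Qed.

Lemma bump_cvg (a b x : R) :
  bump k a b x @[k --> \oo] --> (if a < x < b then 1 else 0 : R).
Proof.
have : step k a x * step k (- b) (- x) @[k --> \oo] -->
    ((if a < x then 1 else 0) * (if - b < - x then 1 else 0) : R).
  by apply: cvgM; exact: step_cvg.
rewrite ltrN2.
by case: ifP => _; case: ifP => _ /=; rewrite ?mulr1 ?mulr0 ?mul0r.
Qed.

Lemma Rint_bump_cvg (a b : R) g : a <= b -> intg `[a, b] g ->
  \int[mu]_(x in `[a, b]) (g x * bump k a b x) @[k --> \oo]
  --> \int[mu]_(x in `[a, b]) g x.
Proof.
move=> ab ig; apply: (Rint_cvg (g := fun x => `|g x|)) => //.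
- move=> k; apply: measurable_funM; first exact: intgm.
  by apply: smooth_meas => //; exact: bump_smooth.
- exact: intgm.
- exact: intg_norm.
- apply: aeS2 (ae_neq a) (ae_neq b) => x xa xb /=.
  rewrite in_itv/= => /andP[ax' xb']; rewrite -[X in _ --> X]mulr1.
  apply: cvgMr; have := @bump_cvg a b x.
  by rewrite !lt_def xa ax' eq_sym xb xb'.
- by move=> k x _; rewrite normrM ler_piMr// bump_norm.
Qed.

(** Fundamental lemma of the calculus of variations: the bumps on [[a, x]] tend
    to its indicator, hence all the primitives of [g] vanish. *)
Lemma ae0_of_test M g : locally_integrable `]0, M[ g ->
  (forall phi, test_fun M phi -> \int[mu]_(x in `]0, M[) (g x * phi x) = 0) ->
  {ae mu, forall x, 0 < x < M -> g x = 0}.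
Proof.
move=> lg h; apply: ae_itv_oo => a b a0 bM.
have ig := locally_intg a0 bM lg.
apply: ae0_of_Rint0 => // x /andP[ax xb].
have xM := le_lt_trans xb bM.
have iax : intg `[a, x] g by apply: intgS ig => //; exact: subitv.
have := Rint_bump_cvg ax iax.
have E k : \int[mu]_(y in `[a, x]) (g y * bump k a x y) = 0.
  rewrite -[RHS](h _ (bump_test k a0 xM)); apply/esym; apply: Rint_supp.
    exact: sub_itv_oo_cc.
  move=> y _ /= /negP; rewrite in_itv/= negb_and -!ltNge => yax.
  by rewrite bump_out ?mulr0//; case/orP: yax => /ltW ->; rewrite ?orbT.
under eq_fun do rewrite E.
by move=> /cvg_lim => /(_ (@Rhausdorff _)) <-; rewrite lim_cst.
Qed.

Lemma test_intg M phi g : test_fun M phi -> locally_integrable `]0, M[ g ->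
  intg `]0, M[ (fun x => g x * phi x).
Proof.
move=> tphi lg; have [a [b [a0 bM p0]]] := proj2 tphi.
have sphi := test_smooth tphi; have [K _ phiK] := smooth_bnd a b sphi.
have iab : intg `[a, b] (fun x => g x * phi x).
  apply: (@intgM _ _ _ _ K) => //; first exact: locally_intg lg.
    exact: smooth_meas.
  by apply: aeW => x /=; rewrite in_itv/=; exact: phiK.
have : intg setT ((fun x => g x * phi x) \_ `[a, b]).
  by rewrite /intg -restrict_EFin; apply/(integrable_mkcond _ _).1.
move=> /(@intgS _ setT `]0, M[ _ measurableT (measurable_itv _) (@subsetT _ _)) iM.
apply: eq_intg iM => // x _.
rewrite patchE; case: ifPn => // /negP xab; rewrite p0 ?mulr0//; apply/orP.
have [?|ax] := ltP x a; first by left.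
have [?|xb] := ltP b x; first by right.
by exfalso; apply: xab; rewrite inE/= in_itv/= ax.
Qed.

Lemma is_wderiv_unique M g h1 h2 : is_wderiv M g h1 -> is_wderiv M g h2 ->
  {ae mu, forall x, 0 < x < M -> h1 x = h2 x}.
Proof.
move=> [_ l1 e1] [_ l2 e2].
have : {ae mu, forall x, 0 < x < M -> (h1 \- h2) x = 0}.
  apply: (ae0_of_test (locally_integrableB l1 l2)) => phi tphi.
  under eq_Rintegral do rewrite /= mulrBl.
  rewrite RintegralB//; [|exact: test_intg|exact: test_intg].
  by apply/eqP; rewrite subr_eq0 -eqr_opp -e1// -e2.
by apply: aeS => x /[apply] /= /eqP; rewrite subr_eq0 => /eqP.
Qed.

Lemma wderivP M g : wderivable M g -> is_wderiv M g (wderiv M g).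
Proof. exact: xgetPex. Qed.

Lemma wderivE M g h : is_wderiv M g h ->
  {ae mu, forall x, 0 < x < M -> wderiv M g x = h x}.
Proof.
by move=> gh; apply: is_wderiv_unique (gh); apply: wderivP; exists h.
Qed.

(** The product rule on a compact interval in [(0, M)] at whose end points the
    test function vanishes. *)
Lemma prim_wderiv M g g' : measurable_fun `]0, M[ g -> measurable_fun `]0, M[ g' ->
  (forall a b : R, 0 < a -> a <= b -> b < M -> prim a b g g') -> is_wderiv M g g'.
Proof.
move=> mg mg' pg.
have empty (f : R -> R) (a b : R) : b < a -> intg `[a, b] f.
  by move=> ba; rewrite /intg set_itv_ge ?bnd_simp -?ltNge//; exact: integrable_set0.
split.
- apply: locally_integrable_itv => // a b a0 bM.
  have [ab|/empty //] := leP a b.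
  have [K _ gK] := prim_bnd (pg a b a0 ab bM).
  apply: (@bnd_intg _ _ _ K) => //; first exact: mu_itv_lty.
    exact: prim_meas (pg a b a0 ab bM).
  by apply: aeW => x /=; rewrite in_itv/=; exact: gK.
- apply: locally_integrable_itv => // a b a0 bM.
  by have [ab|/empty //] := leP a b; have [] := pg a b a0 ab bM.
move=> phi tphi; have [a [b [a0 bM p0]]] := proj2 tphi.
have [M0|M0] := leP M 0.
  by rewrite set_itv_ge -?leNgt ?bnd_simp// !Rintegral_set0 oppr0.
(* a non-empty interval whose end points are outside the support *)
pose a' := Num.min (a / 2%:R) (M / 3%:R).
pose b' := Num.max ((b + M) / 2%:R) (M / 2%:R).
have a'0 : 0 < a' by rewrite lt_min !divr_gt0.
have b'M : b' < M.
  by rewrite gt_max; apply/andP; split; lra.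
have ab' : a' <= b'.
  by rewrite ge_min; apply/orP; right; rewrite le_max; apply/orP; right; lra.
have pa : phi a' = 0.
  rewrite p0//; apply/orP; left; rewrite gt_min; apply/orP; left; lra.
have pb : phi b' = 0.
  rewrite p0//; apply/orP; right; rewrite lt_max; apply/orP; left; lra.
have sub := sub_itv_oo_cc a'0 b'M.
have out x : ~ `[a', b']%classic x -> (x < a') || (b' < x).
  by move=> /= /negP; rewrite in_itv/= negb_and -!ltNge.
have aa : a' <= a by rewrite ge_min; apply/orP; left; lra.
have bb : b <= b' by rewrite le_max; apply/orP; left; lra.
have out0 x : (x < a') || (b' < x) -> phi x = 0.
  move=> /orP[xa|xb]; rewrite p0//; first by rewrite (lt_le_trans xa).
  by rewrite (le_lt_trans bb xb) orbT.
have out1 x : (x < a') || (b' < x) -> derive1 phi x = 0.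
  move=> xo; apply: derive1_near0; case/orP: xo => [xa|xb]; near=> y; rewrite out0//.
    by apply/orP; left; near: y; exact: lt_nbhsl.
  by apply/orP; right; near: y; exact: lt_nbhsr.
have sphi := test_smooth tphi; have pphi := prim_smooth ab' sphi.
have [L _ hL] := smooth_bnd a' b' (smooth_derive1 sphi).
have pgphi := primM (pg a' b' a'0 ab' b'M) pphi hL.
have := proj2 pgphi a' b' (lexx _) ab' (lexx _).
rewrite pa pb !mulr0 subrr => E.
rewrite (@Rint_supp _ `[a', b'])//; last by move=> x _ /out/out1 ->; rewrite mulr0.
rewrite [in RHS](@Rint_supp _ `[a', b'])//; last by move=> x _ /out/out0 ->; rewrite mulr0.
apply/eqP; rewrite eq_sym eqr_oppLR; apply/eqP.
have ig := pg a' b' a'0 ab' b'M.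
have [Kg _ gK] := prim_bnd ig; have [Kp _ pK] := prim_bnd pphi.
have i1 : intg `[a', b'] (fun x => g' x * phi x).
  apply: (@intgM _ _ _ _ Kp) => //; [exact: (proj1 ig)|exact: prim_meas pphi|].
  by apply: aeW => x /=; rewrite in_itv/=; exact: pK.
have i2 : intg `[a', b'] (fun x => g x * derive1 phi x).
  have : intg `[a', b'] (fun x => derive1 phi x * g x).
    apply: (@intgM _ _ _ _ Kg) => //; [exact: (proj1 pphi)|exact: prim_meas ig|].
    by apply: aeW => x /=; rewrite in_itv/=; exact: gK.
  by apply: eq_intg => // x _; rewrite mulrC.
move: E; rewrite RintegralD// => /esym/eqP.
by rewrite addr_eq0 => /eqP.
Unshelve. all: by end_near. Qed.

(** Two functions with the same weak derivative differ by a constant: their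
    difference is tested against [z - (\int z) z0], which has a compactly
    supported primitive when [z0] has integral [1]. *)
Lemma wderiv_prim M g v : 0 < M -> is_wderiv M g v -> intg `[0, M] v ->
  exists c, {ae mu, forall x, 0 < x < M -> g x = c + \int[mu]_(s in `[0, x]) v s}.
Proof.
move=> M0 [lg lv egv] iv.
pose V x := \int[mu]_(s in `[0, x]) v s.
have pV : prim 0 M V v by exact: prim_Rint.
have mV : measurable_fun `]0, M[ V.
  by apply: measurable_funS (prim_meas pV) => //; exact: subset_itv_oo_cc.
have wV : is_wderiv M V v.
  apply: prim_wderiv => //; first by case: lv.
  by move=> a b a0 ab bM; apply: prim_sub pV; exact: ltW.
have lh := locally_integrableB lg (let: And3 l _ _ := wV in l).
pose h x := g x - V x.
have {}lh : locally_integrable `]0, M[ h by [].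
(* the bumps on [[M/3, M/2]] do not all have a zero integral *)
have [z0 [tz0 z0n]] : exists z, test_fun M z /\ \int[mu]_(x in `]0, M[) z x != 0.
  apply: contrapT => /forallNP H.
  have H' k : \int[mu]_(x in `[M / 3%:R, M / 2%:R]) bump k (M / 3%:R) (M / 2%:R) x = 0.
    apply: contrapT => /eqP Hk; apply: (H (bump k (M / 3%:R) (M / 2%:R))).
    have tb : test_fun M (bump k (M / 3%:R) (M / 2%:R)).
      by apply: bump_test; rewrite ?divr_gt0//; lra.
    split => //; apply: contra_neq Hk => <-.
    apply/esym; apply: Rint_supp; first by apply: sub_itv_oo_cc; lra.
    move=> y _ /= /negP; rewrite in_itv/= negb_and -!ltNge => yax.
    by rewrite bump_out//; case/orP: yax => /ltW ->; rewrite ?orbT.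
  have M32 : M / 3%:R <= M / 2%:R by lra.
  have i1 : intg `[M / 3%:R, M / 2%:R] (fun=> 1 : R).
    by apply: intg_cst => //; exact: mu_itv_lty.
  have := Rint_bump_cvg M32 i1.
  under eq_fun do under eq_Rintegral do rewrite mul1r.
  under eq_fun do rewrite H'.
  move=> /cvg_lim => /(_ (@Rhausdorff _)); rewrite lim_cst; last exact: Rhausdorff.
  by rewrite Rint_cst_itv// mul1r; lra.
set I0 := \int[mu]_(x in `]0, M[) z0 x in z0n.
pose c := (\int[mu]_(x in `]0, M[) (h x * z0 x)) / I0.
have hc : {ae mu, forall x, 0 < x < M -> h x - c = 0}.
  have icst : intg `[0, M] (fun=> c).
    by apply: intg_cst => //; exact: mu_itv_lty.
  have lc : locally_integrable `]0, M[ (fun=> c).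
    apply: locally_integrable_itv => // a b a0 bM.
    by apply: intg_cst => //; exact: mu_itv_lty.
  apply: (ae0_of_test (locally_integrableB lh lc)) => z tz.
  have lone : locally_integrable `]0, M[ (fun=> 1 : R).
    apply: locally_integrable_itv => // a b a0 bM.
    by apply: intg_cst => //; exact: mu_itv_lty.
  have i1 y : test_fun M y -> intg `]0, M[ y.
    by move=> ty; apply: eq_intg (test_intg ty lone) => // x _; rewrite mul1r.
  set Iz := \int[mu]_(x in `]0, M[) z x.
  pose psi x := z x + - (Iz / I0) * z0 x.
  have spsi : smooth psi.
    apply: smoothD; first exact: test_smooth tz.
    by apply: smoothM; [exact: smooth_cst|exact: test_smooth tz0].
  have [a1 [b1 [a10 b1M p1]]] := proj2 tz.
  have [a2 [b2 [a20 b2M p2]]] := proj2 tz0.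
  pose a := Num.min a1 a2; pose b := Num.max b1 b2.
  have a0 : 0 < a by rewrite lt_min a10.
  have bM : b < M by rewrite gt_max b1M.
  have ppsi x : (x < a) || (b < x) -> psi x = 0.
    rewrite lt_min gt_max /psi => /orP[]/andP[h1 h2].
      by rewrite p1 ?h1// p2 ?h2// mulr0 addr0.
    by rewrite p1 ?h1 ?orbT// p2 ?h2 ?orbT// mulr0 addr0.
  have ppsia x : x <= a / 2%:R -> psi x = 0.
    by move=> xa; apply: ppsi; rewrite (le_lt_trans xa)//; lra.
  have cpsi := smooth_continuous spsi.
  pose Phi := lprim (a / 2%:R) psi.
  have dPhi x : is_derive x 1 Phi (psi x) by exact: lprim_is_derive.
  have sPhi : smooth Phi by exact: smooth_prim dPhi spsi.
  have tpsi : test_fun M psi by exact: smooth_test spsi a0 bM ppsi.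
  have Ipsi : \int[mu]_(x in `]0, M[) psi x = 0.
    rewrite RintegralD//; [|exact: i1|by apply: intgZ => //; exact: i1].
    by rewrite RintegralZl//; [rewrite -/Iz -/I0 mulNr divfK// subrr|exact: i1].
  have tPhi : test_fun M Phi.
    apply: (@smooth_test _ _ _ (a / 2%:R) b) => //; first by rewrite divr_gt0.
    move=> x /orP[xa|bx]; first by apply: lprim_le => //; exact: ltW.
    rewrite /Phi /lprim -[RHS]Ipsi.
    have out (D : set R) : `[a, b] `<=` D ->
        \int[mu]_(s in D) psi s = \int[mu]_(s in `[a, b]) psi s.
      move=> sD; apply: Rint_supp => // y _ /= /negP.
      by rewrite in_itv/= negb_and -!ltNge => /ppsi.
    rewrite out; last by apply: subitv; [lra|exact: ltW].
    by rewrite out//; exact: sub_itv_oo_cc.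
  have E : \int[mu]_(x in `]0, M[) (h x * psi x) = 0.
    have := egv _ tPhi; have [_ _ /(_ _ tPhi)] := wV; rewrite (derive1_is dPhi).
    move=> e1 e2.
    transitivity (\int[mu]_(x in `]0, M[) (g x * psi x - V x * psi x)).
      by apply: eq_Rintegral => x _; rewrite /h mulrBl.
    rewrite RintegralB//; [|exact: test_intg|apply: test_intg => //; by case: wV].
    by rewrite e1 e2 subrr.
  have ihz := test_intg tz lh; have ihz0 := test_intg tz0 lh.
  have E2 : \int[mu]_(x in `]0, M[) (h x * z x) = Iz / I0 * \int[mu]_(x in `]0, M[) (h x * z0 x).
    apply/eqP; rewrite -subr_eq0 -[X in _ == X]E -RintegralZl// -RintegralB//.
      by apply/eqP; apply: eq_Rintegral => x _; rewrite /psi; ring.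
    exact: intgZ.
  transitivity (\int[mu]_(x in `]0, M[) (h x * z x - c * z x)).
    by apply: eq_Rintegral => x _ /=; rewrite mulrBl.
  rewrite RintegralB//; last by apply: intgZ => //; exact: i1.
  by rewrite RintegralZl ?E2//; [rewrite -/Iz /c; ring|exact: i1].
exists c; apply: aeS hc => x /[apply]; rewrite /h => /eqP.
by rewrite subr_eq0 subr_eq => /eqP ->.
Qed.

End Weak.

(** * Square-integrable functions and curves in L^2 *)

Section SquareIntegrable.
Context {R : realType}.
Local Notation mu := (@lebesgue_measure R).
Implicit Types (D : set R) (f g h w : R -> R).

Definition sqi D f := measurable_fun D f /\ intg D (fun x => f x ^+ 2).

Lemma sqi_prod D f g : measurable D -> sqi D f -> sqi D g ->
  intg D (fun x => f x * g x).
Proof.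
move=> mD [mf i_f] [mg ig].
apply: (le_intg mD _ (intgD mD i_f ig)); first exact: measurable_funM.
apply: aeW => x _; rewrite normrM -(real_normK (num_real (f x))).
rewrite -(real_normK (num_real (g x))).
have := sqr_ge0 (`|f x| - `|g x|); have := sqr_ge0 (`|f x| + `|g x|); nra.
Qed.

Lemma sqiD D f g : measurable D -> sqi D f -> sqi D g -> sqi D (fun x => f x + g x).
Proof.
move=> mD [mf i_f] [mg ig]; split; first exact: measurable_funD.
apply: (le_intg mD _ (intgZ 2%:R mD (intgD mD i_f ig))).
  by apply: measurable_funX; exact: measurable_funD.
apply: aeW => x _; rewrite ger0_norm ?sqr_ge0//.
have := sqr_ge0 (f x - g x); nra.
Qed.

Lemma sqiZ D f a : measurable D -> sqi D f -> sqi D (fun x => a * f x).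
Proof.
move=> mD [mf i_f]; split; first exact: measurable_funM.
apply: eq_intg (intgZ (a ^+ 2) mD i_f) => // x _; by rewrite exprMn.
Qed.

Lemma sqiZr D f a : measurable D -> sqi D f -> sqi D (fun x => f x * a).
Proof.
move=> mD /(sqiZ a mD); congr sqi; apply/funext => x; exact: mulrC.
Qed.

Lemma sqiB D f g : measurable D -> sqi D f -> sqi D g -> sqi D (fun x => f x - g x).
Proof.
move=> mD hf /(sqiZ (-1) mD) /(sqiD mD hf).
by under eq_fun do rewrite mulN1r.
Qed.

Lemma sqi_bnd D f K : measurable D -> (mu D < +oo)%E -> measurable_fun D f ->
  {ae mu, forall x, D x -> `|f x| <= K} -> sqi D f.
Proof.
move=> mD Doo mf fK; split => //.
apply: (@bnd_intg _ _ _ (K ^+ 2)) => //; first exact: measurable_funX.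
apply: aeS fK => x + Dx => /(_ Dx) h; rewrite normrX ler_sqr ?nnegrE//.
exact: le_trans (normr_ge0 _) h.
Qed.

Lemma sqi_intg D f : measurable D -> (mu D < +oo)%E -> sqi D f -> intg D f.
Proof.
move=> mD Doo hf; have h1 : sqi D (fun=> 1 : R).
  by apply: (@sqi_bnd _ _ 1) => //; apply: aeW => x _; rewrite normr1.
by apply: eq_intg (sqi_prod mD hf h1) => // x _; rewrite mulr1.
Qed.

Lemma normL2E D g : measurable D ->
  (normLp D 2%:E g `^ 2)%E = (\int[mu]_(x in D) (g x ^+ 2)%:E)%E.
Proof.
move=> mD; rewrite /normLp poweR_Lnorm ?pnatr_eq0//.
rewrite [RHS]integral_mkcond; apply: eq_integral => x _ /=.
rewrite !patchE; case: ifPn => _ /=; last by rewrite normr0 powR0.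
by rewrite -[2%R]/(2%:R) powR_mulrn// real_normK ?num_real.
Qed.

Lemma normL2_le D g (K : R) : measurable D -> measurable_fun D g -> 0 <= K ->
  (normLp D 2%:E g <= K%:E)%E ->
  sqi D g /\ \int[mu]_(x in D) (g x ^+ 2) <= K ^+ 2.
Proof.
move=> mD mg K0 gK.
have HK : (\int[mu]_(x in D) (g x ^+ 2)%:E <= (K ^+ 2)%:E)%E.
  rewrite -normL2E//.
  have -> : (K ^+ 2)%:E = (K%:E `^ 2)%E by rewrite poweR_EFin -[2%R]/(2%:R) powR_mulrn.
  apply: gt0_ler_poweR => //; rewrite ?in_itv/= ?leey ?andbT ?lee_fin//.
  by rewrite Lnorm_ge0.
have i2 : intg D (fun x => g x ^+ 2).
  apply/integrableP; split.
    by apply/measurable_EFinP; exact: measurable_funX.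
  under eq_integral do rewrite /= ger0_norm ?sqr_ge0//.
  by apply: le_lt_trans HK _; rewrite ltey.
split => //; rewrite -lee_fin /Rintegral fineK//.
exact: (@integrable_fin_num _ _ _ mu _ mD _ i2).
Qed.

Lemma in_L2_sqi D g : measurable D -> in_Lp D 2%:E g -> sqi D g.
Proof.
move=> mD [mg goo].
have g0 : (0 <= normLp D 2%:E g)%E by exact: Lnorm_ge0.
have := @normL2_le D g (fine (normLp D 2%:E g)) mD mg.
rewrite fine_ge0// fineK ?ge0_fin_numE// => /(_ isT (lexx _)).
by case.
Qed.

Lemma normLoo_ae D g (K : \bar R) : measurable D -> (normLp D +oo%E g <= K)%E ->
  {ae mu, forall x, D x -> (`|g x|%:E <= K)%E}.
Proof.
move=> mD; rewrite /normLp unlock /Lnorm ifT; last first.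
  suff h : (0 < mu [set: R])%E by exact: h.
  have := @lebesgue_measure_itv R `]-oo, +oo[; rewrite set_itvNyy => ->.
  by first [done | rewrite /= lt0y | rewrite /= ltNye/= lt0y].
move/ess_supP; apply: aeS => x /= + Dx.
by rewrite patchE mem_set.
Qed.

(** Cauchy-Schwarz in the form of Young's inequality with parameter [l]: first
    [l] is chosen to make the part carried by [f0] and [g0] at most [e / 2], then
    [d] to do the same with the increments. *)
Lemma pairing_continuous D w f0 g0 (W : R) (e : R) : measurable D ->
  measurable_fun D w -> (forall x, D x -> `|w x| <= W) -> sqi D f0 -> sqi D g0 ->
  0 < e -> exists2 d : R, 0 < d & forall f1 g1, sqi D f1 -> sqi D g1 ->
    \int[mu]_(x in D) ((f1 x - f0 x) ^+ 2) <= d ->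
    \int[mu]_(x in D) ((g1 x - g0 x) ^+ 2) <= d ->
    `|\int[mu]_(x in D) (w x * (f1 x * g1 x)) -
      \int[mu]_(x in D) (w x * (f0 x * g0 x))| <= e.
Proof.
move=> mD mw hw hf0 hg0 e0.
set F := \int[mu]_(x in D) (f0 x ^+ 2).
set G := \int[mu]_(x in D) (g0 x ^+ 2).
have F0 : 0 <= F by apply: Rintegral_ge0 => x _; exact: sqr_ge0.
have G0 : 0 <= G by apply: Rintegral_ge0 => x _; exact: sqr_ge0.
pose W1 := `|W| + 1; have W10 : 0 < W1 by rewrite ltr_wpDl.
pose l := e / (W1 * (F + G + 1)).
have l0 : 0 < l by rewrite divr_gt0// mulr_gt0// ltr_wpDl// addr_ge0.
pose d := e / (W1 * 2%:R * (1 + l^-1)).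
have l1 : 0 < 1 + l^-1 by rewrite addr_gt0// invr_gt0.
have d0 : 0 < d by rewrite divr_gt0// mulr_gt0// mulr_gt0.
exists d => // f1 g1 hf1 hg1 df dg.
have hdf := sqiB mD hf1 hf0; have hdg := sqiB mD hg1 hg0.
have iw f g : sqi D f -> sqi D g -> intg D (fun x => w x * (f x * g x)).
  move=> hf hg; have := @intgM _ _ _ w W mD (sqi_prod mD hf hg) mw (aeW hw).
  by apply: eq_intg => // x _; rewrite mulrC.
rewrite -RintegralB//; [|exact: iw|exact: iw].
pose df2 x := (f1 x - f0 x) ^+ 2; pose dg2 x := (g1 x - g0 x) ^+ 2.
pose Fx x := f0 x ^+ 2; pose Gx x := g0 x ^+ 2.
have iD : intg D (fun x => df2 x + dg2 x) by apply: intgD => //; [case: hdf|case: hdg].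
have iFG : intg D (fun x => Fx x + Gx x) by apply: intgD => //; [case: hf0|case: hg0].
pose bound x := W1 / 2%:R * (1 + l^-1) * (df2 x + dg2 x) + W1 / 2%:R * l * (Fx x + Gx x).
have ib : intg D bound by apply: intgD => //; apply: intgZ.
apply: (@le_trans _ _ (\int[mu]_(x in D) bound x)).
  apply: norm_Rint_le => //; first by apply: intgB => //; exact: iw.
  apply: aeW => x Dx.
  have -> : w x * (f1 x * g1 x) - w x * (f0 x * g0 x) =
    w x * ((f1 x - f0 x) * (g1 x - g0 x) + (f1 x - f0 x) * g0 x +
           f0 x * (g1 x - g0 x)) by ring.
  rewrite normrM /bound /df2 /dg2 /Fx /Gx.
  set a := f1 x - f0 x; set b := g1 x - g0 x; set p := f0 x; set q := g0 x.
  have young (s t : R) : `|s * t| <= (l^-1 * s ^+ 2 + l * t ^+ 2) / 2%:R.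
    have ll : l^-1 * l = 1 by rewrite mulVf// gt_eqF.
    have h1 := sqr_ge0 (s - l * t); have h2 := sqr_ge0 (s + l * t).
    have li0 : 0 < l^-1 by rewrite invr_gt0.
    have E1 : l^-1 * (s - l * t) ^+ 2 = l^-1 * s ^+ 2 - 2%:R * (l^-1 * l) * s * t + (l^-1 * l) * l * t ^+ 2 by ring.
    have E2 : l^-1 * (s + l * t) ^+ 2 = l^-1 * s ^+ 2 + 2%:R * (l^-1 * l) * s * t + (l^-1 * l) * l * t ^+ 2 by ring.
    have P1 : 0 <= l^-1 * (s - l * t) ^+ 2 by rewrite mulr_ge0// ltW.
    have P2 : 0 <= l^-1 * (s + l * t) ^+ 2 by rewrite mulr_ge0// ltW.
    rewrite E1 ll in P1; rewrite E2 ll in P2.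
    by rewrite ler_norml; apply/andP; split; lra.
  have y1 : `|a * b| <= (a ^+ 2 + b ^+ 2) / 2%:R.
    rewrite ler_norml; have := sqr_ge0 (a - b); have := sqr_ge0 (a + b); nra.
  have y2 := young a q; have y3 := young b p.
  have s : `|a * b + a * q + p * b| <= (1 + l^-1) / 2%:R * (a ^+ 2 + b ^+ 2) +
      l / 2%:R * (p ^+ 2 + q ^+ 2).
    rewrite (le_trans (ler_normD _ _))// (le_trans (lerD (ler_normD _ _) (lexx _)))//.
    by rewrite [p * b]mulrC; lra.
  have -> : W1 / 2%:R * (1 + l^-1) * (a ^+ 2 + b ^+ 2) + W1 / 2%:R * l * (p ^+ 2 + q ^+ 2)
    = W1 * ((1 + l^-1) / 2%:R * (a ^+ 2 + b ^+ 2) + l / 2%:R * (p ^+ 2 + q ^+ 2)) by ring.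
  rewrite ler_pM// /W1 (le_trans (hw _ Dx))// (le_trans (ler_norm _))//.
  by rewrite lerDl.
rewrite RintegralD//; [|exact: intgZ|exact: intgZ].
rewrite !RintegralZl//.
rewrite !RintegralD//; last 4 first.
- exact: (proj2 hf0).
- exact: (proj2 hg0).
- exact: (proj2 hdf).
- exact: (proj2 hdg).
rewrite -/F -/G.
apply: (@le_trans _ _ (W1 / 2%:R * (1 + l^-1) * (d + d) + W1 / 2%:R * l * (F + G + 1))).
  apply: lerD.
    by rewrite ler_wpM2l ?lerD// ?mulr_ge0 ?(ltW l1) ?divr_ge0 ?(ltW W10).
  apply: ler_wpM2l; last by rewrite lerDl.
  by rewrite mulr_ge0 ?(ltW l0)// divr_ge0// ltW.
have -> : W1 / 2%:R * (1 + l^-1) * (d + d) = e / 2%:R.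
  by rewrite /d; move: (l^-1) l1 => li li1; field; rewrite !gt_eqF.
have -> : W1 / 2%:R * l * (F + G + 1) = e / 2%:R.
  by rewrite /l; field; rewrite !gt_eqF// ltr_wpDl// addr_ge0.
by rewrite -splitr.
Qed.

End SquareIntegrable.

Section Time.
Context {R : realType}.
Local Notation mu := (@lebesgue_measure R).
Implicit Types (D : set R) (F f : R -> R) (M T t s : R).

(** Continuity and differentiability on the half-line [t >= 0], one-sided at
    [0]. *)
Definition cont0 F := forall t (e : R), 0 <= t -> 0 < e -> exists2 d : R, 0 < d &
  forall s, 0 <= s -> `|s - t| < d -> `|F s - F t| <= e.

Definition deriv0 F f := forall t (e : R), 0 <= t -> 0 < e -> exists2 d : R, 0 < d &
  forall s, 0 <= s -> s != t -> `|s - t| < d ->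
  `|(F s - F t) / (s - t) - f t| <= e.

Lemma cont0_within F (a b : R) : 0 <= a -> cont0 F ->
  {within `[a, b], continuous F}.
Proof.
move=> a0 cF; apply/subspace_continuousP => t /=; rewrite in_itv/= => /andP[at_ tb].
apply/cvgrPdist_le => e e0; rewrite near_withinE.
have [d d0 hd] := cF t e (le_trans a0 at_) e0.
exists d => //= s /=; rewrite distrC => st; rewrite in_itv/= => /andP[as_ sb].
by rewrite distrC hd// (le_trans a0).
Qed.

Lemma cont0_cst (c : R) : cont0 (fun=> c).
Proof. by move=> t e t0 e0; exists 1 => // s _ _; rewrite subrr normr0 ltW. Qed.

Lemma cont0D F f : cont0 F -> cont0 f -> cont0 (fun t => F t + f t).
Proof.
move=> hF hf t e t0 e0; have e20 : 0 < e / 2%:R by rewrite divr_gt0.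
have [d1 d10 h1] := hF t _ t0 e20; have [d2 d20 h2] := hf t _ t0 e20.
exists (Num.min d1 d2); first by rewrite lt_min d10.
move=> s s0; rewrite lt_min => /andP[st1 st2].
have -> : F s + f s - (F t + f t) = (F s - F t) + (f s - f t) by ring.
rewrite (le_trans (ler_normD _ _))// [leRHS](splitr e) lerD//; [exact: h1|exact: h2].
Qed.

Lemma cont0M F f : cont0 F -> cont0 f -> cont0 (fun t => F t * f t).
Proof.
move=> hF hf t e t0 e0.
pose K := `|F t| + `|f t| + 1.
have K0 : 0 < K by rewrite ltr_wpDl// addr_ge0.
pose e1 := Num.min 1 (e / (2%:R * K)).
have e10 : 0 < e1 by rewrite lt_min ltr01 divr_gt0// mulr_gt0.
have [d1 d10 h1] := hF t _ t0 e10; have [d2 d20 h2] := hf t _ t0 e10.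
exists (Num.min d1 d2); first by rewrite lt_min d10.
move=> s s0; rewrite lt_min => /andP[/(h1 s s0) st1 /(h2 s s0) st2].
have -> : F s * f s - F t * f t = (F s - F t) * (f s - f t) + (F s - F t) * f t
   + F t * (f s - f t) by ring.
have e11 : e1 <= 1 by rewrite ge_min lexx.
have e1K : e1 * K <= e / 2%:R.
  rewrite -ler_pdivlMr//; have -> : e / 2%:R / K = e / (2%:R * K).
    by field; rewrite gt_eqF.
  by rewrite ge_min lexx orbT.
rewrite (le_trans (ler_normD _ _))// (le_trans (lerD (ler_normD _ _) (lexx _)))//.
rewrite !normrM.
have a1 : `|F s - F t| * `|f s - f t| <= e1 * 1 by rewrite ler_pM// (le_trans st2).
have a2 : `|F s - F t| * `|f t| <= e1 * `|f t| by rewrite ler_wpM2r.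
have a3 : `|F t| * `|f s - f t| <= `|F t| * e1 by rewrite ler_wpM2l.
rewrite /K in e1K; nra.
Qed.

Lemma deriv0_cont F f : deriv0 F f -> cont0 F.
Proof.
move=> hF t e t0 e0; have [d d0 hd] := hF t 1 t0 ltr01.
pose K := `|f t| + 1; have K0 : 0 < K by rewrite ltr_wpDl.
exists (Num.min d (e / K)); first by rewrite lt_min d0 divr_gt0.
move=> s s0; rewrite lt_min => /andP[sd se].
have [->|st] := eqVneq s t; first by rewrite subrr normr0 ltW.
have st0 : s - t != 0 by rewrite subr_eq0.
have := hd s s0 st sd => h.
have -> : F s - F t = ((F s - F t) / (s - t)) * (s - t) by rewrite divfK.
rewrite normrM (@le_trans _ _ (K * `|s - t|))//.
  rewrite ler_wpM2r//.
  by have := lerB_dist ((F s - F t) / (s - t)) (f t); rewrite /K => h1; lra.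
by rewrite mulrC -ler_pdivlMr// ltW.
Qed.

Lemma deriv0_is_derive F f t : 0 < t -> deriv0 F f -> is_derive t 1 F (f t).
Proof.
move=> t0 hF.
have h : h^-1 *: (F (h *: 1 + t) - F t) @[h --> 0^'] --> f t.
  apply/cvgrPdist_le => e e0; have [d d0 hd] := hF t e (ltW t0) e0.
  exists (Num.min d t) => /=; first by rewrite lt_min d0.
  move=> h /=; rewrite sub0r normrN lt_min => /andP[hdl ht] h0.
  rewrite [h *: 1]mulr1 distrC [_ *: _]mulrC.
  have := hd (h + t); rewrite addrK; apply => //.
    by move: ht; rewrite ltr_norml => /andP[? _]; lra.
  by rewrite -subr_eq0 addrK.
apply: DeriveDef; first by apply/cvg_ex; exists (f t).
by apply/cvg_lim => //; exact: h.
Qed.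

Lemma deriv0_prim F f b : 0 <= b -> deriv0 F f -> cont0 f -> prim 0 b F f.
Proof.
move=> b0 dF cf; split.
  apply: continuous_compact_integrable; first exact: segment_compact.
  exact: cont0_within.
move=> x y x0 xy yb; have := xy; rewrite le_eqVlt => /predU1P[->|ltxy].
  by rewrite Rint_pt subrr.
have cF := cont0_within (b := y) x0 (deriv0_cont dF).
have [_ cr cl] := proj1 (continuous_within_itvP _ ltxy) cF.
rewrite /Rintegral (@continuous_FTC2 _ f F x y)//.
- exact: cont0_within.
- split => // z; rewrite in_itv/= => /andP[xz zy].
  by have [] := deriv0_is_derive (le_lt_trans x0 xz) dF.
- move=> z; rewrite in_itv/= => /andP[xz zy].
  by rewrite derive1E; have [] := deriv0_is_derive (le_lt_trans x0 xz) dF.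
Qed.

Lemma cont0_seq F : (forall t (s_ : nat -> R), 0 <= t -> (forall k, 0 <= s_ k) ->
   s_ k @[k --> \oo] --> t -> F (s_ k) @[k --> \oo] --> F t) -> cont0 F.
Proof.
move=> h t e t0 e0; apply: contrapT => /forall2NP H.
have {}H (k : nat) : exists s, [/\ 0 <= s, `|s - t| < k.+1%:R^-1 & e < `|F s - F t|].
  have dk : 0 < k.+1%:R^-1 :> R by rewrite invr_gt0.
  have [//|/existsNP[s]] := H k.+1%:R^-1.
  move=> /not_implyP[s0 /not_implyP[st /negP]]; rewrite -ltNge => es.
  by exists s.
have [s_ hs] := choice H.
have st : s_ k @[k --> \oo] --> t.
  apply/cvgrPdist_lt => e' e'0; near=> k.
  rewrite distrC; have [_ /lt_trans + _] := hs k; apply.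
  by near: k; exact: near_infty_natSinv_lt (PosNum e'0).
have := h t s_ t0 (fun k => let: And3 a _ _ := hs k in a) st.
move=> /cvgrPdist_lt/(_ e e0)[k _ /(_ k (leqnn _))]/=.
by have [_ _ + ] := hs k; rewrite distrC => /lt_trans/[apply]; rewrite ltxx.
Unshelve. all: by end_near. Qed.

End Time.

Section Paths.
Context {R : realType}.
Local Notation mu := (@lebesgue_measure R).
Variable M : R.
Hypothesis M0 : 0 < M.
Local Notation I := (`[0, M]%classic : set R).
Implicit Types (g h : R -> R -> R) (w phi f : R -> R) (t s W : R).

Let mI : measurable I := measurable_itv _.
Let Ioo : (mu I < +oo)%E := mu_itv_lty 0 M.

(** Curves [t >= 0 |-> g (., t)] that are continuous in [L^2 (0, M)], and their
    derivatives. *)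
Definition path g := forall t, 0 <= t -> sqi I (g^~ t) /\
  forall e : R, 0 < e -> exists2 d : R, 0 < d & forall s, 0 <= s -> `|s - t| < d ->
    \int[mu]_(x in I) ((g x s - g x t) ^+ 2) <= e.

Definition path_deriv g g' := forall t, 0 <= t ->
  forall e : R, 0 < e -> exists2 d : R, 0 < d &
  forall s, 0 <= s -> s != t -> `|s - t| < d ->
    \int[mu]_(x in I) (((g x s - g x t) / (s - t) - g' x t) ^+ 2) <= e.

Lemma near_eps (Q : R -> \bar R) (T t : R) :
  Q s @[s --> within `[0, T] (nbhs t)] --> 0%E -> forall e : R, 0 < e ->
  exists2 d : R, 0 < d & forall s, 0 <= s -> s <= T -> `|s - t| < d ->
    (Q s < e%:E)%E.
Proof.
move=> cQ e e0.
have : \forall s \near within `[0, T] (nbhs t), (Q s < e%:E)%E.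
  have h : nbhs 0%E (fun y : \bar R => (y < e%:E)%E).
    by apply: open_ereal_lt'; rewrite lte_fin.
  exact: (cQ _ h).
rewrite near_withinE => -[d /= d0 hd].
exists d => // s s0 sT st; apply: hd; last by rewrite /= in_itv/= s0.
by rewrite /= distrC.
Qed.

Lemma near_eps' (Q : R -> \bar R) (T t : R) :
  Q s @[s --> within `[0, T] t^'] --> 0%E -> forall e : R, 0 < e ->
  exists2 d : R, 0 < d & forall s, 0 <= s -> s <= T -> s != t -> `|s - t| < d ->
    (Q s < e%:E)%E.
Proof.
move=> cQ e e0.
have : \forall s \near within `[0, T] t^', (Q s < e%:E)%E.
  have h : nbhs 0%E (fun y : \bar R => (y < e%:E)%E).
    by apply: open_ereal_lt'; rewrite lte_fin.
  exact: (cQ _ h).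
rewrite near_withinE near_withinE => -[d /= d0 hd].
exists d => // s s0 sT nst st; apply: hd => //; last by rewrite /= in_itv/= s0.
by rewrite /= distrC.
Qed.

Lemma normLoo_L2 (f : R -> R) (K : R) : measurable_fun I f ->
  (normLp I +oo%E f <= K%:E)%E ->
  sqi I f /\ \int[mu]_(x in I) (f x ^+ 2) <= K ^+ 2 * M.
Proof.
move=> mf fK; have := normLoo_ae mI fK => hf.
have hf' : {ae mu, forall x, I x -> `|f x| <= K}.
  by apply: aeS hf => x /[apply]; rewrite lee_fin.
have sf := sqi_bnd mI Ioo mf hf'; split => //.
have -> : K ^+ 2 * M = \int[mu]_(x in I) (fun=> K ^+ 2) x.
  by rewrite Rint_cst_itv ?subr0// ltW.
apply: ae_le_Rint => //; [exact: (proj2 sf)|exact: intg_cst|].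
apply: aeS hf' => x /[apply] h; rewrite -real_normK ?num_real//.
by rewrite ler_sqr ?nnegrE// (le_trans _ h).
Qed.

(* smallness in the norm forces smallness of the integral of the square; this is
   all that is used of the two norms at hand *)
Let norm_ok (p : \bar R) := forall e : R, 0 < e -> exists2 K : R, 0 < K &
  forall f, measurable_fun I f -> (normLp I p f <= K%:E)%E ->
    sqi I f /\ \int[mu]_(x in I) (f x ^+ 2) <= e.

Lemma norm_ok2 : norm_ok 2%:E.
Proof.
move=> e e0; exists (Num.sqrt e); first by rewrite sqrtr_gt0.
move=> f mf fK; have [sf h] := normL2_le mI mf (sqrtr_ge0 e) fK.
by rewrite sqr_sqrtr ?(ltW e0)// in h.
Qed.

Lemma norm_okoo : norm_ok +oo%E.
Proof.
move=> e e0; exists (Num.sqrt (e / M)); first by rewrite sqrtr_gt0 divr_gt0.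
move=> f mf fK; have [sf h] := normLoo_L2 mf fK.
by rewrite sqr_sqrtr ?divfK ?gt_eqF// ?divr_ge0 ?ltW// in h.
Qed.

Lemma CLp_path p g : norm_ok p ->
  (forall f, in_Lp I p f -> sqi I f) ->
  (forall T, 0 < T -> CLp M T p g) -> path g.
Proof.
move=> np sp cg t t0; have tT : 0 < t + 1 by rewrite ltr_wpDl.
have t1 : 0 <= t <= t + 1 by rewrite t0 lerDl ler01.
have [gin gc] := cg _ tT t t1; split; first exact: sp.
move=> e e0; have [K K0 hK] := np e e0.
have [d d0 hd] := near_eps gc K0.
exists (Num.min d 1); first by rewrite lt_min d0 ltr01.
move=> s s0; rewrite lt_min => /andP[sd s1].
have sT : s <= t + 1 by move: s1; rewrite ltr_norml => /andP[_]; lra.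
apply: (proj2 (hK _ _ _)); last by apply: ltW; exact: hd.
have [ms _] := proj1 (cg _ tT s (introT andP (conj s0 sT))).
by apply: measurable_funB => //; case: gin.
Qed.

Lemma C1Lp_path p g g' : norm_ok p ->
  (forall f, in_Lp I p f -> sqi I f) ->
  (forall T, 0 < T -> C1Lp M T p g g') ->
  [/\ path g, path g' & path_deriv g g'].
Proof.
move=> np sp cg; have pg : path g.
  by apply: (CLp_path np sp) => T T0; have [] := cg T T0.
have pg' : path g'.
  by apply: (CLp_path np sp) => T T0; have [] := cg T T0.
split => // t t0 e e0; have tT : 0 < t + 1 by rewrite ltr_wpDl.
have t1 : 0 <= t <= t + 1 by rewrite t0 lerDl ler01.
have [_ _ /(_ t t1) gc] := cg _ tT.
have [K K0 hK] := np e e0.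
have [d d0 hd] := near_eps' gc K0.
exists (Num.min d 1); first by rewrite lt_min d0 ltr01.
move=> s s0 nst; rewrite lt_min => /andP[sd s1].
have sT : s <= t + 1 by move: s1; rewrite ltr_norml => /andP[_]; lra.
apply: (proj2 (hK _ _ _)); last by apply: ltW; exact: hd.
have [[ms _] _] := pg s s0; have [[mt _] _] := pg t t0.
have [[mt' _] _] := pg' t t0.
by apply: measurable_funB => //; apply: measurable_funM => //; exact: measurable_funB.
Qed.

Lemma in_Loo_sqi f : in_Lp I +oo%E f -> sqi I f.
Proof.
move=> [mf foo].
have f0 : (0 <= normLp I +oo f)%E by exact: Lnorm_ge0.
have := @normLoo_L2 f (fine (normLp I +oo f)) mf.
by rewrite fineK ?ge0_fin_numE// => /(_ (lexx _)) [].
Qed.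

Lemma pathB g h : path g -> path h -> path (fun x t => g x t - h x t).
Proof.
move=> pg ph t t0; have [sg cg] := pg t t0; have [sh ch] := ph t t0.
split; first exact: sqiB.
move=> e e0; have e40 : 0 < e / 4%:R by rewrite divr_gt0.
have [d1 d10 h1] := cg _ e40; have [d2 d20 h2] := ch _ e40.
exists (Num.min d1 d2); first by rewrite lt_min d10.
move=> s s0; rewrite lt_min => /andP[/(h1 s s0) st1 /(h2 s s0) st2].
have sgs := sqiB mI (proj1 (pg s s0)) sg; have shs := sqiB mI (proj1 (ph s s0)) sh.
apply: (@le_trans _ _ (\int[mu]_(x in I) (2%:R * ((g x s - g x t) ^+ 2 + (h x s - h x t) ^+ 2)))).
  apply: ae_le_Rint => //.
  - by apply: (proj2 (sqiB mI _ _)); apply: sqiB => //;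
      [exact: (proj1 (pg s s0))|exact: (proj1 (ph s s0))].
  - by apply: intgZ => //; apply: intgD => //; [case: sgs|case: shs].
  - apply: aeW => x _; have := sqr_ge0 ((g x s - g x t) + (h x s - h x t)); nra.
rewrite RintegralZl//; last by apply: intgD => //; [case: sgs|case: shs].
rewrite RintegralD//; [lra|exact: (proj2 sgs)|exact: (proj2 shs)].
Qed.

Lemma path_derivB g g' h h' : path g -> path h -> path g' -> path h' ->
  path_deriv g g' -> path_deriv h h' ->
  path_deriv (fun x t => g x t - h x t) (fun x t => g' x t - h' x t).
Proof.
move=> pg ph pg' ph' dg dh t t0 e e0; have e40 : 0 < e / 4%:R by rewrite divr_gt0.
have [d1 d10 h1] := dg t t0 _ e40; have [d2 d20 h2] := dh t t0 _ e40.
exists (Num.min d1 d2); first by rewrite lt_min d10.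
move=> s s0 nst; rewrite lt_min => /andP[/(h1 s s0 nst) st1 /(h2 s s0 nst) st2].
have sq k k' : path k -> path k' -> sqi I (fun x => (k x s - k x t) / (s - t) - k' x t).
  move=> pk pk'; apply: sqiB => //; last exact: (proj1 (pk' t t0)).
  exact: (sqiZr (s - t)^-1 mI (sqiB mI (proj1 (pk s s0)) (proj1 (pk t t0)))).
have sgs := sq _ _ pg pg'; have shs := sq _ _ ph ph'.
have E x : (g x s - h x s - (g x t - h x t)) / (s - t) - (g' x t - h' x t) =
  ((g x s - g x t) / (s - t) - g' x t) - ((h x s - h x t) / (s - t) - h' x t) by ring.
under eq_Rintegral do rewrite E.
set a := fun x => (g x s - g x t) / (s - t) - g' x t in st1 sgs *.
set b := fun x => (h x s - h x t) / (s - t) - h' x t in st2 shs *.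
apply: (@le_trans _ _ (\int[mu]_(x in I) (2%:R * (a x ^+ 2 + b x ^+ 2)))).
  apply: ae_le_Rint => //.
  - exact: (proj2 (sqiB mI sgs shs)).
  - by apply: intgZ => //; apply: intgD => //; [case: sgs|case: shs].
  - apply: aeW => x _; have := sqr_ge0 (a x + b x); rewrite /a /b; nra.
rewrite RintegralZl//; last by apply: intgD => //; [case: sgs|case: shs].
rewrite RintegralD//; [lra|exact: (proj2 sgs)|exact: (proj2 shs)].
Qed.

Lemma path_cst (f : R -> R) : sqi I f -> path (fun x _ => f x).
Proof.
move=> sf t t0; split => // e e0; exists 1 => // s _ _.
under eq_Rintegral do rewrite subrr expr0n/=.
by rewrite (@Rint_cst_itv R 0 M 0 (ltW M0)) mul0r ltW.
Qed.

Lemma path_const (c : R) : path (fun _ _ => c).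
Proof.
apply: path_cst; apply: (@sqi_bnd _ _ _ `|c|) => //; exact: aeW.
Qed.

Lemma path_pair_cont w W g h : measurable_fun I w -> (forall x, I x -> `|w x| <= W) ->
  path g -> path h -> cont0 (fun t => \int[mu]_(x in I) (w x * (g x t * h x t))).
Proof.
move=> mw hw pg ph t e t0 e0.
have [sg cg] := pg t t0; have [sh ch] := ph t t0.
have [d d0 hd] := pairing_continuous mI mw hw sg sh e0.
have [d1 d10 h1] := cg _ d0; have [d2 d20 h2] := ch _ d0.
exists (Num.min d1 d2); first by rewrite lt_min d10.
move=> s s0; rewrite lt_min => /andP[/(h1 s s0) st1 /(h2 s s0) st2].
by apply: hd => //; [case: (pg s s0)|case: (ph s s0)].
Qed.

Lemma wprod_intg w W f (g : R -> R) : measurable_fun I w -> (forall x, I x -> `|w x| <= W) ->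
  sqi I f -> sqi I g -> intg I (fun x => w x * (f x * g x)).
Proof.
move=> mw hw sf sg.
have := @intgM _ _ _ w W mI (sqi_prod mI sf sg) mw (aeW hw).
by apply: eq_intg => // x _; rewrite mulrC.
Qed.

(** [g(s)^2 - g(t)^2 = (g(s) + g(t)) (g(s) - g(t))]: the first factor and the
    quotient of the second by [s - t] converge in [L^2]. *)
Lemma path_sq_deriv w W g g' : measurable_fun I w -> (forall x, I x -> `|w x| <= W) ->
  path g -> path g' -> path_deriv g g' ->
  deriv0 (fun t => \int[mu]_(x in I) (w x * (g x t * g x t)))
         (fun t => \int[mu]_(x in I) (w x * (2%:R * g x t * g' x t))).
Proof.
move=> mw hw pg pg' dg t e t0 e0.
have [sg cg] := pg t t0; have [sg' _] := pg' t t0.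
have s2 := sqiZ 2%:R mI sg.
have [d d0 hd] := pairing_continuous mI mw hw s2 sg' e0.
have [d1 d10 h1] := cg _ d0; have [d2 d20 h2] := dg t t0 _ d0.
exists (Num.min d1 d2); first by rewrite lt_min d10.
move=> s s0 nst; rewrite lt_min => /andP[/(h1 s s0) st1 /(h2 s s0 nst) st2].
have sgs := proj1 (pg s s0).
have sq : sqi I (fun x => (g x s - g x t) / (s - t)).
  exact: (sqiZr (s - t)^-1 mI (sqiB mI sgs sg)).
have sp : sqi I (fun x => g x s + g x t) by exact: sqiD.
have := hd _ _ sp sq; rewrite -RintegralB//; last 2 first.
- exact: (wprod_intg mw hw).
- exact: (wprod_intg mw hw).
rewrite (_ : (_ - _) / (s - t) = \int[mu]_(x in I)
    (w x * ((g x s + g x t) * ((g x s - g x t) / (s - t))))); last first.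
  rewrite -RintegralB//; [|exact: (wprod_intg mw hw)|exact: (wprod_intg mw hw)].
  rewrite -RintegralZr//; last first.
    by apply: intgB => //; exact: (wprod_intg mw hw).
  by apply: eq_Rintegral => x _; ring.
rewrite -RintegralB//; last 2 first.
- exact: (wprod_intg mw hw).
- exact: (wprod_intg mw hw).
apply; last exact: st2.
apply: le_trans st1; rewrite le_eqVlt; apply/orP; left; apply/eqP.
by apply: eq_Rintegral => x _; ring.
Qed.

Lemma path_lin_deriv phi W g g' : measurable_fun I phi ->
  (forall x, I x -> `|phi x| <= W) ->
  path g -> path g' -> path_deriv g g' ->
  deriv0 (fun t => \int[mu]_(x in I) (g x t * phi x))
         (fun t => \int[mu]_(x in I) (g' x t * phi x)).
Proof.
move=> mw hw pg pg' dg t e t0 e0.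
have [sg _] := pg t t0; have [sg' _] := pg' t t0.
have s1 : sqi I (fun=> 1 : R).
  by apply: (@sqi_bnd _ _ _ 1) => //; apply: aeW => x _; rewrite normr1.
have [d d0 hd] := pairing_continuous mI mw hw s1 sg' e0.
have [d2 d20 h2] := dg t t0 _ d0; exists d2 => // s s0 nst /(h2 s s0 nst) st2.
have sgs := proj1 (pg s s0).
have sq : sqi I (fun x => (g x s - g x t) / (s - t)).
  exact: (sqiZr (s - t)^-1 mI (sqiB mI sgs sg)).
have := hd _ _ s1 sq.
have ip f : sqi I f -> intg I (fun x => f x * phi x).
  by move=> sf; apply: eq_intg (wprod_intg mw hw s1 sf) => // x _; rewrite mul1r mulrC.
have -> : (\int[mu]_(x in I) (g x s * phi x) - \int[mu]_(x in I) (g x t * phi x)) / (s - t)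
  = \int[mu]_(x in I) (phi x * (1 * ((g x s - g x t) / (s - t)))).
  rewrite -RintegralB//; [|exact: ip|exact: ip].
  rewrite -RintegralZr//; last by apply: intgB => //; exact: ip.
  by apply: eq_Rintegral => x _; ring.
have -> : \int[mu]_(x in I) (g' x t * phi x) = \int[mu]_(x in I) (phi x * (1 * g' x t)).
  by apply: eq_Rintegral => x _; rewrite mul1r mulrC.
apply => //; under eq_Rintegral do rewrite subrr expr0n/=.
by rewrite (@Rint_cst_itv R 0 M 0 (ltW M0)) mul0r ltW.
Qed.

End Paths.

(** * The viscous fluxes on a box of states *)

Section PowerFunctions.
Context {R : realType}.
Implicit Types (a b e L p x y : R).

Lemma powR_mvt a b p : 0 < a -> a < b ->
  exists2 c, a < c < b & b `^ p - a `^ p = p * c `^ (p - 1) * (b - a).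
Proof.
move=> a0 ab.
have dp x : 0 < x -> is_derive x 1 (fun y : R => y `^ p) (p * x `^ (p - 1)).
  move=> x0; have xi : x \in `]0, +oo[ by rewrite in_itv/= x0.
  apply: DeriveDef; first exact: derivable_powR.
  by rewrite -derive1E powR_derive1.
have h1 x : x \in `]a, b[ -> is_derive x 1 (fun y : R => y `^ p) (p * x `^ (p - 1)).
  by rewrite in_itv/= => /andP[ax _]; apply: dp; exact: lt_trans ax.
have h2 : {within `[a, b], continuous (fun y : R => y `^ p)}.
  apply: derivable_within_continuous => x; rewrite in_itv/= => /andP[ax _].
  by have [] := dp x (lt_le_trans a0 ax).
have [c cab ->] := MVT ab h1 h2.
by exists c => //; rewrite in_itv/= in cab.
Qed.

Lemma powR_bound e L p x : 0 < e -> e <= x -> x <= L ->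
  x `^ p <= e `^ p + L `^ p.
Proof.
move=> e0 ex xL; have x0 := lt_le_trans e0 ex; have L0 := lt_le_trans x0 xL.
have [p0|p0] := leP 0 p.
  rewrite (@le_trans _ _ (L `^ p))//; last by rewrite lerDr powR_ge0.
  by apply: ge0_ler_powR; rewrite ?nnegrE// ltW.
rewrite (@le_trans _ _ (e `^ p))//; last by rewrite lerDl powR_ge0.
rewrite -(opprK p) !(powRN _ (- p)) lef_pV2 ?posrE ?powR_gt0//.
by apply: ge0_ler_powR; rewrite ?nnegrE ?oppr_ge0 // ltW.
Qed.

Lemma powR_lip e L p : 0 < e -> exists2 K, 0 <= K &
  forall x y, e <= x <= L -> e <= y <= L -> `|x `^ p - y `^ p| <= K * `|x - y|.
Proof.
move=> e0; exists (`|p| * (e `^ (p - 1) + L `^ (p - 1))).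
  by rewrite mulr_ge0// addr_ge0// powR_ge0.
have main x y : e <= x -> y <= L -> x < y ->
    `|y `^ p - x `^ p| <= `|p| * (e `^ (p - 1) + L `^ (p - 1)) * `|y - x|.
  move=> ex yL xy; have [c /andP[xc cy] ->] := powR_mvt p (lt_le_trans e0 ex) xy.
  rewrite !normrM ler_wpM2r// ler_wpM2l// ger0_norm ?powR_ge0//.
  by apply: powR_bound => //; [exact: (le_trans ex (ltW xc))|exact: (le_trans (ltW cy) yL)].
move=> x y /andP[ex xL] /andP[ey yL]; have [xy|yx|->] := ltgtP x y.
- by rewrite distrC [`|x - y|]distrC main.
- by rewrite main.
- by rewrite !subrr normr0 mulr0.
Qed.

Lemma powR_taylor e L p : 0 < e -> exists2 K, 0 <= K &
  forall a b, e <= a <= L -> e <= b <= L ->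
  `|b `^ p - a `^ p - p * a `^ (p - 1) * (b - a)| <= K * (b - a) ^+ 2 /\
  `|p * b `^ (p - 1) - p * a `^ (p - 1)| <= K * `|b - a|.
Proof.
move=> e0; have [K K0 hK] := powR_lip L (p - 1) e0.
exists (`|p| * K); first by rewrite mulr_ge0.
move=> a b ha hb; have lip x y : e <= x <= L -> e <= y <= L ->
    `|p * y `^ (p - 1) - p * x `^ (p - 1)| <= `|p| * K * `|y - x|.
  by move=> hx hy; rewrite -mulrBr normrM -mulrA ler_wpM2l// hK.
split; last exact: lip.
have main c : e <= c <= L -> `|c - a| <= `|b - a| ->
    b `^ p - a `^ p = p * c `^ (p - 1) * (b - a) ->
    `|b `^ p - a `^ p - p * a `^ (p - 1) * (b - a)| <= `|p| * K * (b - a) ^+ 2.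
  move=> hc ca ->; rewrite -mulrBl normrM.
  rewrite -[(b - a) ^+ 2]real_normK ?num_real// expr2 mulrA ler_wpM2r//.
  by rewrite (le_trans (lip a c ha hc))// ler_wpM2l// mulr_ge0.
move: ha hb => /andP[ea aL] /andP[eb bL].
have [ab|ba|ab] := ltgtP a b.
- have [c /andP[ac cb] E] := powR_mvt p (lt_le_trans e0 ea) ab.
  apply: (main c) => //.
    by rewrite (le_trans ea (ltW ac)) (le_trans (ltW cb) bL).
  by rewrite !ger0_norm ?subr_ge0 ?ltW//; lra.
- have [c /andP[ac cb] E] := powR_mvt p (lt_le_trans e0 eb) ba.
  apply: (main c) => //.
  + by rewrite (le_trans eb (ltW ac)) (le_trans (ltW cb) aL).
  + by rewrite !ler0_norm ?subr_le0 ?ltW//; lra.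
  + by rewrite -opprB E; ring.
- by rewrite ab !subrr mulr0 subrr normr0 expr0n mulr0.
Qed.

End PowerFunctions.

Section Lipschitz.
Context {R : realType}.
Variables rho1 rho2 r1 r2 V : R.
Hypothesis rho10 : 0 < rho1.
Hypothesis r10 : 0 < r1.
Implicit Types (F G : R -> R -> R -> R -> R) (a b c d : R).

Definition box a b c d :=
  [/\ rho1 <= a <= rho2, r1 <= b <= r2, `|c| <= V & `|d| <= V].

(** Bounded Lipschitz functions on a box; the last clause, that they preserve
    measurability, makes the class usable under the integral sign. *)
Definition lip G := (exists2 L, 0 <= L & forall a b c d a' b' c' d',
    box a b c d -> box a' b' c' d' -> `|G a b c d| <= L /\
    `|G a b c d - G a' b' c' d'| <=
      L * (`|a - a'| + `|b - b'| + `|c - c'| + `|d - d'|)) /\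
  (forall (D : set R) (fa fb fc fd : R -> R), measurable_fun D fa ->
    measurable_fun D fb -> measurable_fun D fc -> measurable_fun D fd ->
    measurable_fun D (fun x => G (fa x) (fb x) (fc x) (fd x))).

Let dist0 a b c d a' b' c' d' :
  0 <= `|a - a'| + `|b - b'| + `|c - c'| + `|d - d'|.
Proof. by rewrite !addr_ge0. Qed.

Lemma lip_cst (k : R) : lip (fun _ _ _ _ => k).
Proof.
split=> //; exists `|k| => // a b c d a' b' c' d' _ _; split => //.
by rewrite subrr normr0 mulr_ge0.
Qed.

Lemma lip_proj1 : lip (fun a _ _ _ => a).
Proof.
split=> //; exists (`|rho2| + 1); first by rewrite addr_ge0.
move=> a b c d a' b' c' d' [/andP[ha ha'] _ _ _] _; split.
  rewrite ger0_norm ?(le_trans (ltW rho10))//.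
  by rewrite (le_trans ha')// (le_trans (ler_norm _))// lerDl.
apply: (@le_trans _ _ (1 * `|a - a'|)); first by rewrite mul1r.
by rewrite ler_pM// ?lerDr// -!addrA lerDl !addr_ge0.
Qed.

Lemma lip_proj2 : lip (fun _ b _ _ => b).
Proof.
split=> //; exists (`|r2| + 1); first by rewrite addr_ge0.
move=> a b c d a' b' c' d' [_ /andP[ha ha'] _ _] _; split.
  rewrite ger0_norm ?(le_trans (ltW r10))//.
  by rewrite (le_trans ha')// (le_trans (ler_norm _))// lerDl.
apply: (@le_trans _ _ (1 * `|b - b'|)); first by rewrite mul1r.
by rewrite ler_pM// ?lerDr// [`|a - a'| + _]addrC -!addrA lerDl !addr_ge0.
Qed.

Lemma lip_proj3 : lip (fun _ _ c _ => c).
Proof.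
split=> //; exists (`|V| + 1); first by rewrite addr_ge0.
move=> a b c d a' b' c' d' [_ _ ha _] _; split.
  by rewrite (le_trans ha)// (le_trans (ler_norm _))// lerDl.
apply: (@le_trans _ _ (1 * `|c - c'|)); first by rewrite mul1r.
by rewrite ler_pM// ?lerDr// [_ + `|c - c'|]addrC -!addrA lerDl !addr_ge0.
Qed.

Lemma lip_proj4 : lip (fun _ _ _ d => d).
Proof.
split=> //; exists (`|V| + 1); first by rewrite addr_ge0.
move=> a b c d a' b' c' d' [_ _ _ ha] _; split.
  by rewrite (le_trans ha)// (le_trans (ler_norm _))// lerDl.
apply: (@le_trans _ _ (1 * `|d - d'|)); first by rewrite mul1r.
by rewrite ler_pM// ?lerDr// lerDr !addr_ge0.
Qed.

Lemma lipD F G : lip F -> lip G -> lip (fun a b c d => F a b c d + G a b c d).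
Proof.
move=> [[L L0 hL] mF] [[K K0 hK] mG]; split; last first.
  by move=> D fa fb fc fd ma mb mc md; apply: measurable_funD; [exact: mF|exact: mG].
exists (L + K); first by rewrite addr_ge0.
move=> a b c d a' b' c' d' h h'.
have [x1 x2] := hL _ _ _ _ _ _ _ _ h h'; have [y1 y2] := hK _ _ _ _ _ _ _ _ h h'.
split; first by rewrite (le_trans (ler_normD _ _))// lerD.
rewrite opprD addrACA mulrDl (le_trans (ler_normD _ _))// lerD//.
Qed.

Lemma lipM F G : lip F -> lip G -> lip (fun a b c d => F a b c d * G a b c d).
Proof.
move=> [[L L0 hL] mF] [[K K0 hK] mG]; split; last first.
  by move=> D fa fb fc fd ma mb mc md; apply: measurable_funM; [exact: mF|exact: mG].
exists (2%:R * (L * K)); first by rewrite mulr_ge0// mulr_ge0.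
move=> a b c d a' b' c' d' h h'.
have [x1 x2] := hL _ _ _ _ _ _ _ _ h h'; have [y1 y2] := hK _ _ _ _ _ _ _ _ h h'.
have [y1' _] := hK _ _ _ _ _ _ _ _ h' h.
split.
  rewrite normrM (le_trans (ler_pM _ _ x1 y1))//.
  by rewrite ler_peMl ?mulr_ge0// ler1n.
set S := _ + _ + _ + _ in x2 y2 *.
have -> : F a b c d * G a b c d - F a' b' c' d' * G a' b' c' d' =
  F a b c d * (G a b c d - G a' b' c' d') + (F a b c d - F a' b' c' d') * G a' b' c' d' by ring.
rewrite (le_trans (ler_normD _ _))// !normrM.
have e1 := ler_pM (normr_ge0 _) (normr_ge0 _) x1 y2.
have e2 := ler_pM (normr_ge0 _) (normr_ge0 _) x2 y1'.
by rewrite (le_trans (lerD e1 e2))//; lra.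
Qed.

Lemma lipN F : lip F -> lip (fun a b c d => - F a b c d).
Proof.
move=> /(lipM (lip_cst (-1))); congr lip.
by apply/funext=> a; apply/funext=> b; apply/funext=> c; apply/funext=> d; rewrite mulN1r.
Qed.

Lemma lipB F G : lip F -> lip G -> lip (fun a b c d => F a b c d - G a b c d).
Proof. by move=> hF /lipN hG; exact: lipD. Qed.

Lemma lipX F k : lip F -> lip (fun a b c d => F a b c d ^+ k).
Proof.
move=> hF; elim: k => [|k IH]; first exact: (lip_cst 1).
have := lipM hF IH; congr lip.
by apply/funext=> a; apply/funext=> b; apply/funext=> c; apply/funext=> d; rewrite exprS.
Qed.

Lemma lip_powR F e p : lip F -> 0 < e ->
  (forall a b c d, box a b c d -> e <= F a b c d) ->
  lip (fun a b c d => F a b c d `^ p).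
Proof.
move=> [[L L0 hL] mF] e0 hF; split; last first.
  by move=> D fa fb fc fd ma mb mc md; apply: measurable_fun_powR; exact: mF.
have [K K0 hK] := powR_lip L p e0.
exists (e `^ p + L `^ p + K * L); first by rewrite !addr_ge0 ?powR_ge0 ?mulr_ge0.
move=> a b c d a' b' c' d' h h'.
have [x1 x2] := hL _ _ _ _ _ _ _ _ h h'; have [x1' _] := hL _ _ _ _ _ _ _ _ h' h.
have i1 : e <= F a b c d <= L by rewrite hF//= (le_trans (ler_norm _)).
have i2 : e <= F a' b' c' d' <= L by rewrite hF//= (le_trans (ler_norm _)).
split.
  rewrite ger0_norm ?powR_ge0//; case/andP: i1 => i1 i1'.
  by rewrite (le_trans (powR_bound p e0 i1 i1'))// lerDl mulr_ge0.
rewrite (le_trans (hK _ _ i1 i2))//.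
rewrite (le_trans (ler_wpM2l K0 x2))// mulrA ler_wpM2r//.
by rewrite lerDr addr_ge0// powR_ge0.
Qed.

Lemma lipV F e : lip F -> 0 < e ->
  (forall a b c d, box a b c d -> e <= F a b c d) ->
  lip (fun a b c d => (F a b c d)^-1).
Proof.
move=> [[L L0 hL] mF] e0 hF; split; last first.
  by move=> D fa fb fc fd ma mb mc md; apply: measurable_funV; exact: mF.
have ei0 : 0 < e^-1 by rewrite invr_gt0.
exists (e^-1 + e^-1 * e^-1 * L).
  by rewrite addr_ge0 ?mulr_ge0// ltW.
have inv y : e <= y -> 0 <= y^-1 <= e^-1.
  move=> ey; have y0 := lt_le_trans e0 ey.
  by rewrite invr_ge0 (ltW y0) lef_pV2.
move=> a b c d a' b' c' d' h h'.
have [x1 x2] := hL _ _ _ _ _ _ _ _ h h'.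
have p1 := hF _ _ _ _ h; have p2 := hF _ _ _ _ h'.
have /andP[u1 u2] := inv _ p1; have /andP[w1 w2] := inv _ p2.
split; first by rewrite ger0_norm// (le_trans u2)// lerDl !mulr_ge0// ltW.
have n1 : F a b c d != 0 by rewrite gt_eqF// (lt_le_trans e0).
have n2 : F a' b' c' d' != 0 by rewrite gt_eqF// (lt_le_trans e0).
have -> : (F a b c d)^-1 - (F a' b' c' d')^-1 =
  - ((F a b c d)^-1 * (F a' b' c' d')^-1 * (F a b c d - F a' b' c' d')).
  by field; rewrite n1 n2.
rewrite normrN 2!normrM (ger0_norm u1) (ger0_norm w1).
rewrite mulrDl ler_wpDl ?mulr_ge0// ?(ltW ei0)// -[leRHS]mulrA.
by rewrite ler_pM ?mulr_ge0// ler_pM.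
Qed.

Lemma lip_rho_powR p : lip (fun a _ _ _ => a `^ p).
Proof. by apply: (lip_powR p lip_proj1 rho10) => a b c d [/andP[]]. Qed.

Lemma lip_rhoV : lip (fun a _ _ _ => a^-1).
Proof. by apply: (lipV lip_proj1 rho10) => a b c d [/andP[]]. Qed.

Lemma lip_rV : lip (fun _ b _ _ => b^-1).
Proof. by apply: (lipV lip_proj2 r10) => a b c d [_ /andP[]]. Qed.

(** What remains to be estimated of a flux once its variation in the last two
    arguments has gone into the dissipation. *)
Lemma lip_bound12 G : lip G -> exists2 L, 0 <= L &
  forall a b a' b' c d, box a b c d -> box a' b' c d ->
  `|G a b c d - G a' b' c d| <= L * (`|a - a'| + `|b - b'|).
Proof.
move=> [[L L0 hL] _]; exists L => // a b a' b' c d h h'.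
have [_] := hL _ _ _ _ _ _ _ _ h h'.
by rewrite !subrr normr0 !addr0.
Qed.

End Lipschitz.

Section Pointwise.
Context {R : realType}.
Variables (n : nat) (A gamma G theta c1 c2 : R).
Hypothesis n2 : (2 <= n)%N.
Hypothesis theta0 : 0 <= theta.
Hypothesis c10 : 0 < c1.
Hypothesis c20 : 0 < 2%:R * c1 + n%:R * c2.
Variables rho1 rho2 r1 r2 V : R.
Hypothesis rho10 : 0 < rho1.
Hypothesis r10 : 0 < r1.
Implicit Types (a b y u : R).

Local Notation N := (n%:R - 1 : R).

(** Fluxes of the momentum equation in terms of [(rho, r, r^(n-1) u_x, u)], with
    [r] possibly rescaled by [x^(1/n)]. *)
Definition divv a b y u : R := b ^+ n.-1 * y + N * u / (b * a).

Definition stress a b y u : R :=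
  A * a `^ gamma - c2 * a `^ theta * (a * divv a b y u).

Definition fluxa a b y u : R :=
  b ^+ n.-1 * (stress a b y u - 2%:R * (c1 * a `^ theta) * (a * b ^+ n.-1 * y)).

Definition fluxb a b y u : R :=
  N / (b * a) * (stress a b y u - 2%:R * (c1 * a `^ theta) * (u / b)).

Lemma N_ge1 : 1 <= N.
Proof. by rewrite lerBrDr -[1 + 1]/(2%:R) ler_nat. Qed.

Local Notation lip := (lip rho1 rho2 r1 r2 V).
Local Notation box := (box rho1 rho2 r1 r2 V).

Lemma lip_divv : lip divv.
Proof.
apply: lipD; apply: lipM.
- exact: lipX (lip_proj2 _ _ _ _ r10).
- exact: lip_proj3.
- by apply: lipM; [exact: lip_cst|exact: lip_proj4].
- have := lipM (lip_rV rho1 rho2 r2 V r10) (lip_rhoV rho2 r1 r2 V rho10).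
  by congr lip; do 4 (apply/funext => ?); rewrite invfM.
Qed.

Lemma lip_stress : lip stress.
Proof.
apply: lipB.
  by apply: lipM; [exact: lip_cst|exact: lip_rho_powR].
apply: lipM; first by apply: lipM; [exact: lip_cst|exact: lip_rho_powR].
by apply: lipM; [exact: lip_proj1|exact: lip_divv].
Qed.

Lemma lip_visc : lip (fun a _ _ _ => 2%:R * (c1 * a `^ theta)).
Proof.
apply: lipM; first exact: lip_cst.
by apply: lipM; [exact: lip_cst|exact: lip_rho_powR].
Qed.

Lemma lip_area : lip (fun a b _ _ => b ^+ n.-1).
Proof. exact: lipX (lip_proj2 _ _ _ _ r10). Qed.

Lemma lip_geom : lip (fun a b _ _ => N / (b * a)).
Proof.
apply: lipM; first exact: lip_cst.
have := lipM (lip_rV rho1 rho2 r2 V r10) (lip_rhoV rho2 r1 r2 V rho10).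
by congr lip; do 4 (apply/funext => ?); rewrite invfM.
Qed.

Lemma lip_fluxa : lip fluxa.
Proof.
apply: lipM; first exact: lip_area.
apply: lipB; first exact: lip_stress.
apply: lipM; first exact: lip_visc.
by apply: lipM; [apply: lipM; [exact: lip_proj1|exact: lip_area]|exact: lip_proj3].
Qed.

Lemma lip_fluxb : lip fluxb.
Proof.
apply: lipM; first exact: lip_geom.
apply: lipB; first exact: lip_stress.
apply: lipM; first exact: lip_visc.
by apply: lipM; [exact: lip_proj4|exact: lip_rV].
Qed.

Lemma lip_areaV : lip (fun a b _ _ => (b ^+ n.-1)^-1).
Proof.
apply: (lipV lip_area (e := r1 ^+ n.-1)); first exact: exprn_gt0.
move=> a b c d [_ /andP[h _] _ _]; apply: lerXn2r => //; rewrite ?nnegrE ?ltW//.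
exact: lt_le_trans h.
Qed.

(** For [c2 >= 0] the second term is dropped; for [c2 < 0] it is bounded by
    [(p + (n-1) q)^2 <= n (p^2 + (n-1) q^2)]. *)
Lemma elliptic (p q : R) :
  Num.min (2%:R * c1) (2%:R * c1 + n%:R * c2) * (p ^+ 2 + N * q ^+ 2) <=
  2%:R * c1 * (p ^+ 2 + N * q ^+ 2) + c2 * (p + N * q) ^+ 2.
Proof.
have N1 := N_ge1; have N0 : 0 <= N := le_trans ler01 N1.
have S0 : 0 <= p ^+ 2 + N * q ^+ 2 by rewrite addr_ge0 ?sqr_ge0// mulr_ge0 ?sqr_ge0.
have cs : (p + N * q) ^+ 2 <= n%:R * (p ^+ 2 + N * q ^+ 2).
  rewrite -subr_ge0.
  have -> : n%:R * (p ^+ 2 + N * q ^+ 2) - (p + N * q) ^+ 2 = N * (p - q) ^+ 2 by ring.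
  by rewrite mulr_ge0// sqr_ge0.
have [c2p|c2n] := leP 0 c2.
  rewrite (@le_trans _ _ (2%:R * c1 * (p ^+ 2 + N * q ^+ 2)))//.
    by rewrite ler_wpM2r// ge_min lexx.
  by rewrite lerDl mulr_ge0// sqr_ge0.
rewrite (@le_trans _ _ ((2%:R * c1 + n%:R * c2) * (p ^+ 2 + N * q ^+ 2)))//.
  by rewrite ler_wpM2r// ge_min lexx orbT.
by rewrite mulrDl lerD2l [n%:R * c2]mulrC -mulrA ler_wnM2l// ltW.
Qed.

(** For fixed [a] and [b] the fluxes are affine in [(y, u)], and the left-hand
    side is minus the form of [elliptic] at [p = a b^(n-1) (y - y')] and
    [q = (u - u') / b], up to a positive factor. *)
Lemma dissipation : exists2 k, 0 < k & forall a b y u y' u',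
  box a b y u -> box a b y' u' ->
  (fluxa a b y u - fluxa a b y' u') * (y - y') +
  (fluxb a b y u - fluxb a b y' u') * (u - u') <=
  - (k * ((y - y') ^+ 2 + (u - u') ^+ 2)).
Proof.
set m := Num.min (2%:R * c1) (2%:R * c1 + n%:R * c2).
have m0 : 0 < m by rewrite lt_min mulr_gt0.
have N1 := N_ge1; have N0 : 0 <= N := le_trans ler01 N1.
pose k1 := rho1 * (r1 ^+ n.-1) ^+ 2.
pose k2 := (`|rho2| + 1)^-1 * (`|r2| + 1) ^- 2.
have k10 : 0 < k1 by rewrite mulr_gt0// exprn_gt0// exprn_gt0.
have k20 : 0 < k2 by rewrite mulr_gt0 ?invr_gt0 ?exprn_gt0// ltr_wpDl.
exists (rho1 `^ theta * m * Num.min k1 k2).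
  by rewrite !mulr_gt0 ?powR_gt0// lt_min k10.
move=> a b y u y' u' [/andP[a1 a2] /andP[b1 b2] _ _] _.
have a0 := lt_le_trans rho10 a1; have b0 := lt_le_trans r10 b1.
set z := y - y'; set w := u - u'.
pose p := a * b ^+ n.-1 * z; pose q := w / b.
have -> : (fluxa a b y u - fluxa a b y' u') * z +
  (fluxb a b y u - fluxb a b y' u') * w =
  - (a^-1 * a `^ theta * (2%:R * c1 * (p ^+ 2 + N * q ^+ 2) + c2 * (p + N * q) ^+ 2)).
  rewrite /fluxa /fluxb /stress /divv /p /q /z /w.
  by move: (b ^+ n.-1) (a `^ theta) (a `^ gamma) => B T P; field; rewrite !gt_eqF.
rewrite lerN2.
have T0 : rho1 `^ theta <= a `^ theta.
  by apply: ge0_ler_powR => //; rewrite nnegrE ltW.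
have ell := elliptic p q; rewrite -/m /= in ell.
have S0 : 0 <= p ^+ 2 + N * q ^+ 2 by rewrite addr_ge0 ?sqr_ge0// mulr_ge0 ?sqr_ge0.
have ai0 : 0 < a^-1 by rewrite invr_gt0.
have rt0 : 0 < rho1 `^ theta by rewrite powR_gt0.
apply: (@le_trans _ _ (a^-1 * rho1 `^ theta * (m * (p ^+ 2 + N * q ^+ 2)))); last first.
  apply: (@le_trans _ _ (a^-1 * a `^ theta * (m * (p ^+ 2 + N * q ^+ 2)))).
    by rewrite ler_wpM2r ?mulr_ge0 ?(ltW m0)// ler_wpM2l// ltW.
  by rewrite ler_wpM2l// mulr_ge0 ?powR_ge0 ?(ltW ai0).
have -> : a^-1 * rho1 `^ theta * (m * (p ^+ 2 + N * q ^+ 2)) =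
  rho1 `^ theta * m * (a^-1 * p ^+ 2 + N * (a^-1 * q ^+ 2)) by ring.
rewrite -[leLHS]mulrA ler_wpM2l ?mulr_ge0 ?(ltW m0) ?(ltW rt0)//.
rewrite mulrDr lerD//.
  have -> : a^-1 * p ^+ 2 = a * (b ^+ n.-1) ^+ 2 * z ^+ 2.
    by rewrite /p; move: (b ^+ n.-1) => B; field; rewrite gt_eqF.
  rewrite ler_wpM2r ?sqr_ge0// (@le_trans _ _ k1)//; first by rewrite ge_min lexx.
  have hB : r1 ^+ n.-1 <= b ^+ n.-1 by rewrite lerXn2r// nnegrE ltW.
  have hB2 : (r1 ^+ n.-1) ^+ 2 <= (b ^+ n.-1) ^+ 2.
    by rewrite ler_sqr ?nnegrE ?exprn_ge0 ?(ltW r10) ?(ltW b0).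
  by rewrite /k1 ler_pM ?sqr_ge0 ?(ltW rho10).
have -> : a^-1 * q ^+ 2 = a^-1 * b ^- 2 * w ^+ 2 by rewrite /q; field; rewrite !gt_eqF.
rewrite [leRHS]mulrA ler_wpM2r ?sqr_ge0// (@le_trans _ _ k2)//; first by rewrite ge_min lexx orbT.
rewrite (@le_trans _ _ (a^-1 * b ^- 2))//; last by rewrite ler_peMl// mulr_ge0 ?invr_ge0 ?exprn_ge0 ?(ltW a0) ?(ltW b0).
have hr : a <= `|rho2| + 1 by rewrite (le_trans a2)// (le_trans (ler_norm _))// lerDl.
have hb : b <= `|r2| + 1 by rewrite (le_trans b2)// (le_trans (ler_norm _))// lerDl.
have P1 : 0 < `|rho2| + 1 by rewrite ltr_wpDl.
have P2 : 0 < `|r2| + 1 by rewrite ltr_wpDl.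
rewrite /k2 ler_pM ?invr_ge0 ?exprn_ge0 ?(ltW P1) ?(ltW P2)//.
  by rewrite lef_pV2.
by rewrite lef_pV2 ?posrE ?exprn_gt0// ler_sqr ?nnegrE ?(ltW b0) ?(ltW P2).
Qed.

End Pointwise.

(** The integrand of the derivative of the energy is bounded by the energy
    density: [X] stands for [x^(1/n)], [PG] for the external pressure, and [Df]
    for the difference of the two perturbed forces. *)
Definition energy_bound (R : realType) (n : nat) (A gamma G theta c1 c2 : R)
    (rho1 rho2 r1 r2 V Pmax Xmax K : R) : Prop :=
  forall a b y u a' b' y' u' PG X m Df : R,
  box rho1 rho2 r1 r2 V a b y u -> box rho1 rho2 r1 r2 V a' b' y' u' ->
  `|PG| <= Pmax -> 0 <= X <= Xmax -> 0 <= m ->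
  `|Df| <= m * (X * `|b - b'|) ->
  (fluxa n A gamma theta c1 c2 a b y u - fluxa n A gamma theta c1 c2 a' b' y' u'
     - PG * (b ^+ n.-1 - b' ^+ n.-1)) * (y - y')
  + (fluxb n A gamma theta c1 c2 a b y u - fluxb n A gamma theta c1 c2 a' b' y' u'
     - PG * ((n%:R - 1) / (b * a) - (n%:R - 1) / (b' * a'))) * (u - u')
  - (G * X * ((b ^+ n.-1)^-1 - (b' ^+ n.-1)^-1) + Df) * (X * (u - u'))
  + (a - a') * (a' ^+ 2 * divv n a' b' y' u' - a ^+ 2 * divv n a b y u)
  + `|(b - b') * (u - u')| <=
  K * (1 + m ^+ 2) * ((X * (u - u')) ^+ 2 + (a - a') ^+ 2 + (b - b') ^+ 2).

(** Every error term is a product of [`|a - a'| + `|b - b'|] with a difference in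
    one of the four variables; Young's inequality gives its part in [y - y']
    and [u - u'] to the dissipation. The force is the exception: its bound [m] is
    not uniform, and it is paired with [X (u - u')], which belongs to the
    energy. *)
Lemma energy_pointwise (R : realType) (n : nat) (A gamma G theta c1 c2 : R)
    (rho1 rho2 r1 r2 V Pmax Xmax : R) :
  (2 <= n)%N -> 0 <= theta -> 0 < c1 -> 0 < 2%:R * c1 + n%:R * c2 ->
  0 < rho1 -> 0 < r1 ->
  exists2 K, 0 <= K &
    energy_bound n A gamma G theta c1 c2 rho1 rho2 r1 r2 V Pmax Xmax K.
Proof.
move=> n2 theta0 c10 c20 rho10 r10.
pose N : R := n%:R - 1.
pose fluxa := fluxa n A gamma theta c1 c2.
pose fluxb := fluxb n A gamma theta c1 c2.
have [k k0 hk] := dissipation A gamma n2 theta0 c10 c20 rho2 r2 V rho10 r10.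
have [La La0 hLa] := lip_bound12 (lip_fluxa n A gamma theta c1 c2 rho2 r2 V rho10 r10).
have [Lb Lb0 hLb] := lip_bound12 (lip_fluxb n A gamma theta c1 c2 rho2 r2 V rho10 r10).
have [Lr Lr0 hLr] := lip_bound12 (lip_area n rho1 rho2 r2 V r10).
have [Lg Lg0 hLg] := lip_bound12 (lip_geom n rho2 r2 V rho10 r10).
have [Lv Lv0 hLv] := lip_bound12 (lip_areaV n rho1 rho2 r2 V r10).
have lipd : lip rho1 rho2 r1 r2 V (fun a b y u => a ^+ 2 * divv n a b y u).
  by apply: lipM; [apply: lipX; exact: lip_proj1|exact: lip_divv].
have [[Ld Ld0 hLd] _] := lipd.
pose P := `|Pmax|; pose Y := `|Xmax|.
have P0 : 0 <= P by exact: normr_ge0.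
have Y0 : 0 <= Y by exact: normr_ge0.
(* a common constant for all the error terms *)
pose L := La + Lb + P * Lr + P * Lg + `|G| * Y * Y * Lv + Ld + 1.
have L0 : 0 <= L by rewrite !addr_ge0// !mulr_ge0.
have Q0 : 0 <= 16%:R * L ^+ 2 / k by rewrite divr_ge0 ?mulr_ge0 ?sqr_ge0// ltW.
exists (4%:R * L + Y + 16%:R * L ^+ 2 / k + 1).
  by clear -L0 Y0 Q0; lra.
move=> a b y u a' b' y' u' PG X m Df B1 B2 hP /andP[X0 hX] m0 hD.
rewrite -/fluxa -/fluxb -/N.
have B3 : box rho1 rho2 r1 r2 V a b y' u' by case: B1 B2 => [? ? _ _] [_ _ ? ?].
have := hk a b y u y' u' B1 B3; rewrite -/fluxa -/fluxb.
have := hLa a b a' b' y' u' B3 B2; have := hLb a b a' b' y' u' B3 B2.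
have := hLr a b a' b' y' u' B3 B2; have := hLg a b a' b' y' u' B3 B2.
have := hLv a b a' b' y' u' B3 B2; have [_] := hLd _ _ _ _ _ _ _ _ B1 B2.
set z := y - y'; set w := u - u'; set p := a - a'; set q := b - b'.
set fa := fluxa a b y u; set fa' := fluxa a' b' y' u'; set fa1 := fluxa a b y' u'.
set fb := fluxb a b y u; set fb' := fluxb a' b' y' u'; set fb1 := fluxb a b y' u'.
set dv := _ ^+ 2 * divv n a b y u; set dv' := _ ^+ 2 * divv n a' b' y' u'.
set ar := b ^+ n.-1 - b' ^+ n.-1; set ge := N / (b * a) - N / (b' * a').
set av := (b ^+ n.-1)^-1 - (b' ^+ n.-1)^-1.
set s := `|p| + `|q|; set S := s + `|z| + `|w|.
move=> e6 e5 e4 e3 e2 e1 e0.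
have s0 : 0 <= s by rewrite addr_ge0.
have hP' : `|PG| <= P by rewrite (le_trans hP)// ler_norm.
have hX' : X <= Y by rewrite (le_trans hX)// ler_norm.
have T1 : (fa1 - fa') * z <= La * s * `|z|.
  by rewrite (le_trans (ler_norm _))// normrM ler_wpM2r.
have T2 : (fb1 - fb') * w <= Lb * s * `|w|.
  by rewrite (le_trans (ler_norm _))// normrM ler_wpM2r.
have T3 : - (PG * ar * z) <= P * Lr * s * `|z|.
  rewrite (le_trans (ler_norm _))// normrN 2!normrM ler_wpM2r// -mulrA.
  by rewrite ler_pM.
have T4 : - (PG * ge * w) <= P * Lg * s * `|w|.
  rewrite (le_trans (ler_norm _))// normrN 2!normrM ler_wpM2r// -mulrA.
  by rewrite ler_pM.
have T5 : - (G * X * av * (X * w)) <= `|G| * Y * Y * Lv * s * `|w|.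
  have -> : - (G * X * av * (X * w)) = - (G * (X * X) * av * w) by ring.
  rewrite (le_trans (ler_norm _))// normrN 2!normrM ler_wpM2r//.
  have -> : `|G| * Y * Y * Lv * s = (`|G| * (Y * Y)) * (Lv * s) by ring.
  rewrite ler_pM// normrM ler_wpM2l// ger0_norm ?mulr_ge0//.
  by rewrite ler_pM.
have T6 : p * (dv' - dv) <= Ld * `|p| * S.
  rewrite (le_trans (ler_norm _))// normrM [leLHS]mulrC [`|dv' - dv|]distrC.
  by rewrite (le_trans (ler_wpM2r (normr_ge0 _) e6))// mulrAC.
have T7 : - (Df * (X * w)) <= Y * (m ^+ 2 * q ^+ 2 + (X * w) ^+ 2).
  rewrite (le_trans (ler_norm _))// normrN normrM.
  apply: (@le_trans _ _ (Y * ((m * `|q|) * `|X * w|))).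
    rewrite [leRHS]mulrA ler_wpM2r//.
    rewrite (le_trans hD)// mulrCA ler_wpM2r// mulr_ge0//.
  rewrite ler_wpM2l//.
  have := sqr_ge0 (m * `|q| - `|X * w|); have := sqr_ge0 (m * `|q|); have := sqr_ge0 (`|X * w|).
  rewrite -[q ^+ 2]real_normK ?num_real// -[(X * w) ^+ 2]real_normK ?num_real//.
  by rewrite -exprMn; clear; nra.
have T8 : `|q * w| <= s * `|w| by rewrite normrM ler_wpM2r// lerDr.
have zw0 : 0 <= `|z| + `|w| by rewrite addr_ge0.
have sz := normr_ge0 z; have sw := normr_ge0 w; have sp := normr_ge0 p; have sq := normr_ge0 q.
have bnd : La * s * `|z| + Lb * s * `|w| + P * Lr * s * `|z| + P * Lg * s * `|w| +
    `|G| * Y * Y * Lv * s * `|w| + Ld * `|p| * S + s * `|w| <=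
    2%:R * L * (s * (`|z| + `|w|)) + L * s ^+ 2.
  have h1 : 0 <= s * `|z| by rewrite mulr_ge0.
  have h2 : 0 <= s * `|w| by rewrite mulr_ge0.
  have h3 : Ld * `|p| * S <= Ld * (s * S).
    by rewrite -mulrA ler_wpM2l// ler_wpM2r ?lerDl// /S !addr_ge0.
  have E : Ld * (s * S) = Ld * s ^+ 2 + Ld * (s * `|z|) + Ld * (s * `|w|).
    by rewrite /S; ring.
  have g1 : 0 <= P * Lg by rewrite mulr_ge0.
  have g2 : 0 <= P * Lr by rewrite mulr_ge0.
  have g3 : 0 <= `|G| * Y * Y * Lv by rewrite !mulr_ge0.
  have h4 : Ld * s ^+ 2 <= L * s ^+ 2.
    by rewrite ler_wpM2r ?sqr_ge0// /L; clear -La0 Lb0 Ld0 g1 g2 g3; lra.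
  have h5 : (La + P * Lr + Ld) * (s * `|z|) <= L * (s * `|z|).
    by rewrite ler_wpM2r// /L; clear -La0 Lb0 Ld0 g1 g2 g3; lra.
  have h6 : (Lb + P * Lg + `|G| * Y * Y * Lv + Ld + 1) * (s * `|w|) <= L * (s * `|w|).
    by rewrite ler_wpM2r// /L; clear -La0 Lb0 Ld0 g1 g2 g3; lra.
  have h7 : 0 <= L * (s * `|z|) by rewrite mulr_ge0.
  have h8 : 0 <= L * (s * `|w|) by rewrite mulr_ge0.
  rewrite E in h3; clear -h1 h2 h3 h4 h5 h6 h7 h8; lra.
have s2 : s ^+ 2 <= 2%:R * (p ^+ 2 + q ^+ 2).
  rewrite -[p ^+ 2]real_normK ?num_real// -[q ^+ 2]real_normK ?num_real//.
  by have := sqr_ge0 (`|p| - `|q|); rewrite /s; clear; nra.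
have zw2 : (`|z| + `|w|) ^+ 2 <= 2%:R * (z ^+ 2 + w ^+ 2).
  rewrite -[z ^+ 2]real_normK ?num_real// -[w ^+ 2]real_normK ?num_real//.
  by have := sqr_ge0 (`|z| - `|w|); clear; nra.
have yg : 2%:R * L * (s * (`|z| + `|w|)) <= k * (z ^+ 2 + w ^+ 2) + 8%:R * L ^+ 2 / k * s ^+ 2.
  have kk : k^-1 * k = 1 by rewrite mulVf// gt_eqF.
  have ki : 0 < k^-1 by rewrite invr_gt0.
  have h0 : 0 <= k^-1 / 2%:R * (k * (`|z| + `|w|) - 2%:R * L * s) ^+ 2.
    by rewrite mulr_ge0 ?sqr_ge0// divr_ge0// ltW.
  have E : k^-1 / 2%:R * (k * (`|z| + `|w|) - 2%:R * L * s) ^+ 2 =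
     (k^-1 * k) * k / 2%:R * (`|z| + `|w|) ^+ 2 - (k^-1 * k) * (2%:R * L * (s * (`|z| + `|w|)))
     + 2%:R * (L ^+ 2 * k^-1 * s ^+ 2) by field; rewrite gt_eqF.
  rewrite E kk !mul1r in h0.
  have h1 : k / 2%:R * (`|z| + `|w|) ^+ 2 <= k / 2%:R * (2%:R * (z ^+ 2 + w ^+ 2)).
    by rewrite ler_wpM2l// divr_ge0// ltW.
  have h2 : 0 <= L ^+ 2 * k^-1 * s ^+ 2 by rewrite !mulr_ge0 ?sqr_ge0// ltW.
  have E2 : 8%:R * L ^+ 2 / k * s ^+ 2 = 8%:R * (L ^+ 2 * k^-1 * s ^+ 2) by ring.
  rewrite E2; clear -h0 h1 h2; lra.
have Lk0 : 0 <= 8%:R * L ^+ 2 / k by rewrite divr_ge0 ?mulr_ge0 ?sqr_ge0// ltW.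
have yg2 := ler_wpM2l Lk0 s2; have yg3 := ler_wpM2l L0 s2.
have p2 := sqr_ge0 p; have q2 := sqr_ge0 q; have w2 := sqr_ge0 (X * w); have m2 := sqr_ge0 m.
set KK := 4%:R * L + Y + 16%:R * L ^+ 2 / k + 1.
set EN := (X * w) ^+ 2 + p ^+ 2 + q ^+ 2.
have EN0 : 0 <= EN by rewrite !addr_ge0.
have KK1 : (2%:R * L + 16%:R * L ^+ 2 / k + Y) * EN <= KK * EN.
  by rewrite ler_wpM2r// /KK; clear -L0; lra.
have KK2 : Y * (m ^+ 2 * EN) <= KK * (m ^+ 2 * EN).
  by rewrite ler_wpM2r ?mulr_ge0// /KK; clear -L0 Q0; lra.
have YEN : Y * (m ^+ 2 * q ^+ 2) <= Y * (m ^+ 2 * EN).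
  by rewrite ler_wpM2l// ler_wpM2l// /EN; clear -p2 q2 w2; lra.
have YEN2 : Y * (X * w) ^+ 2 <= Y * EN by rewrite ler_wpM2l// /EN; clear -p2 q2 w2; lra.
have ENpq : (2%:R * L + 16%:R * L ^+ 2 / k) * (p ^+ 2 + q ^+ 2) <= (2%:R * L + 16%:R * L ^+ 2 / k) * EN.
  rewrite ler_wpM2l//; first by clear -L0 Q0; lra.
  by rewrite /EN; clear -w2; lra.
have D : KK * (1 + m ^+ 2) * EN = KK * EN + KK * (m ^+ 2 * EN) by ring.
have D1 : (2%:R * L + 16%:R * L ^+ 2 / k) * (p ^+ 2 + q ^+ 2) =
  L * (2%:R * (p ^+ 2 + q ^+ 2)) + 8%:R * L ^+ 2 / k * (2%:R * (p ^+ 2 + q ^+ 2)) by ring.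
have D2 : (2%:R * L + 16%:R * L ^+ 2 / k + Y) * EN =
  (2%:R * L + 16%:R * L ^+ 2 / k) * EN + Y * EN by ring.
have D3 : (fa - fa' - PG * ar) * z + (fb - fb' - PG * ge) * w -
    (G * X * av + Df) * (X * w) + p * (dv' - dv) =
  ((fa - fa1) * z + (fb - fb1) * w) + (fa1 - fa') * z + (fb1 - fb') * w
  - (PG * ar * z) - (PG * ge * w) - (G * X * av * (X * w)) - Df * (X * w) + p * (dv' - dv) by ring.
have D4 : Y * (m ^+ 2 * q ^+ 2 + (X * w) ^+ 2) = Y * (m ^+ 2 * q ^+ 2) + Y * (X * w) ^+ 2 by ring.
rewrite D3 D; rewrite D2 in KK1; rewrite D1 in ENpq; rewrite D4 in T7.
clear -e0 T1 T2 T3 T4 T5 T6 T7 T8 bnd yg yg2 yg3 KK1 KK2 YEN YEN2 ENpq.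
lra.
Qed.

(** * One solution at a fixed time *)

Section WeakDerivativeCalculus.
Context {R : realType}.
Local Notation mu := (@lebesgue_measure R).
Implicit Types (M : R) (g h : R -> R).

Lemma ae_locally_integrable M g h : locally_integrable `]0, M[ g ->
  measurable_fun `]0, M[ h -> {ae mu, forall x, 0 < x < M -> g x = h x} ->
  locally_integrable `]0, M[ h.
Proof.
move=> lg mh gh; apply: locally_integrable_itv => // a b a0 bM.
have ig := locally_intg a0 bM lg; have sub := sub_itv_oo_cc a0 bM.
apply: (le_intg _ _ (intg_norm _ ig)) => //; first exact: measurable_funS mh.
apply: aeS gh => x + /sub; rewrite /= in_itv/= => /[apply] ->.
exact: lexx.
Qed.

Lemma is_wderiv_ae M g g' h h' : is_wderiv M g g' ->
  measurable_fun `]0, M[ h -> measurable_fun `]0, M[ h' ->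
  {ae mu, forall x, 0 < x < M -> g x = h x} ->
  {ae mu, forall x, 0 < x < M -> g' x = h' x} -> is_wderiv M h h'.
Proof.
move=> [lg lg' E] mh mh' gh gh'.
split; [exact: ae_locally_integrable gh|exact: ae_locally_integrable gh'|].
move=> phi tphi; have sphi := test_smooth tphi.
have eqi (k k' f : R -> R) : measurable_fun `]0, M[ k -> measurable_fun `]0, M[ k' ->
    smooth f -> {ae mu, forall x, 0 < x < M -> k x = k' x} ->
    \int[mu]_(x in `]0, M[) (k x * f x) = \int[mu]_(x in `]0, M[) (k' x * f x).
  move=> mk mk' sf kk'; have mf := smooth_meas sf (measurable_itv `]0, M[).
  apply: ae_eq_Rint => //; [exact: measurable_funM|exact: measurable_funM|].
  by apply: aeS kk' => x + ; rewrite /= in_itv/= => /[apply] ->.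
have [mg _ _] := lg; have [mg' _ _] := lg'.
rewrite -(eqi g h)//; last exact: smooth_derive1.
by rewrite -(eqi g' h')// E.
Qed.

Lemma is_wderivZ M c g h : is_wderiv M g h ->
  is_wderiv M (fun x => c * g x) (fun x => c * h x).
Proof.
move=> [lg lh E].
have lZ k : locally_integrable `]0, M[ k -> locally_integrable `]0, M[ (fun x => c * k x).
  move=> lk; apply: locally_integrable_itv.
    by apply: measurable_funM => //; case: lk.
  by move=> a b a0 bM; apply: intgZ => //; exact: locally_intg lk.
split; [exact: lZ|exact: lZ|] => phi tphi.
have aux f (k : R -> R) : test_fun M f -> locally_integrable `]0, M[ k ->
    \int[mu]_(x in `]0, M[) (c * k x * f x) = c * \int[mu]_(x in `]0, M[) (k x * f x).
  move=> tf lk; under eq_Rintegral do rewrite -mulrA.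
  by rewrite RintegralZl//; exact: test_intg.
by rewrite !aux ?E ?mulrN//; exact: test_derive1.
Qed.

End WeakDerivativeCalculus.

Section Profile.
Context {R : realType}.
Local Notation mu := (@lebesgue_measure R).
Variables (n : nat) (M lo hi C V Q : R) (rho u r v : R -> R).
Implicit Types (x d : R).
Local Notation I := (`[0, M]%classic : set R).
Local Notation N := (n%:R - 1 : R).
Hypothesis n2 : (2 <= n)%N.
Hypothesis M0 : 0 < M.
Hypothesis lo0 : 0 < lo.
Hypothesis C0 : 0 < C.

(** What is used of a solution at a fixed time. *)
Record profile : Prop := Profile {
  pf_mrho : measurable_fun I rho;
  pf_rho : forall x, 0 <= x <= M -> lo <= rho x <= hi;
  pf_r0 : forall x, 0 <= x <= M -> 0 <= r x;
  pf_rE : forall x, 0 <= x <= M ->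
    r x ^+ n = n%:R * \int[mu]_(y in `[0, x]) (rho y)^-1;
  pf_r : forall x, 0 <= x <= M -> C^-1 * x <= r x ^+ n <= C * x;
  pf_mu : measurable_fun I u;
  pf_u : {ae mu, forall x, 0 <= x <= M -> `|u x / r x| <= Q};
  pf_mv : measurable_fun I v;
  pf_v : {ae mu, forall x, 0 <= x <= M -> `|v x| <= V};
  pf_uv : is_wderiv M (fun x => r x ^+ n.-1 * u x) v }.

Hypothesis pf : profile.

Let n0 : (0 < n)%N := ltn_trans (ltn0Sn 0) n2.
Let nR0 : n%:R != 0 :> R. Proof. by rewrite pnatr_eq0 -lt0n. Qed.
Let nE : n = n.-1.+1. Proof. by rewrite prednK. Qed.
Let NE : N = n.-1%:R. Proof. by rewrite {1}nE -natr1 addrK. Qed.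

Let nSS : exists k, n = k.+2.
Proof. by case: (n) n2 => [|[|k]] // _; exists k. Qed.

Lemma pf_rn_gt0 x : 0 < x <= M -> 0 < r x ^+ n.
Proof.
move=> /andP[x0 xM]; have := pf_r pf (x := x); rewrite (ltW x0) xM => /(_ isT) /andP[h _].
by rewrite (lt_le_trans _ h)// mulr_gt0// invr_gt0.
Qed.

Lemma pf_r_gt0 x : 0 < x <= M -> 0 < r x.
Proof.
move=> xM; have h := pf_rn_gt0 xM; case/andP: (xM) => x0 xM'.
have := pf_r0 pf (x := x); rewrite (ltW x0) xM' => /(_ isT).
rewrite le_eqVlt => /predU1P[r0|//].
by move: h; rewrite -r0 expr0n gtn_eqF ?ltxx.
Qed.

Lemma pf_rho_gt0 x : 0 <= x <= M -> 0 < rho x.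
Proof. by move=> /(pf_rho pf)/andP[h _]; exact: lt_le_trans h. Qed.

Lemma pf_irhoV : intg I (fun x => (rho x)^-1).
Proof.
apply: (@bnd_intg _ _ _ lo^-1) => //; first exact: mu_itv_lty.
  by apply: measurable_funV; exact: pf_mrho pf.
apply: aeW => x /=; rewrite in_itv/= => xM; have r0 := pf_rho_gt0 xM.
rewrite ger0_norm ?invr_ge0 ?(ltW r0)// lef_pV2 ?posrE//.
by case/andP: (pf_rho pf xM).
Qed.

Lemma pf_prim_rn : prim 0 M (fun x => r x ^+ n) (fun x => n%:R * (rho x)^-1).
Proof.
have pZ := primZ n%:R (prim_Rint pf_irhoV).
apply: (prim_ext pZ); last by apply: aeW.
  by move=> x xM; rewrite (pf_rE pf).
by have [/intgm] := pZ.
Qed.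

Lemma pf_r_powR x : 0 <= x <= M -> r x = (r x ^+ n) `^ n%:R^-1.
Proof.
move=> xM; have r0 := pf_r0 pf xM.
have E : n%:R * n%:R^-1 = 1 :> R by rewrite divff.
by rewrite -powR_mulrn// -powRrM E powRr1.
Qed.

Lemma pf_mr : measurable_fun I r.
Proof.
have h := measurable_fun_powR n%:R^-1 (prim_meas pf_prim_rn).
apply: eq_measurable_fun h => x; rewrite inE/= in_itv/= => xM.
by rewrite -pf_r_powR.
Qed.

(** [x^(1/n)] bounds for [r]; the constants are chosen to avoid roots of [C]. *)
Definition rlow := Num.min 1 C^-1.
Definition rupp := Num.max 1 C.

Lemma rlow_gt0 : 0 < rlow. Proof. by rewrite lt_min ltr01 invr_gt0. Qed.
Lemma rupp_gt0 : 0 < rupp. Proof. by rewrite lt_max ltr01. Qed.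

Lemma root_gt0 x : 0 < x -> 0 < x `^ n%:R^-1.
Proof. exact: powR_gt0. Qed.

Lemma root_n x : 0 <= x -> (x `^ n%:R^-1) ^+ n = x.
Proof.
move=> x0; have E : n%:R^-1 * n%:R = 1 :> R by rewrite mulVf.
by rewrite -powR_mulrn ?powR_ge0// -powRrM E powRr1.
Qed.

Lemma pf_r_root x : 0 < x <= M ->
  rlow <= r x / x `^ n%:R^-1 <= rupp.
Proof.
move=> xM; case/andP: (xM) => x0 xM'.
have X0 := root_gt0 x0; set X := x `^ n%:R^-1 in X0 *.
have r0 := pf_r_gt0 xM.
have q0 : 0 < r x / X by rewrite divr_gt0.
have qn : (r x / X) ^+ n = r x ^+ n / x by rewrite expr_div_n root_n ?ltW.
have /andP[h1 h2] : C^-1 <= (r x / X) ^+ n <= C.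
  rewrite qn ler_pdivlMr// ler_pdivrMr//; apply: (pf_r pf).
  by rewrite (ltW x0).
apply/andP; split.
- rewrite ge_min; have [//|q1] := leP 1 (r x / X).
  rewrite (le_trans h1)//= nE exprS ler_piMr ?(ltW q0)//.
  by rewrite exprn_ile1// ltW.
- rewrite le_max; have [//|q1] := leP (r x / X) 1.
  rewrite (le_trans _ h2)//= nE exprS ler_peMr ?(ltW q0)//.
  by rewrite exprn_ege1// ltW.
Qed.

Lemma pf_r_bounds d x : 0 < d -> d <= x <= M ->
  rlow * d `^ n%:R^-1 <= r x <= rupp * M `^ n%:R^-1.
Proof.
move=> d0 /andP[dx xM]; have x0 := lt_le_trans d0 dx.
have xM' : 0 < x <= M by rewrite x0.
have /andP[h1 h2] := pf_r_root xM'; have X0 := root_gt0 x0.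
rewrite ler_pdivlMr// in h1; rewrite ler_pdivrMr// in h2.
have mono a b : 0 <= a -> a <= b -> a `^ n%:R^-1 <= b `^ n%:R^-1.
  move=> a0 ab; apply: ge0_ler_powR; rewrite ?nnegrE ?invr_ge0//.
  exact: le_trans ab.
rewrite (le_trans _ h1) ?(le_trans h2)//.
  by rewrite ler_wpM2l ?mono ?(ltW x0) ?(ltW rupp_gt0).
by rewrite ler_wpM2l ?mono ?(ltW d0) ?(ltW rlow_gt0).
Qed.

Definition dr x := (r x ^+ n.-1 * rho x)^-1.

Lemma mdr : measurable_fun I dr.
Proof.
apply: measurable_funV.
by apply: measurable_funM; [apply: measurable_funX; exact: pf_mr|exact: pf_mrho pf].
Qed.

Lemma subI d : 0 < d -> `[d, M] `<=` I.
Proof. by move=> d0; apply: subitv => //; exact: ltW. Qed.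

Lemma itv0M d x : 0 < d -> d <= x <= M -> 0 < x <= M.
Proof. by move=> d0 /andP[dx ->]; rewrite (lt_le_trans d0). Qed.

Lemma dr_bnd d : 0 < d -> exists2 L, 0 <= L & forall x, d <= x <= M -> `|dr x| <= L.
Proof.
move=> d0; pose e := rlow * d `^ n%:R^-1.
have e0 : 0 < e by rewrite mulr_gt0 ?rlow_gt0 ?root_gt0.
exists (e ^+ n.-1 * lo)^-1; first by rewrite invr_ge0 mulr_ge0 ?exprn_ge0 ?ltW.
move=> x dxM; have xM := itv0M d0 dxM; have r0 := pf_r_gt0 xM.
have xM' : 0 <= x <= M by case/andP: xM => /ltW -> ->.
have rh0 := pf_rho_gt0 xM'.
rewrite /dr ger0_norm; last by rewrite invr_ge0 mulr_ge0 ?exprn_ge0 ?ltW.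
rewrite lef_pV2 ?posrE ?mulr_gt0 ?exprn_gt0//.
have /andP[h _] := pf_r_bounds d0 dxM; have /andP[h' _] := pf_rho pf xM'.
rewrite ler_pM ?exprn_ge0 ?(ltW e0) ?(ltW lo0)//.
by rewrite lerXn2r ?nnegrE ?(ltW e0) ?(ltW r0).
Qed.

(** Chain rule for [(r^n)^(1/n)], since [r^n] is a primitive of [n / rho] that is
    bounded below away from the centre. *)
Lemma prim_r d : 0 < d -> prim d M r dr.
Proof.
move=> d0; pose e := C^-1 * d; pose L := C * M.
have e0 : 0 < e by rewrite mulr_gt0// invr_gt0.
have [K K0 hK] := @powR_taylor R e L n%:R^-1 e0.
have pn : prim d M (fun x => r x ^+ n) (fun x => n%:R * (rho x)^-1).
  by apply: prim_sub pf_prim_rn => //; exact: ltW.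
have rng s : d <= s <= M -> e <= r s ^+ n <= L.
  move=> dsM; case/andP: (dsM) => ds sM.
  have := pf_r pf (x := s); rewrite sM (le_trans (ltW d0) ds) => /(_ isT) /andP[h1 h2].
  rewrite (le_trans _ h1)/= ?(le_trans h2)//; first by rewrite ler_wpM2l// ltW.
  by rewrite ler_wpM2l// invr_ge0 ltW.
have pc := @prim_comp _ _ _ _ _ [set y | e <= y <= L] (fun y => y `^ n%:R^-1)
  (fun y => n%:R^-1 * y `^ (n%:R^-1 - 1)) K (n%:R * lo^-1) pn K0.
have {}pc : prim d M ((fun y : R => y `^ n%:R^-1) \o (fun x => r x ^+ n))
    (fun x => n%:R^-1 * (r x ^+ n) `^ (n%:R^-1 - 1) * (n%:R * (rho x)^-1)).
  apply: pc => //.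
  - move=> s dsM; have /andP[s0 sM] := itv0M d0 dsM.
    have sM' : 0 <= s <= M by rewrite (ltW s0).
    have rh0 := pf_rho_gt0 sM'.
    rewrite normrM (ger0_norm (ler0n _ _)) ler_wpM2l//.
    rewrite ger0_norm ?invr_ge0 ?(ltW rh0)// lef_pV2 ?posrE//.
    by case/andP: (pf_rho pf sM').
  - by apply: measurable_funM => //; apply: measurable_fun_powR; exact: prim_meas pn.
apply: (prim_ext pc).
- move=> x dxM /=; rewrite -pf_r_powR//.
  by have /andP[/ltW -> ->] := itv0M d0 dxM.
- by apply: measurable_funS mdr => //; exact: subI.
- apply: aeW => x dxM; have xM := itv0M d0 dxM.
  have r0 := pf_r_gt0 xM; have rn0 := pf_rn_gt0 xM.
  have xM' : 0 <= x <= M by case/andP: xM => /ltW -> ->.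
  have rh0 := pf_rho_gt0 xM'.
  rewrite powRB; last by rewrite (gt_eqF rn0) implybT.
  rewrite -pf_r_powR// powRr1 ?(ltW rn0)// /dr.
  rewrite [in r x ^+ n]nE exprS.
  have B0 : r x ^+ n.-1 != 0 by rewrite gt_eqF// exprn_gt0.
  by field; rewrite B0 nR0 !gt_eqF.
Qed.

Lemma prim_rX d k : 0 < d ->
  prim d M (fun x => r x ^+ k) (fun x => k%:R * r x ^+ k.-1 * dr x).
Proof.
move=> d0; elim: k => [|k IH].
  have := prim_cst d M (1 : R); congr prim; apply/funext => x.
  by rewrite mul0r mul0r.
have [L _ hL] := dr_bnd d0.
have := primM IH (prim_r d0) hL; congr prim; apply/funext => x /=.
  by rewrite exprSr.
case: k {IH} => [|k] /=; first by rewrite !mul0r !expr0; ring.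
by rewrite -[in RHS]natr1 exprS; ring.
Qed.

Lemma prim_rX_bnd d k : 0 < d -> exists2 L, 0 <= L &
  forall x, d <= x <= M -> `|k%:R * r x ^+ k.-1 * dr x| <= L.
Proof.
move=> d0; have [L L0 hL] := dr_bnd d0; have [K K0 hK] := prim_bnd (prim_rX k.-1 d0).
exists (k%:R * K * L); first by rewrite !mulr_ge0.
move=> x dxM; rewrite !normrM (ger0_norm (ler0n _ _)) ler_pM ?mulr_ge0 ?hL//.
by rewrite ler_wpM2l// hK.
Qed.

Lemma prim_rXV d k : 0 < d ->
  prim d M (fun x => (r x ^+ k)^-1)
    (fun x => - (k%:R * r x ^+ k.-1 * dr x / (r x ^+ k) ^+ 2)) /\
  exists2 L, 0 <= L & forall x, d <= x <= M ->
    `|- (k%:R * r x ^+ k.-1 * dr x / (r x ^+ k) ^+ 2)| <= L.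
Proof.
move=> d0; pose e := rlow * d `^ n%:R^-1.
have e0 : 0 < e by rewrite mulr_gt0 ?rlow_gt0 ?root_gt0.
have [L L0 hL] := prim_rX_bnd k d0.
have ge x : d <= x <= M -> e ^+ k <= r x ^+ k.
  move=> dxM; have /andP[h _] := pf_r_bounds d0 dxM.
  by rewrite lerXn2r ?nnegrE ?(ltW e0)// (le_trans (ltW e0)).
split; first by apply: (prim_inv (e := e ^+ k) _ (prim_rX k d0) hL) => //; exact: exprn_gt0.
exists (L * ((e ^+ k) ^+ 2)^-1).
  by rewrite mulr_ge0// invr_ge0 sqr_ge0.
move=> x dxM; have g := ge x dxM; have ek0 : 0 < e ^+ k by exact: exprn_gt0.
have rk0 := lt_le_trans ek0 g.
have q1 : 0 < (e ^+ k) ^+ 2 by exact: exprn_gt0.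
have q2 : 0 < (r x ^+ k) ^+ 2 by exact: exprn_gt0.
rewrite normrN normrM ler_pM ?hL// normfV ger0_norm ?sqr_ge0// lef_pV2 ?posrE//.
by rewrite ler_sqr ?nnegrE ?(ltW ek0) ?(ltW rk0).
Qed.

(** [v] truncated at its essential bound, so as to be bounded everywhere. *)
Definition vt x := if `|v x| <= V then v x else 0.

Lemma vt_bnd x : `|vt x| <= `|V|.
Proof.
rewrite /vt; case: ifP => [h|_]; last by rewrite normr0.
exact: le_trans h (ler_norm _).
Qed.

Lemma vtE : {ae mu, forall x, 0 <= x <= M -> v x = vt x}.
Proof. by apply: aeS (pf_v pf) => x + xM => /(_ xM) h; rewrite /vt h. Qed.

Lemma mvt : measurable_fun I vt.
Proof.
have mb : measurable_fun I (fun x => `|v x| <= V).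
  apply: measurable_fun_ler => //.
  by apply: measurableT_comp => //; exact: pf_mv pf.
apply: measurable_fun_if => //.
by apply: measurable_funS (pf_mv pf) => //; exact: subIsetl.
Qed.

Lemma ivt : intg I vt.
Proof.
apply: (@bnd_intg _ _ _ `|V|) => //; [exact: mu_itv_lty|exact: mvt|].
by apply: aeW => x _; exact: vt_bnd.
Qed.

Lemma pf_iv : intg I v.
Proof.
apply: (@bnd_intg _ _ _ V) => //; [exact: mu_itv_lty|exact: pf_mv pf|].
by apply: aeS (pf_v pf) => x; rewrite /= in_itv.
Qed.

Definition du (ut : R -> R) x := (vt x - N * ut x / (r x * rho x)) / r x ^+ n.-1.

(** [r^(n-1) u] is a.e. a primitive of [v]; divide it by [r^(n-1)], which is
    Lipschitz and positive away from the centre. *)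
Lemma velocity_version : exists ut : R -> R,
  [/\ {ae mu, forall x, 0 <= x <= M -> u x = ut x},
      forall d, 0 < d -> prim d M ut (du ut) /\
        exists2 L, 0 <= L & forall x, d <= x <= M -> `|du ut x| <= L &
      measurable_fun `]0, M] ut].
Proof.
have [c hc] := wderiv_prim M0 (pf_uv pf) pf_iv.
pose W x := c + \int[mu]_(s in `[0, x]) vt s.
have pW : prim 0 M W vt.
  have := primD (prim_cst 0 M c) (prim_Rint ivt).
  by congr prim; apply/funext => x; rewrite ?add0r.
pose ut x := W x / r x ^+ n.-1.
have VV s : 0 <= s <= M -> \int[mu]_(y in `[0, s]) v y = \int[mu]_(y in `[0, s]) vt y.
  move=> /andP[s0 sM]; have sub := subitv (lexx 0) sM.
  apply: ae_eq_Rint => //.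
  - by apply: measurable_funS (pf_mv pf) => //; exact: sub.
  - by apply: measurable_funS mvt => //; exact: sub.
  - apply: aeS vtE => x + /sub; rewrite /= in_itv/=; exact.
have hd d : 0 < d -> prim d M ut (du ut) /\
        exists2 L, 0 <= L & forall x, d <= x <= M -> `|du ut x| <= L.
  move=> d0; have [pV [L L0 hL]] := prim_rXV n.-1 d0.
  have pWd : prim d M W vt by apply: prim_sub pW => //; exact: ltW.
  have pp := primM pWd pV hL.
  have E x : d <= x <= M -> vt x * (r x ^+ n.-1)^-1 + W x *
       - (n.-1%:R * r x ^+ n.-1.-1 * dr x / (r x ^+ n.-1) ^+ 2) = du ut x.
    move=> dxM; have xM := itv0M d0 dxM; have r0 := pf_r_gt0 xM.
    have xM' : 0 <= x <= M by case/andP: xM => /ltW -> ->.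
    have rh0 := pf_rho_gt0 xM'.
    rewrite /du /ut /dr NE.
    have [k nk] := nSS.
    rewrite nk /= exprS; have B0 : r x ^+ k != 0 by rewrite gt_eqF// exprn_gt0.
    by move: (k.+1%:R : R) => K; field; rewrite B0 !gt_eqF.
  have mdu : measurable_fun `[d, M] (du ut).
    apply: eq_measurable_fun (intgm (proj1 pp)) => x; rewrite inE/= in_itv/=.
    by move=> /E.
  split; first by apply: (prim_ext pp) => //; apply: aeW; exact: E.
  have [K1 K10 hK1] := prim_bnd pV; have [K2 K20 hK2] := prim_bnd pWd.
  exists (`|V| * K1 + K2 * L); first by rewrite addr_ge0 ?mulr_ge0.
  move=> x dxM; rewrite -E// (le_trans (ler_normD _ _))// !normrM lerD//.
    by rewrite ler_pM ?vt_bnd// hK1.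
  by rewrite ler_pM ?hK2// hL.
exists ut; split => //.
- apply: aeS3 (ae_neq 0) (ae_neq M) hc => x x0 xM hx /andP[xge0 xleM].
  have x0' : 0 < x by rewrite lt_def x0.
  have xM' : 0 < x <= M by rewrite x0'.
  have := hx; rewrite x0' lt_neqAle xM xleM => /(_ isT) H.
  have r0 := pf_r_gt0 xM'.
  by rewrite /ut /W -VV ?xge0// -H mulrC mulKf// gt_eqF// exprn_gt0.
- apply: measurable_funM.
    apply: measurable_funS (prim_meas pW) => //.
    by apply: subset_itvr; rewrite bnd_simp.
  apply: measurable_funV; apply: measurable_funX; apply: measurable_funS pf_mr => //.
  by apply: subset_itvr; rewrite bnd_simp.
Qed.

Section TestFunction.
Variables (phi : R -> R) (a : R).
Hypothesis sphi : smooth phi.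
Hypothesis a0 : 0 < a.
Hypothesis phi0 : forall x, x <= a -> phi x = 0.

Let dphi := derive1 phi.

Let sub_oo : `]0, M[ `<=` I. Proof. exact: subset_itv_oo_cc. Qed.

Let prim_phi d : d <= M -> prim d M phi dphi /\
  exists2 L, 0 <= L & forall x, d <= x <= M -> `|dphi x| <= L.
Proof.
move=> dM; split; first exact: prim_smooth.
by apply: smooth_bnd; exact: smooth_derive1.
Qed.

Let mIoo (f : R -> R) : measurable_fun I f -> measurable_fun `]0, M[ f.
Proof. by move=> mf; apply: measurable_funS mf. Qed.

Let mIr k : measurable_fun I (fun x => r x ^+ k).
Proof. by apply: measurable_funX; exact: pf_mr. Qed.

Let mphi f : smooth f -> measurable_fun I f.
Proof. by move=> sf; exact: smooth_meas. Qed.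

Lemma wderiv_area : is_wderiv M (fun x => r x ^+ n.-1 * phi x)
  (fun x => r x ^+ n.-1 * dphi x + N / (r x * rho x) * phi x).
Proof.
have H x : 0 < x <= M -> n.-1%:R * r x ^+ n.-1.-1 * dr x * phi x + r x ^+ n.-1 * dphi x =
   r x ^+ n.-1 * dphi x + N / (r x * rho x) * phi x.
  move=> xM; have r0 := pf_r_gt0 xM.
  have xM' : 0 <= x <= M by case/andP: xM => /ltW -> ->.
  have rh0 := pf_rho_gt0 xM'.
  rewrite addrC; congr (_ + _); congr (_ * _).
  have [k nk] := nSS.
  rewrite /dr NE nk /= exprS; have B0 : r x ^+ k != 0 by rewrite gt_eqF// exprn_gt0.
  by field; rewrite B0 !gt_eqF.
have mf : measurable_fun I (fun x => r x ^+ n.-1 * phi x).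
  by apply: measurable_funM; [exact: mIr|exact: mphi].
have mf' : measurable_fun I (fun x => r x ^+ n.-1 * dphi x + N / (r x * rho x) * phi x).
  apply: measurable_funD; apply: measurable_funM => //.
  - by apply: mphi; exact: smooth_derive1.
  - apply: measurable_funM => //; apply: measurable_funV; apply: measurable_funM => //.
      exact: pf_mr.
    exact: pf_mrho pf.
  - exact: mphi.
apply: prim_wderiv; [exact: mIoo|exact: mIoo|].
move=> c d c0 cd dM; have cM := le_trans cd (ltW dM).
have [pphi [L _ hL]] := prim_phi cM.
have pp := primM (prim_rX n.-1 c0) pphi hL.
apply: (prim_sub (lexx c) (ltW dM)).
apply: (prim_ext pp) => //.
  by apply: measurable_funS mf' => //; exact: subI.
by apply: aeW => x cxM; apply: H; exact: itv0M cxM.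
Qed.

Lemma wderiv_velocity : is_wderiv M (fun x => r x ^+ (n - 2)%N * u x * phi x)
  (fun x => r x ^+ (n - 2)%N * u x * dphi x +
            (v x / r x - u x / (r x ^+ 2 * rho x)) * phi x).
Proof.
have [c hc] := wderiv_prim M0 (pf_uv pf) pf_iv.
pose W x := c + \int[mu]_(s in `[0, x]) v s.
have pW : prim 0 M W v.
  have := primD (prim_cst 0 M c) (prim_Rint pf_iv).
  by congr prim; apply/funext => x; rewrite ?add0r.
(* [r^(n-2) u phi = W (phi / r)] with [W = r^(n-1) u] *)
pose q x := (r x ^+ 1)^-1 * phi x.
pose q' x := - (1%:R * r x ^+ 1.-1 * dr x / (r x ^+ 1) ^+ 2) * phi x + (r x ^+ 1)^-1 * dphi x.
have pq d : 0 < d -> d <= M -> prim d M q q' /\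
    exists2 L, 0 <= L & forall x, d <= x <= M -> `|q' x| <= L.
  move=> d0 dM; have [pphi [L L0 hL]] := prim_phi dM.
  have [pV [K K0 hK]] := prim_rXV 1 d0.
  split; first exact: primM hL.
  have [K1 K10 hK1] := prim_bnd pphi; have [K2 K20 hK2] := prim_bnd pV.
  exists (K * K1 + K2 * L); first by rewrite addr_ge0 ?mulr_ge0.
  move=> x dxM; rewrite /q' (le_trans (ler_normD _ _))// !normrM lerD//.
    by rewrite ler_pM ?hK// hK1.
  by rewrite ler_pM ?hK2// hL.
have mq : measurable_fun I q.
  by apply: measurable_funM; [apply: measurable_funV; exact: mIr|exact: mphi].
have mdphi : measurable_fun I dphi by apply: mphi; exact: smooth_derive1.
have mq' : measurable_fun I q'.
  apply: measurable_funD; apply: measurable_funM => //.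
  - apply: measurableT_comp => //; apply: measurable_funM.
      apply: measurable_funM; last exact: mdr.
      by apply: measurable_funM => //; exact: mIr.
    by apply: measurable_funV; apply: measurable_funX; exact: mIr.
  - exact: mphi.
  - by apply: measurable_funV; exact: mIr.
have mru k : measurable_fun I (fun x => r x ^+ k * u x).
  by apply: measurable_funM; [exact: mIr|exact: pf_mu pf].
have wq : is_wderiv M (fun x => W x * q x) (fun x => v x * q x + W x * q' x).
  apply: prim_wderiv.
  - by apply: mIoo; apply: measurable_funM => //; exact: prim_meas pW.
  - apply: mIoo; apply: measurable_funD; apply: measurable_funM => //.
      exact: pf_mv pf.
    exact: prim_meas pW.
  - move=> d e d0 de eM; have dM := le_trans de (ltW eM).
    have [pqd [L L0 hL]] := pq d d0 dM.
    apply: (prim_sub (lexx d) (ltW eM)).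
    by apply: primM hL => //; apply: prim_sub pW => //; exact: ltW.
have [k nk] := nSS.
have EW x : 0 < x < M -> r x ^+ n.-1 * u x = W x -> W x = r x ^+ (n - 2)%N * u x * r x.
  by move=> _ <-; rewrite nk /= subn2/= exprSr; ring.
apply: (is_wderiv_ae wq).
- by apply: mIoo; apply: measurable_funM; [exact: mru|exact: mphi].
- apply: mIoo; apply: measurable_funD; apply: measurable_funM => //.
  + apply: measurable_funB.
      by apply: measurable_funM; [exact: pf_mv pf|apply: measurable_funV; exact: pf_mr].
    apply: measurable_funM; first exact: pf_mu pf.
    by apply: measurable_funV; apply: measurable_funM; [exact: mIr|exact: pf_mrho pf].
  + exact: mphi.
- apply: aeS hc => x h xM; have H := EW x xM (h xM); rewrite H /q.
  have xM' : 0 < x <= M by case/andP: xM => -> /ltW ->.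
  by rewrite expr1; field; rewrite gt_eqF// pf_r_gt0.
- apply: aeS hc => x h xM; have H := EW x xM (h xM); rewrite H /q /q' /dr.
  have xM' : 0 < x <= M by case/andP: xM => -> /ltW ->.
  have xM2 : 0 <= x <= M by case/andP: xM => /ltW -> /ltW ->.
  have r0 := pf_r_gt0 xM'; have rh0 := pf_rho_gt0 xM2.
  rewrite expr1 expr0 nk /= subn2/= exprS.
  have B0 : r x ^+ k != 0 by rewrite gt_eqF// exprn_gt0.
  by field; rewrite B0 !gt_eqF.
Qed.

(** The product rule for [r^(n-1) phi], which vanishes near the centre. It makes
    the external pressure a bulk term, so that the weak equation has the form
    required by [du_bois_reymond]. *)
Lemma area_boundary : r M ^+ n.-1 * phi M =
  \int[mu]_(x in I) (dphi x * r x ^+ n.-1 + phi x * (N / (r x * rho x))).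
Proof.
have dphi0 x : x < a -> dphi x = 0.
  move=> xa; apply: derive1_near0; near=> y; apply: phi0; apply: ltW; near: y; exact: lt_nbhsl.
have [Ma|aM] := leP M a.
  rewrite phi0// mulr0.
  have E0 : \int[mu]_(x in I) (fun=> 0 : R) x = 0 by rewrite Rint_cst_itv ?(ltW M0)// mul0r.
  rewrite -[LHS]E0; apply: ae_eq_Rint => //.
    apply: measurable_funD; apply: measurable_funM => //.
    - by apply: mphi; exact: smooth_derive1.
    - exact: mphi.
    - apply: measurable_funM => //; apply: measurable_funV; apply: measurable_funM => //.
        exact: pf_mr.
      exact: pf_mrho pf.
  apply: aeS (ae_neq M) => x xM /=; rewrite in_itv/= => /andP[x0 xleM].
  have xa : x < a by rewrite (lt_le_trans _ Ma)// lt_neqAle xM.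
  by rewrite dphi0// phi0 ?(ltW xa)// !mul0r addr0.
have [pphi [L _ hL]] := prim_phi (ltW aM).
have pp := primM (prim_rX n.-1 a0) pphi hL.
have := (proj2 pp) a M (lexx _) (ltW aM) (lexx _).
rewrite [phi a]phi0// mulr0 subr0 => ->.
rewrite [RHS](@Rint_supp _ I `[a, M]); last 2 first.
- exact: subI.
- move=> x; rewrite /= in_itv/= => /andP[x0 xM] /negP; rewrite in_itv/= xM andbT -ltNge => xa.
  by rewrite dphi0// phi0 ?(ltW xa)// !mul0r addr0.
apply: eq_Rintegral => x; rewrite inE/= in_itv/= => axM.
rewrite addrC mulrC; congr (_ + _).
have xM := itv0M a0 axM; have r0 := pf_r_gt0 xM.
have xM' : 0 <= x <= M by case/andP: xM => /ltW -> ->.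
have rh0 := pf_rho_gt0 xM'.
rewrite mulrC; congr (_ * _).
have [k nk] := nSS.
rewrite /dr NE nk /= exprS; have B0 : r x ^+ k != 0 by rewrite gt_eqF// exprn_gt0.
by field; rewrite B0 !gt_eqF.
Unshelve. all: by end_near. Qed.

End TestFunction.

End Profile.

(** * Continuity in time of integral functionals *)

Section PathCalculus.
Context {R : realType}.
Local Notation mu := (@lebesgue_measure R).
Variable M : R.
Hypothesis M0 : 0 < M.
Local Notation I := (`[0, M]%classic : set R).
Implicit Types (g h : R -> R -> R) (w phi f : R -> R) (t s W : R).

Let mI : measurable I := measurable_itv _.
Let Ioo : (mu I < +oo)%E := mu_itv_lty 0 M.

Lemma ChalfLp_path g : (forall T, 0 < T -> ChalfLp M T 2%:E g) -> path M g.
Proof.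
move=> hg t t0; have T0 : 0 < t + 1 by rewrite ltr_wpDl.
have tT : 0 <= t <= t + 1 by rewrite t0 lerDl ler01.
split; first by apply: in_L2_sqi => //; case: (hg _ T0) => + _; apply.
move=> e e0.
have [hm [K hK]] := hg _ T0; pose L := Num.max K 1.
have L1 : 1 <= L by rewrite le_max lexx orbT.
have L0 : 0 < L by exact: lt_le_trans L1.
exists (Num.min 1 (e / L ^+ 2)); first by rewrite lt_min ltr01 divr_gt0 ?exprn_gt0.
move=> s s0; rewrite lt_min => /andP[st1 st2].
have sT : 0 <= s <= t + 1.
  by rewrite s0 -lerBlDl (le_trans (ler_norm _)) ?ltW.
have hst := hK s t sT tT.
have [mgs _] := hm s sT; have [mgt _] := hm t tT.
have := @normL2_le _ I (fun x => g x s - g x t) (L * Num.sqrt `|s - t|) mI.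
case.
- exact: measurable_funB.
- by rewrite mulr_ge0 ?sqrtr_ge0 ?ltW.
- by apply: (le_trans hst); rewrite lee_fin ler_wpM2r ?sqrtr_ge0// le_max lexx.
move=> _ /le_trans; apply; rewrite exprMn sqr_sqrtr//.
by rewrite -ler_pdivlMl ?exprn_gt0// mulrC ltW.
Qed.

(** On a bounded interval convergence in [L^2] implies convergence in [L^1]; here
    by [`|y| <= k + y^2 / k]. *)
Lemma path_intg_norm g : path M g -> forall t, 0 <= t -> forall e : R, 0 < e ->
  exists2 d : R, 0 < d & forall s, 0 <= s -> `|s - t| < d ->
    \int[mu]_(x in I) `|g x s - g x t| <= e.
Proof.
move=> pg t t0 e e0; have [sgt hg] := pg t t0.
pose k := e / (2%:R * M); have k0 : 0 < k by rewrite divr_gt0 ?mulr_gt0.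
have [d d0 hd] := hg (k * e / 2%:R) (divr_gt0 (mulr_gt0 k0 e0) (ltr0n _ 2)).
exists d => // s s0 st; have [sgs _] := pg s s0.
have sB := sqiB mI sgs sgt.
have iB := sqi_intg mI Ioo sB.
have i2 : intg I (fun x => k + k^-1 * (g x s - g x t) ^+ 2).
  by apply: intgD => //; [exact: intg_cst|apply: intgZ => //; case: sB].
apply: (@le_trans _ _ (\int[mu]_(x in I) (k + k^-1 * (g x s - g x t) ^+ 2))).
  apply: ae_le_Rint => //; first exact: intg_norm.
  apply: aeW => x _; set y := g x s - g x t.
  have [yk|ky] := leP `|y| k.
    by rewrite (le_trans yk)// lerDl mulr_ge0 ?invr_ge0 ?sqr_ge0 ?ltW.
  rewrite (@le_trans _ _ (k^-1 * y ^+ 2))//; last by rewrite lerDr ltW.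
  by rewrite ler_pdivlMl// -(real_normK (num_real y)) expr2 ler_wpM2r// ltW.
rewrite RintegralD//; first last.
- by apply: intgZ => //; case: sB.
- exact: intg_cst.
rewrite (@RintegralZl _ _ _ mu _ (fun x => (g x s - g x t) ^+ 2) k^-1 mI (proj2 sB)).
rewrite Rint_cst_itv ?(ltW M0)// subr0.
have h := hd s s0 st.
rewrite (@le_trans _ _ (k * M + k^-1 * (k * e / 2%:R)))//.
  by rewrite lerD2l ler_wpM2l// invr_ge0 ltW.
have -> : k * M = e / 2%:R by rewrite /k; field; rewrite gt_eqF.
by rewrite -mulrA mulKf ?gt_eqF// -splitr.
Qed.

Section LipschitzFunctional.
Variables (rho1 rho2 r1 r2 V : R) (G : R -> R -> R -> R -> R) (w : R -> R) (W a : R).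
Variables ga gb gc gd : R -> R -> R.
Hypothesis lG : lip rho1 rho2 r1 r2 V G.
Hypothesis mw : measurable_fun I w.
Hypothesis wW : forall x, I x -> `|w x| <= W.
Hypothesis w0 : forall x, I x -> x < a -> w x = 0.
Hypothesis pa : path M ga.
Hypothesis pb : path M gb.
Hypothesis pc : path M gc.
Hypothesis pd : path M gd.
Hypothesis inbox : forall t, 0 <= t -> {ae mu, forall x, a <= x -> 0 <= x <= M ->
  box rho1 rho2 r1 r2 V (ga x t) (gb x t) (gc x t) (gd x t)}.

Lemma lip_path_meas t : 0 <= t ->
  measurable_fun I (fun x => G (ga x t) (gb x t) (gc x t) (gd x t)).
Proof.
move=> t0; have [_ h] := lG.
by apply: h; [case: (pa t0)|case: (pb t0)|case: (pc t0)|case: (pd t0)] => - [].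
Qed.

Lemma lip_path_intg t : 0 <= t ->
  intg I (fun x => w x * G (ga x t) (gb x t) (gc x t) (gd x t)).
Proof.
move=> t0; have [[L L0 hL] _] := lG.
apply: (@bnd_intg _ _ _ (W * L)) => //.
  by apply: measurable_funM => //; exact: lip_path_meas.
apply: aeS (inbox t0) => x hx xI; rewrite normrM.
have [xa|ax] := ltP x a.
  rewrite w0// normr0 mul0r mulr_ge0// (le_trans _ (wW xI))//.
have xM : 0 <= x <= M by move: xI; rewrite /= in_itv.
by have bx := hx ax xM; rewrite ler_pM ?wW//; case: (hL _ _ _ _ _ _ _ _ bx bx).
Qed.

(** The four curves are continuous in [L^1], and on the support of the weight they
    take their values in the box where [G] is Lipschitz. *)
Lemma lip_path_cont : cont0 (fun t =>
  \int[mu]_(x in I) (w x * G (ga x t) (gb x t) (gc x t) (gd x t))).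
Proof.
move=> t e t0 e0; have [[L L0 hL] _] := lG.
have I0 : I 0 by rewrite /= in_itv/= lexx ltW.
have W0 : 0 <= W by rewrite (le_trans _ (wW I0)).
pose k := e / (4%:R * (W * L + 1)).
have WL : 0 < W * L + 1 by rewrite ltr_wpDl// mulr_ge0.
have k0 : 0 < k by rewrite divr_gt0 ?mulr_gt0.
have [d1 d10 h1] := path_intg_norm pa t0 k0.
have [d2 d20 h2] := path_intg_norm pb t0 k0.
have [d3 d30 h3] := path_intg_norm pc t0 k0.
have [d4 d40 h4] := path_intg_norm pd t0 k0.
exists (Num.min (Num.min d1 d2) (Num.min d3 d4)); first by rewrite !lt_min d10 d20 d30.
move=> s s0; rewrite !lt_min => /andP[/andP[s1 s2] /andP[s3 s4]].
have is_ := lip_path_intg s0; have it := lip_path_intg t0.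
rewrite -RintegralB//.
have iB g : path M g -> intg I (fun x => `|g x s - g x t|).
  move=> pg; apply: intg_norm => //; apply: (sqi_intg mI Ioo).
  by apply: (sqiB mI); [case: (pg s s0)|case: (pg t t0)].
have i12 : intg I (fun x => `|ga x s - ga x t| + `|gb x s - gb x t|).
  by apply: intgD => //; exact: iB.
have i123 := intgD mI i12 (iB _ pc); have i1234 := intgD mI i123 (iB _ pd).
pose S x := `|ga x s - ga x t| + `|gb x s - gb x t| + `|gc x s - gc x t| + `|gd x s - gd x t|.
apply: (@le_trans _ _ (\int[mu]_(x in I) ((W * L) * S x))).
  apply: norm_Rint_le => //; [exact: intgB|exact: intgZ|].
  apply: aeS2 (inbox s0) (inbox t0) => x hs ht xI.
  have xM : 0 <= x <= M by move: xI; rewrite /= in_itv.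
  have S0 : 0 <= S x by rewrite /S !addr_ge0.
  have [xa|ax] := ltP x a.
    by rewrite w0// !mul0r subr0 normr0 !mulr_ge0.
  have [_ h] := hL _ _ _ _ _ _ _ _ (hs ax xM) (ht ax xM).
  by rewrite -mulrBr normrM -mulrA ler_pM// wW.
rewrite RintegralZl// /S RintegralD//; last exact: iB.
rewrite RintegralD//; last exact: iB.
rewrite RintegralD//; [|exact: iB|exact: iB].
rewrite (@le_trans _ _ (W * L * (k + k + k + k)))//.
  rewrite ler_wpM2l ?mulr_ge0//.
  by rewrite !lerD ?h1 ?h2 ?h3 ?h4.
have -> : k + k + k + k = e / (W * L + 1) by rewrite /k; field; rewrite gt_eqF.
rewrite mulrCA ler_piMr ?(ltW e0)// ler_pdivrMr// mul1r lerDl ler01//.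
Qed.

End LipschitzFunctional.

(** The integral over [[0, b]] tends to [0] with [b], which gives [c = 0]; then
    the integrals of [Z] over all intervals vanish. *)
Lemma cont0_zero (Z : R -> R) (c : R) : cont0 Z ->
  (forall b, 0 < b -> \int[mu]_(t in `[0, b]) Z t = c) ->
  c = 0 /\ forall t, 0 <= t -> Z t = 0.
Proof.
move=> cZ hZ.
have iZ a b : 0 <= a -> intg `[a, b] Z.
  move=> a0; apply: continuous_compact_integrable; first exact: segment_compact.
  exact: cont0_within.
have c0 : c = 0.
  apply/eqP; rewrite -normr_eq0 -[_ == 0]negbK; apply/negP => /=.
  rewrite -normr_gt0 normr_id => c0.
  have [d d0 hd] := Rint_small (@ler01 R) (iZ 0 1 (lexx _)) c0.
  pose b := Num.min (d / 2%:R) 1.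
  have b0 : 0 < b by rewrite lt_min ltr01 divr_gt0.
  have := hd b (ltW b0); rewrite ge_min lexx orbT => /(_ isT).
  rewrite gt_min gtr_pMr ?invf_lt1 ?ltr1n// => /(_ isT).
  by rewrite hZ// ltxx.
split=> // t t0; apply/eqP; rewrite -normr_eq0 -[_ == 0]negbK; apply/negP => /=.
rewrite -normr_gt0 normr_id => zt.
have [d d0 hd] := cZ t _ t0 (divr_gt0 zt (ltr0n _ 2)).
pose b := t + d / 2%:R; have d20 : 0 < d / 2%:R by rewrite divr_gt0.
have tb : t < b by rewrite ltrDl.
have b0 : 0 < b by exact: le_lt_trans tb.
have h0 (s : R) : 0 <= s -> \int[mu]_(x in `[0, s]) Z x = 0.
  rewrite le_eqVlt => /predU1P[<-|s0]; first exact: Rint_pt.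
  by rewrite hZ.
have : \int[mu]_(x in `[t, b]) Z x = 0.
  have := Rint_chasles t0 (ltW tb) (iZ 0 b (lexx _)).
  by rewrite !h0 ?(ltW b0)// add0r.
have := @norm_Rint_le _ `[t, b] (fun x => Z t - Z x) (fun=> `|Z t| / 2%:R).
have mtb := measurable_itv `[t, b]; have ltb := mu_itv_lty t b.
move=> /(_ mtb) h H0.
have : `|\int[mu]_(x in `[t, b]) (Z t - Z x)| <= `|Z t| / 2%:R * (b - t).
  rewrite -Rint_cst_itv ?(ltW tb)//; apply: h.
  - by apply: intgB => //; [exact: intg_cst|exact: iZ].
  - exact: intg_cst.
  - apply: aeW => x /=; rewrite in_itv/= => /andP[tx xb].
    rewrite distrC; apply: hd; first exact: le_trans tx.
    rewrite ger0_norm ?subr_ge0// ltrBlDl (le_lt_trans xb)//.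
    by rewrite ltrD2l gtr_pMr ?invf_lt1 ?ltr1n.
rewrite RintegralB//; [|exact: intg_cst|exact: iZ].
rewrite H0 subr0 Rint_cst_itv ?(ltW tb)// normrM [`|b - t|]gtr0_norm ?subr_gt0//.
rewrite ler_pM2r ?subr_gt0// leNgt gtr_pMr ?invf_lt1 ?ltr1n//.
Qed.

End PathCalculus.

Section SeparatedTest.
Context {R : realType}.
Implicit Types (phi eta : R -> R).

Lemma smooth2_prod phi eta : smooth phi -> smooth eta ->
  smooth2 (fun x t => phi x * eta t).
Proof.
move=> sp se; exists (fun i j x t => derive1n i phi x * derive1n j eta t).
split=> // i j; have spi := smooth_derive1n i sp; have sej := smooth_derive1n j se.
split.
  move=> z; apply: cvgM.
    by apply: cvg_comp; [exact: cvg_fst|exact: smooth_continuous].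
  by apply: cvg_comp; [exact: cvg_snd|exact: smooth_continuous].
move=> x t; split.
  have h := smooth_is_derive x spi.
  by apply: is_derive_eq; rewrite /GRing.scale/= ?mulr0 ?add0r; ring.
have h := smooth_is_derive t sej.
by apply: is_derive_eq; rewrite /GRing.scale/=; ring.
Qed.

End SeparatedTest.

(** * The momentum equation at each time *)

Section Forcing.
Context {R : realType}.
Local Notation mu := (@lebesgue_measure R).
Implicit Types (g : R -> R -> R -> R).

Lemma octant_eps g x r t e : continuous_octant g -> 0 <= x -> 0 <= r -> 0 <= t ->
  0 < e -> exists2 d : R, 0 < d & forall x' r' t', 0 <= x' -> 0 <= r' -> 0 <= t' ->
  `|x' - x| < d -> `|r' - r| < d -> `|t' - t| < d ->
  `|g x' r' t' - g x r t| <= e.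
Proof.
move=> /subspace_continuousP cg x0 r0 t0 e0.
have := cg (x, r, t) (And3 x0 r0 t0) => /cvgrPdist_le /(_ e e0).
rewrite near_withinE => /nbhs_ballP [d /= d0 hd].
exists d => // x' r' t' x'0 r'0 t'0 xd rd td.
rewrite distrC; apply: (hd (x', r', t')); last by split.
by split=> /=; [split|]; rewrite /ball/= distrC.
Qed.

Lemma octant_bounded g (X L T : R) : continuous_octant g ->
  exists K, forall x r t, 0 <= x <= X -> 0 <= r <= L -> 0 <= t <= T ->
  `|g x r t| <= K.
Proof.
move=> cg; pose B : set (R * R * R) := (`[0, X] `*` `[0, L]) `*` `[0, T].
have cB : compact B.
  by apply: compact_setX; [apply: compact_setX|]; exact: segment_compact.
have sB : B `<=` [set z : R * R * R | [/\ 0 <= z.1.1, 0 <= z.1.2 & 0 <= z.2]].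
  move=> [[x r] t] [[/= ]]; rewrite !in_itv/= => /andP[-> _] /andP[-> _] /andP[-> _].
  by split.
have cgB := continuous_subspaceW sB cg.
have [K [Kr hK]] := compact_bounded (continuous_compact cgB cB).
exists (K + 1) => x r t xX rL tT; apply: (hK (K + 1)); first by rewrite ltrDl.
by exists (x, r, t).
Qed.

Lemma is_deriv_in_deriv0 (g dg : R -> R) :
  (forall t, 0 <= t -> is_deriv_in half_line g t (dg t)) -> deriv0 g dg.
Proof.
move=> hg t e t0 e0; have := hg t t0 => /cvgrPdist_le /(_ e e0).
rewrite near_withinE near_withinE => -[d /= d0 hd].
exists d => // s s0 nst st; rewrite distrC; apply: hd => //=; first by rewrite distrC.
by rewrite /half_line /= in_itv/= s0.
Qed.

Lemma C1_half_line_cont0 (g : R -> R) : C1_half_line g -> cont0 g.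
Proof. by move=> [dg _ /is_deriv_in_deriv0]; exact: deriv0_cont. Qed.

Lemma deriv0_lip (g dg : R -> R) (m a b : R) : deriv0 g dg ->
  (forall s, 0 <= s -> `|dg s| <= m) -> 0 <= a -> 0 <= b ->
  `|g a - g b| <= m * `|a - b|.
Proof.
move=> hg hm; wlog ab : a b / a <= b.
  move=> H a0 b0; have [/H|/ltW /H] := leP a b; first exact.
  by rewrite distrC [`|b - a|]distrC; exact.
move=> a0 b0; move: ab; rewrite le_eqVlt => /predU1P[->|ab].
  by rewrite !subrr normr0 mulr0.
have [] := @MVT R g dg a b ab.
- move=> s; rewrite in_itv/= => /andP[sa _].
  by apply: deriv0_is_derive hg; exact: le_lt_trans sa.
- exact: cont0_within (deriv0_cont hg).
- move=> c; rewrite in_itv/= => /andP[ca _] E.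
  rewrite distrC E normrM [`|a - b|]distrC ler_wpM2r// hm// ltW//.
  exact: le_lt_trans ca.
Qed.

End Forcing.

Lemma meas_away0 (R : realType) (M : R) (f : R -> R) : 0 < M ->
  (forall d, 0 < d -> d <= M -> measurable_fun `[d, M] f) -> measurable_fun `[0, M] f.
Proof.
move=> M0 mf; apply/measurable_fun_itv_obnd_cbndP.
have -> : `]0, M]%classic = \bigcup_k `[M / k.+1%:R, M]%classic.
  apply/seteqP; split=> x /=; rewrite ?in_itv/=.
    move=> /andP[x0 xM]; have [k hk] : exists k : nat, M / x < k.+1%:R.
      by exists (Num.truncn (M / x)); exact: truncnS_gt.
    exists k => //=; rewrite in_itv/= xM andbT ler_pdivrMr//.
    by rewrite mulrC -ler_pdivrMr// ltW.
  move=> [k _] /=; rewrite in_itv/= => /andP[h ->]; rewrite andbT.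
  by apply: lt_le_trans h; rewrite divr_gt0.
apply/measurable_fun_bigcup => // k; apply: mf; first by rewrite divr_gt0.
by rewrite ler_pdivrMr// ler_peMr ?(ltW M0)// ler1n.
Qed.

Section Auxiliary.
Context {R : realType}.
Local Notation mu := (@lebesgue_measure R).

Lemma wderiv_meas (M : R) (g : R -> R) : wderivable M g ->
  measurable_fun `[0, M] (wderiv M g).
Proof.
move=> /wderivP [_ [m _ _] _].
by apply/measurable_fun_itv_obnd_cbndP/measurable_fun_itv_bndo_bndcP.
Qed.

Lemma cont0_intg (Z : R -> R) a b : cont0 Z -> 0 <= a -> intg `[a, b] Z.
Proof.
move=> cZ a0; apply: continuous_compact_integrable; first exact: segment_compact.
exact: cont0_within.
Qed.

Lemma cont0N (Z : R -> R) : cont0 Z -> cont0 (fun t => - Z t).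
Proof.
move=> /(cont0M (cont0_cst (-1))); congr cont0.
by apply/funext => t; rewrite mulN1r.
Qed.

Lemma smooth_cont0 (f : R -> R) : smooth f -> cont0 f.
Proof.
move=> sf t e _ e0; have := @smooth_continuous R f sf t.
move=> /cvgrPdist_le /(_ e e0) /nbhs_ballP [d /= d0 hd]; exists d => // s _ st; rewrite distrC.
by apply: hd; rewrite /ball/= distrC.
Qed.

End Auxiliary.

Section Evolution.
Context {R : realType}.
Local Notation mu := (@lebesgue_measure R).
Variables (n : nat) (A gamma G Poo M theta c1 c2 : R) (rhoi : R -> R) (C eps0 : R).
Local Notation p := (Params n A gamma G Poo M theta c1 c2).
Variables (F : forcing R) (rho0 u0 : R -> R) (rho u r ut : R -> R -> R).
Local Notation I := (`[0, M]%classic : set R).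
Local Notation N := (n%:R - 1 : R).
Local Notation lo := (rhomin p rhoi / 2%:R).
Local Notation hi := (3%:R / 2%:R * rhomax p rhoi).
Local Notation V := (C * eps0).
Local Notation Q := (C * (C * eps0)).
Hypothesis n2 : (2 <= n)%N.
Hypothesis M0 : 0 < M.
Hypothesis C0 : 0 < C.
Hypothesis lo0 : 0 < lo.
Hypothesis adm : admissible_forcing F.
Hypothesis sol : weak_solution p F rho0 u0 rho u r.
Hypothesis bnd : solution_bounds p C eps0 rhoi rho u r.
Hypothesis hut : forall T : R, 0 < T -> C1Lp M T 2%:E u ut.
Implicit Types (x t d a b : R).

Let mI : measurable I := measurable_itv _.
Let Ioo : (mu I < +oo)%E := mu_itv_lty 0 M.

Definition vel_div := wderivx M (fun x t => r x t ^+ n.-1 * u x t).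
Local Notation v := vel_div.

Lemma sol_path_u : [/\ path M u, path M ut & path_deriv M u ut].
Proof.
apply: (C1Lp_path _ _ hut); first exact: norm_ok2.
by move=> f; exact: in_L2_sqi.
Qed.

Lemma sol_path_rho : path M rho.
Proof.
have [rt h _] := ws_rho sol; have [] // := C1Lp_path _ _ h; first exact: norm_ok2.
by move=> f; exact: in_L2_sqi.
Qed.

Lemma sol_path_r : path M r.
Proof.
have [rt h _] := ws_r sol; have [] // := C1Lp_path _ _ h; first exact: norm_okoo.
by move=> f; exact: in_Loo_sqi.
Qed.

Lemma sol_path_v : path M v.
Proof.
by apply: ChalfLp_path => // T T0; have [_ []] := ws_dx_high sol T0.
Qed.

Lemma sol_profile t : 0 <= t ->
  profile n M lo hi C V Q (rho^~ t) (u^~ t) (r^~ t) (v^~ t).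
Proof.
move=> t0; have [b1 b2 b3 b4 _] := bnd t0.
have T0 : 0 < t + 1 by rewrite ltr_wpDl.
have [hw _] := ws_dx_high sol T0.
split.
- by case: (sol_path_rho t0) => -[].
- exact: b1.
- by move=> x xM; case: (ws_radius sol xM t0).
- by move=> x xM; case: (ws_radius sol xM t0).
- exact: b2.
- by have [pu _ _] := sol_path_u; case: (pu t t0) => -[].
- have h : (normLp I +oo (fun x => u x t / r x t)%R <= Q%:E)%E.
    apply: (le_trans b3); rewrite [Q]/Q EFinM lee_pmul2l//.
  apply: aeS (normLoo_ae mI h) => x + xM; rewrite /= in_itv/= xM => /(_ isT).
  by rewrite lee_fin.
- by case: (sol_path_v t0) => -[].
- apply: aeS (normLoo_ae mI b4) => x + xM; rewrite /= in_itv/= xM => /(_ isT).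
  by rewrite lee_fin.
- by apply: wderivP; apply: hw; rewrite t0 lerDl ler01.
Qed.

Local Notation pf := sol_profile.

(** [r^n] is the integral of [n / rho] against an indicator, a continuous functional
    of the curve [rho]. *)
Lemma sol_r_cont x : 0 < x <= M -> cont0 (r x).
Proof.
move=> xM; have xM' : 0 <= x <= M by case/andP: xM => /ltW -> ->.
case/andP: (xM) => x0 xM2.
pose w (y : R) : R := if x < y then 0 else 1.
have pcst := path_const M0 (0 : R); have p1 := path_const M0 (1 : R).
have lG : lip lo hi 1 1 0 (fun a _ _ _ => a^-1) by exact: lip_rhoV.
have cw := @lip_path_cont R M M0 lo hi 1 1 0 _ w 1 0 rho (fun _ _ => 1)
  (fun _ _ => 0) (fun _ _ => 0) lG.
have {}cw : cont0 (fun t => \int[mu]_(y in I) (w y * (rho y t)^-1)).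
  apply: cw => //.
  - exact: meas_ind.
  - by move=> y _; rewrite /w; case: ifP; rewrite ?normr0 ?normr1 ?ler01.
  - by move=> y; rewrite /= in_itv/= => /andP[y0 _]; rewrite ltNge y0.
  - exact: sol_path_rho.
  - move=> t t0; apply: aeW => y _ yM; split; rewrite ?lexx ?normr0 ?lexx//.
    exact: (pf_rho (pf t0)).
have E t : 0 <= t -> r x t ^+ n = n%:R * \int[mu]_(y in I) (w y * (rho y t)^-1).
  move=> t0; rewrite (pf_rE (pf t0) xM'); congr (_ * _).
  rewrite [RHS](@Rint_supp _ I `[0, x]); last 2 first.
  - exact: subitv.
  - move=> y; rewrite /= !in_itv/= => /andP[y0 yM] /negP; rewrite y0/= -ltNge => xy.
    by rewrite /w xy mul0r.
  apply: eq_Rintegral => y; rewrite inE/= in_itv/= => /andP[_ yx].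
  by rewrite /w ltNge yx mul1r.
have cX0 : 0 < C^-1 * x by rewrite mulr_gt0 ?invr_gt0.
have [K K0 hK] := @powR_lip R (C^-1 * x) (C * x) n%:R^-1 cX0.
move=> t e t0 e0.
have K1 : 0 < K * n%:R + 1 by rewrite ltr_wpDl// mulr_ge0.
have [d d0 hd] := cw t _ t0 (divr_gt0 e0 K1).
exists d => // s s0 st; have h := hd s s0 st.
rewrite (pf_r_powR n2 (pf s0) xM') (pf_r_powR n2 (pf t0) xM').
rewrite (le_trans (hK _ _ (pf_r (pf s0) xM') (pf_r (pf t0) xM')))//.
rewrite !E// -mulrBr normrM (ger0_norm (ler0n _ _)) mulrA.
rewrite (le_trans (ler_wpM2l _ h)) ?mulr_ge0//.
rewrite mulrCA ler_piMr ?(ltW e0)// ler_pdivrMr// mul1r lerDl ler01//.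
Qed.

(** Fluxes of the momentum equation in terms of [v = (r^(n-1) u)_x]. *)
Definition FA a b c d : R := b ^+ n.-1 *
  (A * a `^ gamma - a * (c2 * a `^ theta + 2%:R * (c1 * a `^ theta)) * c) +
  2%:R * N * (c1 * a `^ theta) * (b ^+ (n - 2)%N * d).
Definition FB a b c d : R := N / (b * a) *
  (A * a `^ gamma - a * (c2 * a `^ theta + 2%:R * (c1 * a `^ theta)) * c) +
  2%:R * N * (c1 * a `^ theta) * (c / b - d / (b ^+ 2 * a)).

Section FluxLip.
Variables (rho1 rho2 r1 r2 W : R).
Hypothesis rho10 : 0 < rho1.
Hypothesis r10 : 0 < r1.
Local Notation lip := (lip rho1 rho2 r1 r2 W).

Let lip_pw (k q : R) : lip (fun a _ _ _ => k * a `^ q).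
Proof. by apply: lipM; [exact: lip_cst|exact: lip_rho_powR]. Qed.

Let lip_S : lip (fun a _ c _ =>
  A * a `^ gamma - a * (c2 * a `^ theta + 2%:R * (c1 * a `^ theta)) * c).
Proof.
apply: lipB; first exact: lip_pw.
apply: lipM; last exact: lip_proj3.
apply: lipM; first exact: lip_proj1.
by apply: lipD; [exact: lip_pw|apply: lipM; [exact: lip_cst|exact: lip_pw]].
Qed.

Lemma lip_FA : lip FA.
Proof.
apply: lipD; first by apply: lipM; [exact: lip_area|exact: lip_S].
apply: lipM; first by apply: lipM; [exact: lip_cst|exact: lip_pw].
by apply: lipM; [apply: lipX; exact: lip_proj2|exact: lip_proj4].
Qed.

Lemma lip_FB : lip FB.
Proof.
apply: lipD; first by apply: lipM; [exact: lip_geom|exact: lip_S].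
apply: lipM; first by apply: lipM; [exact: lip_cst|exact: lip_pw].
apply: lipB; first by apply: lipM; [exact: lip_proj3|exact: lip_rV].
apply: lipM; first exact: lip_proj4.
have := lipM (lipX 2 (lip_rV rho1 rho2 r2 W r10)) (lip_rhoV rho2 r1 r2 W rho10).
by congr lip; do 4 (apply/funext => ?); rewrite invfM exprVn.
Qed.

End FluxLip.

Definition AA x t : R := FA (rho x t) (r x t) (v x t) (u x t)
  - PGamma p F t * r x t ^+ n.-1.
Definition BB x t : R := FB (rho x t) (r x t) (v x t) (u x t)
  - PGamma p F t * (N / (r x t * rho x t)) - force p F x (r x t) t - ut x t.

Section Weak.
Variables (phi : R -> R) (a : R).
Hypothesis sphi : smooth phi.
Hypothesis a0 : 0 < a.
Hypothesis phi0 : forall x, x <= a -> phi x = 0.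

Local Notation dphi := (derive1 phi).
Local Notation rl := (rlow C * a `^ n%:R^-1).
Local Notation ru := (rupp C * M `^ n%:R^-1).
Local Notation W := (Num.max V (Q * ru)).

Let rl0 : 0 < rl. Proof. by rewrite mulr_gt0 ?rlow_gt0 ?powR_gt0. Qed.

Let inbox t : 0 <= t -> {ae mu, forall x, a <= x -> 0 <= x <= M ->
  box lo hi rl ru W (rho x t) (r x t) (v x t) (u x t)}.
Proof.
move=> t0; apply: aeS2 (pf_v (pf t0)) (pf_u (pf t0)) => x hv hu ax xM.
have axM : a <= x <= M by rewrite ax; case/andP: xM.
have rb := pf_r_bounds n2 C0 (pf t0) a0 axM.
split => //; first exact: (pf_rho (pf t0)).
  by rewrite le_max hv.
have xM' : 0 < x <= M by rewrite (lt_le_trans a0 ax); case/andP: xM.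
have r0 := pf_r_gt0 n2 C0 (pf t0) xM'.
rewrite le_max; apply/orP; right; have := hu xM.
rewrite normrM normfV [`|r x t|]gtr0_norm// ler_pdivrMr// => h.
rewrite (le_trans h)// ler_wpM2l//; last by case/andP: rb.
by rewrite (le_trans (normr_ge0 _) (hu xM)).
Qed.

Let mphi (f : R -> R) : smooth f -> measurable_fun I f.
Proof. by move=> sf; exact: smooth_meas. Qed.

Let wbnd (f : R -> R) : smooth f -> exists K, forall x, I x -> `|f x| <= K.
Proof.
move=> /(smooth_bnd 0 M)[K _ hK]; exists K => x.
by rewrite /= in_itv/=; exact: hK.
Qed.

Let sdphi : smooth dphi. Proof. exact: smooth_derive1. Qed.

Let dphi0 x : x < a -> dphi x = 0.
Proof.
move=> xa; apply: derive1_near0; near=> y; apply: phi0; apply: ltW; near: y; exact: lt_nbhsl.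
Unshelve. all: by end_near. Qed.

Let sxphi : smooth (fun x => x * phi x).
Proof.
apply: smoothM => //; apply: (@smooth_prim _ _ (fun=> 1)); exact: smooth_cst.
Qed.

(* the weights of the flux, of the lower order terms, and of gravity, whose
   factor [x] is moved into the weight *)
Let wt (f : R -> R) := smooth f /\ forall x, I x -> x < a -> f x = 0.
Let w1 : wt dphi. Proof. by split=> // x _; exact: dphi0. Qed.
Let w2 : wt phi. Proof. by split=> // x _ xa; rewrite phi0// ltW. Qed.
Let w3 : wt (fun x => x * phi x).
Proof. by split; [exact: sxphi|move=> x _ xa; rewrite phi0 ?mulr0// ltW]. Qed.

Let J f H t := \int[mu]_(x in I) (f x * H (rho x t) (r x t) (v x t) (u x t)).

Let J_intg f H t : wt f -> lip lo hi rl ru W H -> 0 <= t ->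
  intg I (fun x => f x * H (rho x t) (r x t) (v x t) (u x t)).
Proof.
move=> [sf f0] lH t0; have [K hK] := wbnd sf; have [pu _ _] := sol_path_u.
exact: (lip_path_intg lH (mphi sf) hK f0 sol_path_rho sol_path_r sol_path_v pu inbox).
Qed.

Let J_cont f H : wt f -> lip lo hi rl ru W H -> cont0 (J f H).
Proof.
move=> [sf f0] lH; have [K hK] := wbnd sf; have [pu _ _] := sol_path_u.
exact: (lip_path_cont M0 lH (mphi sf) hK f0 sol_path_rho sol_path_r sol_path_v pu inbox).
Qed.

Lemma sol_df_meas t : 0 <= t -> measurable_fun I (fun x => df F x (r x t) t).
Proof.
move=> t0; have [_ [fx [fr [ft [[cdf _ _ _ _] _]]]] _ _ _] := adm.
apply: meas_away0 => // d d0 dM; apply: subspace_continuous_measurable_fun => //.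
apply/subspace_continuousP => x; rewrite /= in_itv/= => dxM.
have /subspace_continuousP cr := prim_cont (prim_r n2 lo0 C0 (pf t0) d0).
have xM : 0 < x <= M by exact: itv0M d0 dxM.
have ge0 y : d <= y <= M -> 0 <= y /\ 0 <= r y t.
  move=> dyM; have yM := itv0M d0 dyM.
  by split; [case/andP: yM => /ltW|exact/ltW/(pf_r_gt0 n2 C0 (pf t0))].
have [x0 r0] := ge0 x dxM.
apply/cvgrPdist_le => e e0.
have [k k0 hk] := octant_eps cdf x0 r0 t0 e0.
have : `[d, M]%classic x by rewrite /= in_itv.
move=> /cr /cvgrPdist_lt /(_ k k0).
rewrite !near_withinE => -[d1 /= d10 h1].
exists (Num.min d1 k); first by rewrite /= lt_min d10.
move=> y /=; rewrite lt_min => /andP[yd1 yk] yI.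
have dyM : d <= y <= M by move: yI; rewrite in_itv.
have [y0 ry0] := ge0 y dyM.
rewrite distrC; apply: hk => //; rewrite ?subrr ?normr0//.
  by rewrite distrC.
by rewrite distrC; exact: h1.
Qed.

Lemma sol_df_bnd T : exists K, forall x t, 0 <= x <= M -> 0 <= t <= T ->
  `|df F x (r x t) t| <= K.
Proof.
have [_ [fx [fr [ft [[cdf _ _ _ _] _]]]] _ _ _] := adm.
have CM1 : 1 <= C * M + 1 by rewrite lerDr mulr_ge0 ?ltW.
have [K hK] := octant_bounded M (C * M + 1) T cdf.
exists K => x t xM tT; have t0 : 0 <= t by case/andP: tT.
apply: hK => //; have r0 := pf_r0 (pf t0) xM; rewrite r0/=.
have [r1|r1] := leP (r x t) 1; first exact: le_trans CM1.
apply: (@le_trans _ _ (r x t ^+ n)).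
  by have -> : n = n.-1.+1 by [rewrite prednK// ltnW]; rewrite exprS ler_peMr// exprn_ege1// ltW.
have /andP[_ h] := pf_r (pf t0) xM.
rewrite (le_trans h)// (le_trans (ler_wpM2l (ltW C0) (_ : x <= M))) ?lerDl//.
by case/andP: xM.
Qed.

Let df_intg t : 0 <= t -> intg I (fun x => phi x * df F x (r x t) t).
Proof.
move=> t0; have [K hK] := wbnd sphi; have [L hL] := sol_df_bnd t.
apply: (@bnd_intg _ _ _ (K * L)) => //.
  by apply: measurable_funM; [exact: mphi|exact: sol_df_meas].
apply: aeW => x xI; rewrite normrM ler_pM ?hK// hL ?t0 ?lexx//.
Qed.

(** The force is only jointly continuous, with no uniform modulus at hand:
    dominated convergence along sequences of times. *)
Let df_cont : cont0 (fun t => \int[mu]_(x in I) (phi x * df F x (r x t) t)).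
Proof.
have [_ [fx [fr [ft [[cdf _ _ _ _] _]]]] _ _ _] := adm.
have [K hK] := wbnd sphi.
apply: cont0_seq => t s_ t0 s0 st.
have [T hT] : exists T, forall k, s_ k <= T.
  have := cvg_seq_bounded (cvgP _ st) => -[B [_ hB]]; exists (B + 1) => k.
  by apply: (le_trans (ler_norm _)); apply: (hB (B + 1)); rewrite ?ltrDl//.
have [L hL] := sol_df_bnd T.
apply: (@Rint_cvg _ _ _ _ (fun=> K * L)) => //.
- by move=> k; apply: measurable_funM; [exact: mphi|exact: sol_df_meas].
- by apply: measurable_funM; [exact: mphi|exact: sol_df_meas].
- exact: intg_cst.
- apply: aeS (ae_neq 0) => x xn0; rewrite /= in_itv/= => /andP[x0 xM].
  have xM' : 0 < x <= M by rewrite lt_def xn0 x0.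
  apply: cvgMr; apply/cvgrPdist_le => e e0.
  have rx s : 0 <= s -> 0 <= r x s.
    by move=> s0'; exact/ltW/(pf_r_gt0 n2 C0 (pf s0')).
  have [d d0 hd] := octant_eps cdf x0 (rx t t0) t0 e0.
  have [d1 d10 hd1] := sol_r_cont xM' t0 (divr_gt0 d0 (ltr0n _ 2)).
  have d' : 0 < Num.min d d1 by rewrite lt_min d0.
  move/cvgrPdist_lt: st => /(_ _ d') st; near=> k.
  rewrite distrC; apply: hd => //; first exact: rx.
  - by rewrite subrr normr0.
  - rewrite (@le_lt_trans _ _ (d / 2%:R))// ?gtr_pMr ?invf_lt1 ?ltr1n//.
    apply: hd1 => //; rewrite distrC; near: k.
    by apply: filterS st => k; rewrite lt_min => /andP[].
  - rewrite distrC; near: k.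
    by apply: filterS st => k; rewrite lt_min => /andP[].
- move=> k x xI; rewrite normrM ler_pM ?hK// hL ?s0 ?hT//.
Unshelve. all: by end_near. Qed.

Local Notation area := (fun _ b _ _ : R => b ^+ n.-1).
Local Notation geom := (fun a b _ _ : R => N / (b * a)).
Local Notation grav := (fun _ b _ _ : R => G * (b ^+ n.-1)^-1).
Local Notation xphi := (fun x => x * phi x).

Let U t := \int[mu]_(x in I) (u x t * phi x).
Let U' t := \int[mu]_(x in I) (ut x t * phi x).
Let D t := \int[mu]_(x in I) (phi x * df F x (r x t) t).
Let H t := J dphi FA t + J phi FB t - (J xphi grav t + D t).
Let Bd t := PGamma p F t * (J dphi area t + J phi geom t).

Let lFA : lip lo hi rl ru W FA. Proof. exact: lip_FA. Qed.
Let lFB : lip lo hi rl ru W FB. Proof. exact: lip_FB. Qed.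
Let larea : lip lo hi rl ru W area. Proof. exact: lip_area. Qed.
Let lgeom : lip lo hi rl ru W geom. Proof. exact: lip_geom. Qed.
Let lgrav : lip lo hi rl ru W grav.
Proof. by apply: lipM; [exact: lip_cst|exact: lip_areaV]. Qed.

Let uphi_intg t : 0 <= t -> intg I (fun x => u x t * phi x).
Proof.
move=> t0; have [K hK] := wbnd sphi; have [pu _ _] := sol_path_u.
apply: (@intgM _ _ _ _ K) => //; first by apply: (sqi_intg mI Ioo); case: (pu t t0).
  exact: mphi.
by apply: aeW.
Qed.

Let cH : cont0 H.
Proof.
apply: cont0D; first by apply: cont0D; exact: J_cont.
by apply: cont0N; apply: cont0D; [exact: J_cont|exact: df_cont].
Qed.

Let cBd : cont0 Bd.
Proof.
apply: cont0M; last by apply: cont0D; exact: J_cont.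
apply: cont0D; first exact: cont0_cst.
by have [hdP _ _ _ _] := adm; exact: C1_half_line_cont0.
Qed.

Let pairing : cont0 U' /\ forall b, 0 <= b -> prim 0 b U U'.
Proof.
have [K hK] := wbnd sphi; have [pu put pdu] := sol_path_u.
have cU' : cont0 U'.
  have := path_pair_cont (mphi sphi) hK put (path_const M0 1); congr cont0; apply/funext => t.
  by apply: eq_Rintegral => x _; rewrite mulr1 mulrC.
split=> // b b0; apply: deriv0_prim => //.
exact: (path_lin_deriv M0 (mphi sphi) hK pu put pdu).
Qed.

Section TimeFactor.
Variables (eta : R -> R) (b : R).
Hypothesis seta : smooth eta.
Hypothesis b0 : 0 < b.
Hypothesis eta0 : forall t, b <= t -> eta t = 0.
Local Notation deta := (derive1 eta).

Let inn t := \int[mu]_(x in I) (u x t * derive1 (fun s => phi x * eta s) t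
     + (pressure p (rho x t)
        - rho x t * (visclambda p (rho x t) + 2%:R * viscmu p (rho x t)) * v x t)
       * wderivx M (fun x t => r x t ^+ n.-1 * (phi x * eta t)) x t
     + 2%:R * (n%:R - 1) * viscmu p (rho x t) *
       wderivx M (fun x t => r x t ^+ (n - 2)%N * u x t * (phi x * eta t)) x t
     - force p F x (r x t) t * (phi x * eta t)).

Let inner t : 0 <= t -> inn t =
  deta t * U t + eta t * H t.
Proof.
move=> t0; rewrite /inn; have P := pf t0.
have W1 := is_wderivZ (eta t) (wderiv_area n2 lo0 C0 P sphi).
have W2 := is_wderivZ (eta t) (wderiv_velocity n2 M0 lo0 C0 P sphi).
have G1 : (fun x => r x t ^+ n.-1 * (phi x * eta t)) =
          (fun x => eta t * (r x t ^+ n.-1 * phi x)) by apply/funext => x; ring.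
have G2 : (fun x => r x t ^+ (n - 2)%N * u x t * (phi x * eta t)) =
          (fun x => eta t * (r x t ^+ (n - 2)%N * u x t * phi x)) by apply/funext => x; ring.
have mrho : measurable_fun I (rho^~ t) := pf_mrho P.
have mu_ : measurable_fun I (u^~ t) := pf_mu P.
have mv_ : measurable_fun I (v^~ t) := pf_mv P.
have mr_ : measurable_fun I (r^~ t) by exact: (pf_mr n2 lo0 P).
have mw q : measurable_fun I (fun x => rho x t `^ q).
  exact: measurable_fun_powR.
have ml (k : R) q : measurable_fun I (fun x => k * rho x t `^ q) by exact: measurable_funM.
pose g x := deta t * (u x t * phi x) + eta t * ((dphi x * FA (rho x t) (r x t) (v x t) (u x t)
   + phi x * FB (rho x t) (r x t) (v x t) (u x t)) - (xphi x * grav (rho x t) (r x t) (v x t) (u x t)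
   + phi x * df F x (r x t) t)).
have i1 := uphi_intg t0.
have i2 := J_intg w1 lFA t0; have i3 := J_intg w2 lFB t0.
have i4 := J_intg w3 lgrav t0; have i5 := df_intg t0.
have i23 := intgD mI i2 i3; have i45 := intgD mI i4 i5; have i25 := intgB mI i23 i45.
have ig : intg I g by apply: intgD => //; exact: intgZ.
transitivity (\int[mu]_(x in I) g x); last first.
  rewrite /g RintegralD//; [|exact: intgZ|exact: intgZ].
  by rewrite !RintegralZl// RintegralB// !RintegralD.
apply: ae_eq_Rint => //; last 2 first.
- exact: intgm ig.
- apply: aeS3 (wderivE W1) (wderivE W2) (aeI (ae_neq 0) (ae_neq M)).
  move=> x h1 h2 [xn0 xnM]; rewrite /= in_itv/= => /andP[x0 xM].
  have xM' : 0 < x < M by rewrite !lt_neqAle x0 xM xnM eq_sym xn0.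
  rewrite /wderivx G1 G2 h1// h2//.
  have -> : derive1 (fun s => phi x * eta s) t = phi x * deta t.
    have h := smooth_is_derive t seta; rewrite derive1E; exact: derive_val.
  rewrite /g /FA /FB /pressure /viscmu /visclambda /force/=; ring.
- apply: measurable_funB; [apply: measurable_funD; [apply: measurable_funD|]|].
  + apply: measurable_funM => //.
    rewrite (_ : (fun x => _) = (fun x => phi x * deta t)).
      by apply: measurable_funM => //; exact: mphi.
    apply/funext => x; have h := smooth_is_derive t seta; rewrite derive1E; exact: derive_val.
  + apply: measurable_funM.
      apply: measurable_funB; first exact: ml.
      apply: measurable_funM => //; apply: measurable_funM => //.
      by apply: measurable_funD; [exact: ml|apply: measurable_funM => //; exact: ml].
    by apply: wderiv_meas; rewrite G1; eexists; exact: W1.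
  + apply: measurable_funM; first by apply: measurable_funM => //; exact: ml.
    by apply: wderiv_meas; rewrite G2; eexists; exact: W2.
  + apply: measurable_funM; last by apply: measurable_funM => //; exact: mphi.
    apply: measurable_funD; last exact: sol_df_meas.
    apply: measurable_funM; first by apply: measurable_funM.
    by apply: measurable_funV; exact: measurable_funX.
Qed.

(** The weak equation for [phi (x) eta (t)]. Integration by parts in time moves the
    derivative from [eta] to the velocity. *)
Lemma weak_eta : \int[mu]_(t in `[0, b]) (eta t * (H t - U' t - Bd t)) =
  (U 0 - \int[mu]_(x in I) (u0 x * phi x)) * eta 0.
Proof.
have [cU' pU] := pairing.
have tf : test_fun2 M (fun x t => phi x * eta t).
  split; first exact: smooth2_prod.
  exists a, b; split=> // x t _ _ /orP[xa|bt]; first by rewrite phi0 ?mul0r// ltW.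
  by rewrite eta0 ?mulr0// ltW.
have deta0 t : b < t -> deta t = 0.
  move=> bt; apply: derive1_near0; near=> y; apply: eta0; apply: ltW; near: y; exact: lt_nbhsr.
have subh : `[0, b]%classic `<=` (half_line : set R).
  by move=> t; rewrite /half_line /= !in_itv/= => /andP[->].
have out (g : R -> R) : (forall t, 0 <= t -> b < t -> g t = 0) ->
    \int[mu]_(t in half_line) g t = \int[mu]_(t in `[0, b]) g t.
  move=> g0; apply: Rint_supp => // t; rewrite /half_line /= !in_itv/= andbT => t0.
  by move=> /negP; rewrite t0/= -ltNge; exact: g0.
have : \int[mu]_(t in half_line) inn t =
  \int[mu]_(t in half_line) (PGamma p F t * (r M t ^+ n.-1 * (phi M * eta t)))
  - \int[mu]_(x in I) (u0 x * (phi x * eta 0)) := ws_momentum sol tf.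
rewrite (@eq_Rintegral _ _ _ mu half_line (fun t => deta t * U t + eta t * H t) inn); last first.
  by move=> t; rewrite inE /half_line /= in_itv/= andbT => t0; exact: inner.
rewrite (@eq_Rintegral _ _ _ mu half_line (fun t => eta t * Bd t)
  (fun t => PGamma p F t * (r M t ^+ n.-1 * (phi M * eta t)))); last first.
  move=> t; rewrite inE /half_line /= in_itv/= andbT => t0.
  rewrite [r M t ^+ _ * _]mulrA (area_boundary n2 M0 lo0 C0 (pf t0) sphi a0 phi0).
  by rewrite RintegralD ?(J_intg w1 larea t0) ?(J_intg w2 lgeom t0)// /Bd /J; ring.
rewrite !out; first last.
- by move=> t t0 bt; rewrite eta0 ?deta0 ?mul0r ?addr0// ltW.
- by move=> t t0 bt; rewrite eta0 ?mul0r// ltW.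
have ceta := smooth_cont0 seta; have cdeta := smooth_cont0 (smooth_derive1 seta).
have peta := prim_smooth (ltW b0) seta.
have [L _ hL] := smooth_bnd 0 b (smooth_derive1 seta).
have [ip Ep] := primM (pU b (ltW b0)) peta hL.
have {Ep} := Ep 0 b (lexx _) (ltW b0) (lexx _); rewrite (eta0 (lexx b)) mulr0 sub0r => Ep.
have mb : measurable (`[0, b]%classic : set R) by [].
have iB : intg `[0, b] (fun t => eta t * Bd t) by apply: cont0_intg => //; exact: cont0M.
have iU : intg `[0, b] (fun t => deta t * U t).
  apply: cont0_intg => //; apply: cont0M => //.
  have [K hK] := wbnd sphi; have [pu put pdu] := sol_path_u.
  exact: deriv0_cont (path_lin_deriv M0 (mphi sphi) hK pu put pdu).
have iH : intg `[0, b] (fun t => eta t * H t) by apply: cont0_intg => //; exact: cont0M.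
have iUH := intgD mb iU iH.
have E0 : \int[mu]_(x in I) (u0 x * (phi x * eta 0)) =
    (\int[mu]_(x in I) (u0 x * phi x)) * eta 0.
  have [K hK] := wbnd sphi.
  rewrite mulrC -RintegralZl//; first by apply: eq_Rintegral => x _; ring.
  have [_ du0] := ws_data sol.
  apply: (@intgM _ _ _ _ K) => //; last by apply: aeW.
    by apply: (sqi_intg mI Ioo); exact: in_L2_sqi.
  exact: mphi.
rewrite E0 => EM.
transitivity (\int[mu]_(t in `[0, b]) ((deta t * U t + eta t * H t)
   - (U' t * eta t + U t * deta t) - eta t * Bd t)).
  by apply: eq_Rintegral => t _; ring.
rewrite RintegralB//; last exact: intgB.
by rewrite RintegralB// -Ep EM; ring.
Unshelve. all: by end_near. Qed.

End TimeFactor.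

(** Let [eta] tend to the indicator of [[0, b)]: the integrals over all [[0, b]]
    of a continuous function of time agree. *)
Let sol_test : U 0 = \int[mu]_(x in I) (u0 x * phi x) /\
  forall t, 0 <= t -> H t - U' t - Bd t = 0.
Proof.
have [cU' _] := pairing.
have cZ : cont0 (fun t => H t - U' t - Bd t).
  by apply: cont0D; [apply: cont0D => //; exact: cont0N|exact: cont0N].
pose Z t := H t - U' t - Bd t; pose c := U 0 - \int[mu]_(x in I) (u0 x * phi x).
suff h b : 0 < b -> \int[mu]_(t in `[0, b]) Z t = c.
  have [/eqP c0 hZ] := cont0_zero cZ h; split=> //.
  by apply/eqP; rewrite -subr_eq0.
move=> b0; have iZ : intg `[0, b] Z by exact: cont0_intg.
have mb : measurable (`[0, b]%classic : set R) by [].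
have E k : \int[mu]_(t in `[0, b]) (bump k (-1) b t * Z t) = c * bump k (-1) b 0.
  apply: weak_eta => //; first exact: bump_smooth.
  by move=> t bt; rewrite bump_out ?bt ?orbT.
have l1 : \int[mu]_(t in `[0, b]) (bump k (-1) b t * Z t) @[k --> \oo] -->
    \int[mu]_(t in `[0, b]) Z t.
  apply: (@Rint_cvg _ _ _ _ (fun t => `|Z t|)) => //.
  - by move=> k; apply: measurable_funM; [apply: smooth_meas => //; exact: bump_smooth|exact: intgm iZ].
  - exact: intgm iZ.
  - exact: intg_norm.
  - apply: aeS (ae_neq b) => t tnb; rewrite /= in_itv/= => /andP[t0 tb].
    have := @bump_cvg R (-1) b t; rewrite (lt_le_trans _ t0) ?ltrN10//= lt_neqAle tnb tb.
    by move=> h; rewrite -[X in _ --> X]mul1r; apply: cvgM => //; exact: cvg_cst.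
  - by move=> k t _; rewrite normrM ler_piMl// bump_norm.
have l2 : \int[mu]_(t in `[0, b]) (bump k (-1) b t * Z t) @[k --> \oo] --> c.
  have -> : (fun k => \int[mu]_(t in `[0, b]) (bump k (-1) b t * Z t)) =
      (fun k => c * bump k (-1) b 0) by apply/funext.
  have := @bump_cvg R (-1) b 0; rewrite ltrN10 b0/= => h.
  by rewrite -[X in _ --> X]mulr1; apply: cvgM => //; exact: cvg_cst.
exact: (cvg_unique _ l1 l2).
Qed.

(** The external pressure has been moved under the integral sign by
    [area_boundary]. *)
Lemma weak_momentum_at :
  \int[mu]_(x in I) (u x 0 * phi x) = \int[mu]_(x in I) (u0 x * phi x) /\
  forall t, 0 <= t -> \int[mu]_(x in I) (AA x t * dphi x + BB x t * phi x) = 0.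
Proof.
have [E0 Et] := sol_test; split=> // t t0; transitivity (H t - U' t - Bd t); last exact: Et.
have [K hK] := wbnd sphi; have [_ put _] := sol_path_u.
have iut : intg I (fun x => ut x t * phi x).
  apply: (@intgM _ _ _ _ K) => //; first by apply: (sqi_intg mI Ioo); case: (put t t0).
    exact: mphi.
  by apply: aeW.
have i2 := J_intg w1 lFA t0; have i3 := J_intg w2 lFB t0.
have i4 := J_intg w3 lgrav t0; have i5 := df_intg t0.
have i6 := J_intg w1 larea t0; have i7 := J_intg w2 lgeom t0.
have i23 := intgD mI i2 i3; have i45 := intgD mI i4 i5; have i25 := intgB mI i23 i45.
have i8 := intgB mI i25 iut; have i67 := intgD mI i6 i7.
have i67Z := intgZ (PGamma p F t) mI i67.
transitivity (\int[mu]_(x in I) (((dphi x * FA (rho x t) (r x t) (v x t) (u x t)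
    + phi x * FB (rho x t) (r x t) (v x t) (u x t))
    - (xphi x * grav (rho x t) (r x t) (v x t) (u x t) + phi x * df F x (r x t) t)
    - ut x t * phi x)
    - PGamma p F t * (dphi x * r x t ^+ n.-1 + phi x * (N / (r x t * rho x t))))).
  by apply: eq_Rintegral => x _; rewrite /AA /BB /force/=; ring.
rewrite RintegralB// RintegralB// RintegralB// RintegralD// [X in _ - X - _ - _]RintegralD//.
by rewrite RintegralZl// RintegralD.
Qed.

End Weak.

Lemma sol_initial : {ae mu, forall x, 0 <= x <= M -> u x 0 = u0 x}.
Proof.
have [pu _ _] := sol_path_u; have [_ du0] := ws_data sol.
have su := proj1 (pu 0 (lexx _)); have su0 := in_L2_sqi mI du0.
have iB := sqi_intg mI Ioo (sqiB mI su su0).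
have mloc : measurable_fun `]0, M[ (fun x => u x 0 - u0 x).
  by apply: measurable_funS (intgm iB) => //; exact: subset_itv_oo_cc.
have loc : locally_integrable `]0, M[ (fun x => u x 0 - u0 x).
  apply: locally_integrable_itv => //.
  move=> a b a0 bM; apply: intgS iB => //; apply: subitv; exact: ltW.
have h0 : {ae mu, forall x, 0 < x < M -> u x 0 - u0 x = 0}.
  apply: ae0_of_test loc _ => phi tphi; have sphi := test_smooth tphi.
  have [a [b [a0 bM p0]]] := proj2 tphi.
  have a20 : 0 < a / 2%:R by rewrite divr_gt0.
  have phi0 x : x <= a / 2%:R -> phi x = 0.
    move=> xa; apply: p0; rewrite (le_lt_trans xa)// gtr_pMr// invf_lt1 ?ltr1n//.
  have [E _] := weak_momentum_at sphi a20 phi0.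
  have [K _ hK] := smooth_bnd 0 M sphi.
  have iphi f : sqi I f -> intg I (fun x => f x * phi x).
    move=> sf; apply: (@intgM _ _ _ _ K) => //; first exact: (sqi_intg mI Ioo).
      exact: smooth_meas.
    by apply: aeW => x; rewrite /= in_itv/=; exact: hK.
  have mB : measurable_fun `]0, M[ (fun x => (u x 0 - u0 x) * phi x).
    apply: measurable_funM; last by apply: smooth_meas.
    exact: mloc.
  rewrite Rint_oo_cc//.
  under eq_Rintegral do rewrite mulrBl.
  rewrite RintegralB//; [|exact: iphi|exact: iphi].
  by rewrite E subrr.
apply: aeS3 (ae_neq 0) (ae_neq M) h0 => x x0 xM h /andP[xge0 xleM].
apply/eqP; rewrite -subr_eq0 h//.
by rewrite !lt_neqAle xge0 xleM xM eq_sym x0.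
Qed.

Lemma sol_lag x : 0 <= x <= M -> lag_radius p rho0 x = r x 0.
Proof.
move=> xM; have P := pf (lexx (0 : R)); rewrite /lag_radius/=.
have [[mrho0 _] _] := ws_data sol; have mrho := pf_mrho P.
have sub : `[0, x] `<=` I by apply: subitv => //; case/andP: xM.
have mV (f : R -> R) : measurable_fun I f -> measurable_fun `[0, x] (fun y => (f y)^-1).
  by move=> mf; apply: measurable_funV; exact: measurable_funS mf.
have -> : \int[mu]_(y in `[0, x]) (rho0 y)^-1 = \int[mu]_(y in `[0, x]) (rho y 0)^-1.
  apply: ae_eq_Rint; rewrite ?mV//; [exact: mV|exact: mV|].
  apply: aeS (ws_init sol) => y h /sub; rewrite /= in_itv/= => yM.
  by have [-> _] := h yM.
by rewrite -(pf_rE P xM) -(pf_r_powR n2 P xM).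
Qed.

Lemma sol_momentum k a t : 0 < a -> 0 <= t ->
  \int[mu]_(x in I) (AA x t * step k a x + BB x t * lprim a (step k a) x) = 0.
Proof.
move=> a0 t0; have ss := @step_smooth R k a.
have d x : is_derive x 1 (lprim a (step k a)) (step k a x).
  apply: lprim_is_derive; first exact: smooth_continuous.
  by move=> y; exact: step_le0.
have sl : smooth (lprim a (step k a)) := smooth_prim d ss.
have l0 x : x <= a -> lprim a (step k a) x = 0.
  by move=> xa; apply: lprim_le => // y; exact: step_le0.
have [_ /(_ t t0)] := weak_momentum_at sl a0 l0.
by rewrite (derive1_is d).
Qed.

End Evolution.

(** * The energy inequality at a fixed time *)

Section RootWeight.
Context {R : realType}.
Local Notation mu := (@lebesgue_measure R).
Implicit Types (x d e : R).

Lemma ae_exists (P : R -> Prop) (a b : R) : a < b -> {ae mu, forall x, P x} ->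
  exists2 x, a < x < b & P x.
Proof.
move=> ab aeP; apply: contrapT => nex.
have : {ae mu, forall x, ~ (a < x < b)}.
  by apply: aeS aeP => x Px axb; apply: nex; exists x.
move=> [N [mN N0 hN]].
have : (mu `]a, b[ <= mu N)%E.
  apply: le_measure; rewrite ?inE//.
  by move=> x; rewrite /= in_itv/= => axb; apply: hN => /=; exact.
rewrite N0 lebesgue_measure_itv/= lte_fin ab -EFinB lee_fin subr_le0.
by rewrite leNgt ab.
Qed.

Lemma prim_powR d M (q : R) : 0 < d ->
  prim d M (fun x => x `^ q) (fun x => q * x `^ (q - 1)).
Proof.
move=> d0; have [K K0 hK] := @powR_taylor R d M q d0.
have [Md|dM] := ltP M d.
  split; first by rewrite set_itv_ge ?bnd_simp -?ltNge//; exact: integrable_set0.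
  by move=> x y dx xy yM; have := le_lt_trans (le_trans (le_trans dx xy) yM) Md; rewrite ltxx.
have pid : prim d M (fun x => x) (fun=> 1).
  apply: prim_continuous_FTC => //.
  by apply: continuous_subspaceT => x; exact: cvg_cst.
have := @prim_comp _ _ _ _ _ [set y | d <= y <= M] (fun y => y `^ q)
  (fun y => q * y `^ (q - 1)) K 1 pid K0.
have -> : (fun x : R => q * x `^ (q - 1) * 1) = (fun x => q * x `^ (q - 1)).
  by apply/funext => x; rewrite mulr1.
apply=> //; first by move=> s _; rewrite normr1.
by apply: measurable_funM => //; apply: measurable_funS (measurable_powR _).
Qed.

(** The primitive [x^q / q] bounds the integrals over [[M / k, M]], uniformly in
    [k]. *)
Lemma intg_powR (M q : R) : 0 < M -> 0 < q -> intg `[0, M] (fun x => x `^ (q - 1)).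
Proof.
move=> M0 q0; pose f x : R := x `^ (q - 1).
have mf D : measurable_fun D f by exact: measurable_fun_powR.
pose f_ (k : nat) x : R := f x * (if M / k.+1%:R < x then 1 else 0).
have ind01 k x : 0 <= (if M / k.+1%:R < x then 1 else 0 : R) <= 1 by case: ifP; rewrite ?lexx ler01.
have mf_ k D : measurable_fun D (f_ k).
  by apply: measurable_funM => //; exact: meas_ind.
have dk k : 0 < M / k.+1%:R by rewrite divr_gt0.
have dM k : M / k.+1%:R <= M by rewrite ler_pdivrMr// ler_peMr ?(ltW M0)// ler1n.
have ik k : intg `[0, M] (f_ k).
  apply: (@bnd_intg _ _ _ (`|(M / k.+1%:R) `^ (q - 1)| + `|M `^ (q - 1)|)) => //; first exact: mu_itv_lty.
  apply: aeW => x /=; rewrite in_itv/= => /andP[x0 xM].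
  rewrite /f_; case: ifP => h; last by rewrite mulr0 normr0 addr_ge0.
  rewrite mulr1 !ger0_norm ?powR_ge0//.
  exact: powR_bound (dk k) (ltW h) xM.
have bk k : \int[mu]_(x in `[0, M]) f_ k x <= q^-1 * M `^ q.
  have E : \int[mu]_(x in `[0, M]) f_ k x = \int[mu]_(x in `[M / k.+1%:R, M]) f_ k x.
    apply: Rint_supp; first by apply: subitv => //; exact: ltW.
    move=> x; rewrite /= !in_itv/= => /andP[x0 xM] /negP; rewrite xM andbT -ltNge => h.
    by rewrite /f_ ltNge (ltW h) mulr0.
  have pp := primZ q^-1 (prim_powR M q (dk k)).
  rewrite E; apply: (@le_trans _ _ (\int[mu]_(x in `[M / k.+1%:R, M]) (q^-1 * (q * x `^ (q - 1))))).
    apply: ae_le_Rint => //; [|exact: (proj1 pp)|].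
      by apply: intgS (ik k) => //; apply: subitv => //; exact: ltW.
    apply: aeW => x _; rewrite mulKf ?gt_eqF// /f_ ler_piMr ?powR_ge0//.
    by case/andP: (ind01 k x).
  rewrite -((proj2 pp) (M / k.+1%:R) M)// lerBlDr lerDl mulr_ge0 ?invr_ge0 ?powR_ge0 ?(ltW q0)//.
pose f0 x : R := f x * (if 0 < x then 1 else 0).
have mf0 : measurable_fun (`[0, M]%classic : set R) f0.
  by apply: measurable_funM => //; exact: meas_ind.
have [||||||i0 _] := @intg_le_lim _ `[0, M] f_ f0 (q^-1 * M `^ q) _ mf0 => //.
- by move=> x _; rewrite /f0 mulr_ge0 ?powR_ge0//; case: ifP.
- by move=> k x _; rewrite mulr_ge0 ?powR_ge0//; case/andP: (ind01 k x).
- move=> x; rewrite /= in_itv/= => /andP[_ xM]; apply: cvg_near_cst.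
  have [xp|x0] := ltP 0 x.
    exists (Num.truncn (M / x)) => // k /= hk; rewrite /f_ /f0 xp.
    suff -> : M / k.+1%:R < x by [].
    rewrite ltr_pdivrMr// mulrC -ltr_pdivrMr//.
    by apply: lt_le_trans (truncnS_gt _) _; rewrite ler_nat ltnS.
  apply: nearW => k; rewrite /f_ /f0.
  by rewrite [0 < x]ltNge x0 ltNge (le_trans x0 (ltW (dk k))).
apply: (le_intg _ _ i0) => //; apply: aeS (ae_neq 0) => x xn0.
rewrite /= in_itv/= => /andP[x0 _].
by rewrite /f0 lt_def xn0 x0 mulr1 ger0_norm ?powR_ge0.
Qed.

End RootWeight.

Section Scaled.
Context {R : realType}.
Local Notation mu := (@lebesgue_measure R).
Variables (n : nat) (A gamma theta c1 c2 M lo hi C V Q : R) (rho u r v ut : R -> R).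
Local Notation I := (`[0, M]%classic : set R).
Local Notation N := (n%:R - 1 : R).
Hypothesis n2 : (2 <= n)%N.
Hypothesis M0 : 0 < M.
Hypothesis lo0 : 0 < lo.
Hypothesis C0 : 0 < C.
Hypothesis pf : profile n M lo hi C V Q rho u r v.
Hypothesis utE : {ae mu, forall x, 0 <= x <= M -> u x = ut x}.
Hypothesis put : forall d, 0 < d -> prim d M ut (du n V rho r v ut) /\
  exists2 L, 0 <= L & forall x, d <= x <= M -> `|du n V rho r v ut x| <= L.
Implicit Types (x d : R).

(** [x^(1/n)], which has the size of the radius. *)
Definition root x : R := x `^ n%:R^-1.

Lemma root_pos x : 0 < x -> 0 < root x.
Proof. exact: root_gt0. Qed.

(** The radius, the velocity and its derivative in units for which they are
    bounded up to the centre. *)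
Definition sr x : R := r x / root x.
Definition su x : R := ut x / root x.
Definition sy x : R := root x ^+ n.-1 * du n V rho r v ut x.

Definition sbound := Num.max (Q * rupp C) ((V + N * (Q / lo)) / rlow C ^+ n.-1).

Let nE : n = n.-1.+1. Proof. by rewrite prednK// ltnW. Qed.

Lemma sr_bnd x : 0 < x <= M -> rlow C <= sr x <= rupp C.
Proof. exact: (pf_r_root n2 C0 pf). Qed.

Lemma sr_gt0 x : 0 < x <= M -> 0 < sr x.
Proof. by move=> /sr_bnd /andP[h _]; apply: lt_le_trans h; exact: rlow_gt0. Qed.

Let NQ : 0 <= N. Proof. by rewrite subr_ge0 ler1n ltnW. Qed.

(** The bounds on [u / r] and [v] control [U] and, since [v] is the sum of
    [R^(n-1) Y] and [(n-1) U / (R rho)], also [Y]. *)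
Lemma scaled_box : {ae mu, forall x, 0 < x <= M ->
  box lo hi (rlow C) (rupp C) sbound (rho x) (sr x) (sy x) (su x)}.
Proof.
apply: aeS3 (vtE pf) utE (aeI (pf_u pf) (pf_v pf)).
move=> x hv hu [hq hV] xM.
have xM' : 0 <= x <= M by case/andP: xM => /ltW -> ->.
have X0 : 0 < root x by apply: root_pos; case/andP: xM.
have r0 := pf_r_gt0 n2 C0 pf xM; have s0 := sr_gt0 xM.
have rh0 := pf_rho_gt0 lo0 pf xM'; have /andP[rhl rhh] := pf_rho pf xM'.
have /andP[s1 s2] := sr_bnd xM.
have Q0 : 0 <= Q by exact: le_trans (normr_ge0 _) (hq xM').
have hq' : `|ut x| <= Q * r x.
  have := hq xM'; rewrite hu// normrM normfV [`|r x|]gtr0_norm//.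
  by rewrite ler_pdivrMr.
split; [by rewrite rhl|by rewrite s1| |].
- rewrite le_max; apply/orP; right.
  have -> : sy x = (vt V v x - N * (ut x / r x / rho x)) / sr x ^+ n.-1.
    rewrite /sy /du /sr expr_div_n.
    have B1 : root x ^+ n.-1 != 0 by rewrite gt_eqF// exprn_gt0.
    have B2 : r x ^+ n.-1 != 0 by rewrite gt_eqF// exprn_gt0.
    by field; rewrite B1 B2 !gt_eqF.
  rewrite normrM; apply: ler_pM => //; last first.
    rewrite normfV lef_pV2 ?posrE ?exprn_gt0 ?rlow_gt0 ?normr_gt0 ?gt_eqF ?exprn_gt0//.
    rewrite ger0_norm ?exprn_ge0 ?(ltW s0)//.
    by rewrite lerXn2r ?nnegrE ?(ltW (rlow_gt0 C0)) ?(ltW s0).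
  rewrite (le_trans (ler_normB _ _))// lerD//; first by rewrite -hv// hV.
  rewrite normrM (ger0_norm NQ) ler_wpM2l// normrM ler_pM//.
    by have := hq xM'; rewrite hu.
  by rewrite normfV gtr0_norm// lef_pV2 ?posrE.
- rewrite le_max; apply/orP; left.
  rewrite /su normrM normfV [`|root x|]gtr0_norm// ler_pdivrMr//.
  rewrite (le_trans hq')// -mulrA ler_wpM2l//.
  by rewrite -ler_pdivrMr.
Qed.

Lemma su_bnd_ae : {ae mu, forall x, 0 < x <= M -> `|ut x| <= sbound * root x}.
Proof.
apply: aeS scaled_box => x h xM; have [_ _ _] := h xM.
have X0 : 0 < root x by apply: root_pos; case/andP: xM.
by rewrite /su normrM normfV [`|root x|]gtr0_norm// ler_pdivrMr.
Qed.

(** The divergence is homogeneous of degree [0] in [X], and the two fluxes of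
    degrees [n - 1] and [-1]. *)
Lemma scaled_flux : {ae mu, forall x, 0 < x <= M ->
  [/\ v x = divv n (rho x) (sr x) (sy x) (su x),
      FA n A gamma theta c1 c2 (rho x) (r x) (v x) (u x) =
        root x ^+ n.-1 * fluxa n A gamma theta c1 c2 (rho x) (sr x) (sy x) (su x) &
      FB n A gamma theta c1 c2 (rho x) (r x) (v x) (u x) =
        (root x)^-1 * fluxb n A gamma theta c1 c2 (rho x) (sr x) (sy x) (su x)]}.
Proof.
apply: aeS2 (vtE pf) utE => x hv hu xM.
have xM' : 0 <= x <= M by case/andP: xM => /ltW -> ->.
have X0 : root x != 0 by rewrite gt_eqF// root_pos//; case/andP: xM.
have r0 := pf_r_gt0 n2 C0 pf xM.
have rh0 := pf_rho_gt0 lo0 pf xM'.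
have [k nk] : exists k, n = k.+2 by case: (n) n2 => [|[|k]] // _; exists k.
have B1 : root x ^+ k != 0 by rewrite expf_neq0.
have B2 : r x ^+ k != 0 by rewrite gt_eqF// exprn_gt0.
have E : v x = divv n (rho x) (sr x) (sy x) (su x).
  rewrite hv// /divv /sy /su /sr /du expr_div_n nk/= !exprS.
  by move: (k.+2%:R : R) => K; field; rewrite B1 B2 X0 !gt_eqF.
have Ey : r x ^+ n.-1 / root x ^+ n.-1 * sy x = v x - N * ut x / (r x * rho x).
  rewrite hv// /sy /du nk/= !exprS.
  by move: (k.+2%:R : R) => K; field; rewrite B1 B2 X0 !gt_eqF.
split => //.
- rewrite /FA /fluxa /stress -E hu// /sr expr_div_n.
  have -> : forall (a b : R), a / root x ^+ n.-1 * (b - 2%:R * (c1 * rho x `^ theta) *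
    (rho x * (r x ^+ n.-1 / root x ^+ n.-1) * sy x)) =
    a / root x ^+ n.-1 * (b - 2%:R * (c1 * rho x `^ theta) *
    (rho x * (r x ^+ n.-1 / root x ^+ n.-1 * sy x))) by move=> a b; rewrite !mulrA.
  rewrite Ey nk/= subn2/= !exprS.
  move: (k.+2%:R : R) (rho x `^ theta) (rho x `^ gamma) => K T S.
  by field; rewrite B1 X0 !gt_eqF.
- rewrite /FB /fluxb /stress -E hu// /sr /su.
  move: (rho x `^ theta) (rho x `^ gamma) => T S.
  by field; rewrite X0 !gt_eqF.
Qed.

Lemma mut : measurable_fun I ut.
Proof. by apply: meas_away0 => // d d0 _; exact: prim_meas (proj1 (put d0)). Qed.

Lemma mdu : measurable_fun I (du n V rho r v ut).
Proof. by apply: meas_away0 => // d d0 _; exact: intgm (proj1 (proj1 (put d0))). Qed.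

Section Momentum.
Variables (G Pg : R) (D acc : R -> R) (KD : R).
Hypothesis mD : measurable_fun I D.
Hypothesis bD : forall x, 0 <= x <= M -> `|D x| <= KD.
Hypothesis sacc : sqi I acc.

Let mI : measurable I := measurable_itv _.
Let Ioo : (mu I < +oo)%E := mu_itv_lty 0 M.

(** The momentum equation reads [(momA)_x = momB]; [D] is the perturbation of the
    force and [acc] the acceleration [u_t]. *)
Definition momA x : R := FA n A gamma theta c1 c2 (rho x) (r x) (v x) (u x)
  - Pg * r x ^+ n.-1.
Definition momB x : R := FB n A gamma theta c1 c2 (rho x) (r x) (v x) (u x)
  - Pg * (N / (r x * rho x)) - (G * x / r x ^+ n.-1 + D x) - acc x.

Definition fluxA x : R := fluxa n A gamma theta c1 c2 (rho x) (sr x) (sy x) (su x)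
  - Pg * sr x ^+ n.-1.
Definition fluxB x : R := fluxb n A gamma theta c1 c2 (rho x) (sr x) (sy x) (su x)
  - Pg * (N / (sr x * rho x)).

Lemma root_nth x : 0 <= x -> root x ^+ n = x.
Proof. exact: root_n. Qed.

Lemma mom_scaled : {ae mu, forall x, 0 < x <= M ->
  momA x = root x ^+ n.-1 * fluxA x /\
  momB x = (root x)^-1 * fluxB x - (G * root x * (sr x ^+ n.-1)^-1 + D x) - acc x}.
Proof.
apply: aeS scaled_flux => x h xM; have [_ EA EB] := h xM.
have xM' : 0 <= x <= M by case/andP: xM => /ltW -> ->.
have X0 : root x != 0 by rewrite gt_eqF// root_pos//; case/andP: xM.
have Xk : root x ^+ n.-1 != 0 by rewrite expf_neq0.
have r0 : r x != 0 by rewrite gt_eqF// (pf_r_gt0 n2 C0 pf xM).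
have rk : r x ^+ n.-1 != 0 by rewrite expf_neq0.
have rh0 : rho x != 0 by rewrite gt_eqF// (pf_rho_gt0 lo0 pf xM').
split; first by rewrite /momA EA /fluxA /sr expr_div_n; field.
have Ex : G * x = G * (root x * root x ^+ n.-1).
  by rewrite -exprS -nE root_nth//; case/andP: xM'.
rewrite /momB EB /fluxB Ex /sr expr_div_n.
by field; rewrite X0 Xk r0 rk rh0.
Qed.

Lemma flux_bnd : exists2 K, 0 <= K &
  {ae mu, forall x, 0 < x <= M -> `|fluxA x| <= K /\ `|fluxB x| <= K}.
Proof.
have r10 := rlow_gt0 C0.
have [[La La0 hLa] _] := lip_fluxa n A gamma theta c1 c2 hi (rupp C) sbound lo0 r10.
have [[Lb Lb0 hLb] _] := lip_fluxb n A gamma theta c1 c2 hi (rupp C) sbound lo0 r10.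
have [[Lr Lr0 hLr] _] := lip_area n lo hi (rupp C) sbound r10.
have [[Lg Lg0 hLg] _] := lip_geom n hi (rupp C) sbound lo0 r10.
exists ((La + `|Pg| * Lr) + (Lb + `|Pg| * Lg)).
  by rewrite !addr_ge0 ?mulr_ge0.
apply: aeS scaled_box => x /[apply] bx.
have [ha _] := hLa _ _ _ _ _ _ _ _ bx bx; have [hb _] := hLb _ _ _ _ _ _ _ _ bx bx.
have [hr _] := hLr _ _ _ _ _ _ _ _ bx bx; have [hg _] := hLg _ _ _ _ _ _ _ _ bx bx.
split; rewrite (le_trans (ler_normB _ _))// [`|Pg * _|]normrM.
  apply: (le_trans (lerD ha (ler_wpM2l (normr_ge0 Pg) hr))).
  by rewrite lerDl addr_ge0 ?mulr_ge0.
apply: (le_trans (lerD hb (ler_wpM2l (normr_ge0 Pg) hg))).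
by rewrite lerDr addr_ge0 ?mulr_ge0.
Qed.

Let mIm (F : R -> R -> R -> R -> R) (fr fy fu : R -> R) : lip lo hi 1 1 0 F ->
  measurable_fun I fr -> measurable_fun I fy -> measurable_fun I fu ->
  measurable_fun I (fun x => F (rho x) (fr x) (fy x) (fu x)).
Proof. by move=> [_ h] mfr mfy mfu; apply: h => //; exact: pf_mrho pf. Qed.

Let mr : measurable_fun I r. Proof. exact: (pf_mr n2 lo0 pf). Qed.

Lemma mmomA : measurable_fun I momA.
Proof.
apply: measurable_funB.
  by apply: mIm => //; [exact: lip_FA|exact: pf_mv pf|exact: pf_mu pf].
by apply: measurable_funM => //; exact: measurable_funX.
Qed.

Lemma mmomB : measurable_fun I momB.
Proof.
apply: measurable_funB; last by case: sacc.
apply: measurable_funB; first apply: measurable_funB.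
- by apply: mIm => //; [exact: lip_FB|exact: pf_mv pf|exact: pf_mu pf].
- apply: measurable_funM => //; apply: measurable_funM => //; apply: measurable_funV.
  by apply: measurable_funM => //; exact: pf_mrho pf.
- apply: measurable_funD => //; apply: measurable_funM.
    by apply: measurable_funM.
  by apply: measurable_funV; exact: measurable_funX.
Qed.

Lemma root_le x : 0 <= x <= M -> 0 <= root x <= root M.
Proof.
move=> /andP[x0 xM]; rewrite powR_ge0/=; apply: ge0_ler_powR; rewrite ?nnegrE ?invr_ge0//.
exact: le_trans xM.
Qed.

Lemma imomA : intg I momA.
Proof.
have [K K0 hK] := flux_bnd.
apply: (@bnd_intg _ _ _ (root M ^+ n.-1 * K)) => //; first exact: mmomA.
apply: aeS3 (ae_neq 0) hK mom_scaled => x xn0 h1 h2; rewrite /= in_itv/= => xM.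
have xM' : 0 < x <= M by case/andP: xM => x0 ->; rewrite lt_def xn0 x0.
have [-> _] := h2 xM'; have [hA _] := h1 xM'.
have /andP[X0 XM] := root_le xM.
rewrite normrM ler_pM// ger0_norm ?exprn_ge0//.
by rewrite lerXn2r// nnegrE// (le_trans X0).
Qed.

Lemma iroot : intg I (fun x => (root x)^-1).
Proof.
have nR : (0 : R) < n%:R by rewrite ltr0n ltnW.
have q0 : (0 : R) < 1 - n%:R^-1.
  by rewrite subr_gt0 invf_lt1// ltr1n.
have := intg_powR M0 q0; congr intg; apply/funext => x.
have -> : 1 - n%:R^-1 - 1 = - n%:R^-1 :> R by ring.
by rewrite powRN.
Qed.

Lemma imomB : intg I momB.
Proof.
have [K K0 hK] := flux_bnd; have r10 := rlow_gt0 C0.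
pose K1 := `|G| * root M * (rlow C ^+ n.-1)^-1.
have i0 : intg I acc := sqi_intg mI Ioo sacc.
have i1 := intgZ K mI iroot.
have i2 : intg I (fun=> K1 + KD) by exact: intg_cst.
have i12 := intgD mI i1 i2; have i3 := intgD mI i12 (intg_norm mI i0).
apply: (le_intg _ _ i3) => //; first exact: mmomB.
apply: aeS3 (ae_neq 0) hK mom_scaled => x xn0 h1 h2; rewrite /= in_itv/= => xM.
have xM' : 0 < x <= M by case/andP: xM => x0 ->; rewrite lt_def xn0 x0.
have [_ ->] := h2 xM'; have [_ hB] := h1 xM'.
have /andP[X0 XM] := root_le xM.
rewrite (le_trans (ler_normB _ _))// lerD//.
rewrite (le_trans (ler_normB _ _))// lerD//.
  by rewrite normrM mulrC ler_pM// normfV ger0_norm.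
rewrite (le_trans (ler_normD _ _))// lerD ?bD// normrM /K1.
have s0 := sr_gt0 xM'; have /andP[s1 _] := sr_bnd xM'.
apply: ler_pM => //; first by rewrite normrM ler_wpM2l// ger0_norm.
rewrite normfV ger0_norm ?exprn_ge0 ?(ltW s0)// lef_pV2 ?posrE ?exprn_gt0//.
by rewrite lerXn2r ?nnegrE ?(ltW r10) ?(ltW s0).
Qed.

End Momentum.

End Scaled.

(** The weight [x^(-2/n)] of the radii, cut off near the centre to keep the
    energy differentiable in time. *)
Definition cutw (R : realType) (n : nat) (eps x : R) : R :=
  if eps < x then x `^ (- (2%:R / n%:R)) else 0.

Section CutWeight.
Context {R : realType}.
Variables (n : nat) (eps : R).
Hypothesis eps0 : 0 < eps.
Implicit Types x : R.

Lemma root_sq x : x `^ (- (2%:R / n%:R)) = (root n x ^+ 2)^-1.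
Proof. by rewrite powRN -powR_mulrn ?powR_ge0// -powRrM mulrC. Qed.

Lemma cutw_ge0 x : 0 <= cutw n eps x.
Proof. by rewrite /cutw; case: ifP => // _; exact: powR_ge0. Qed.

Lemma cutw_le x : cutw n eps x <= x `^ (- (2%:R / n%:R)).
Proof. by rewrite /cutw; case: ifP => // _; exact: powR_ge0. Qed.

Lemma cutw_bnd x : `|cutw n eps x| <= (root n eps ^+ 2)^-1.
Proof.
rewrite ger0_norm ?cutw_ge0// /cutw root_sq; case: ifP => [ex|_].
  have h0 : 0 < root n eps by exact: root_pos.
  have h1 : root n eps <= root n x.
    by apply: ge0_ler_powR; rewrite ?nnegrE ?invr_ge0 ?(ltW eps0) ?(ltW (lt_trans eps0 ex))// ltW.
  rewrite lef_pV2 ?posrE ?exprn_gt0// ?(lt_le_trans h0)//.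
  by rewrite lerXn2r ?nnegrE ?(ltW h0)// (le_trans (ltW h0)).
by rewrite invr_ge0 sqr_ge0.
Qed.

Lemma cutw_meas (D : set R) : measurable_fun D (cutw n eps).
Proof.
have -> : cutw n eps = (fun x => (if eps < x then 1 else 0) * x `^ (- (2%:R / n%:R))).
  by apply/funext => x; rewrite /cutw; case: ifP; rewrite ?mul1r ?mul0r.
apply: measurable_funM; first exact: meas_ind.
exact: measurable_fun_powR.
Qed.

End CutWeight.

Section TwoProfiles.
Context {R : realType}.
Local Notation mu := (@lebesgue_measure R).
Variables (n : nat) (A gamma G theta c1 c2 M lo hi C V Q Pg KD : R).
Variables (rho1 u1 r1 v1 w1 D1 a1 rho2 u2 r2 v2 w2 D2 a2 : R -> R).
Local Notation I := (`[0, M]%classic : set R).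
Hypothesis n2 : (2 <= n)%N.
Hypothesis M0 : 0 < M.
Hypothesis lo0 : 0 < lo.
Hypothesis C0 : 0 < C.
Hypothesis pf1 : profile n M lo hi C V Q rho1 u1 r1 v1.
Hypothesis pf2 : profile n M lo hi C V Q rho2 u2 r2 v2.
Hypothesis w1E : {ae mu, forall x, 0 <= x <= M -> u1 x = w1 x}.
Hypothesis w2E : {ae mu, forall x, 0 <= x <= M -> u2 x = w2 x}.
Hypothesis pw1 : forall d, 0 < d -> prim d M w1 (du n V rho1 r1 v1 w1) /\
  exists2 L, 0 <= L & forall x, d <= x <= M -> `|du n V rho1 r1 v1 w1 x| <= L.
Hypothesis pw2 : forall d, 0 < d -> prim d M w2 (du n V rho2 r2 v2 w2) /\
  exists2 L, 0 <= L & forall x, d <= x <= M -> `|du n V rho2 r2 v2 w2 x| <= L.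
Hypothesis mD1 : measurable_fun I D1.
Hypothesis mD2 : measurable_fun I D2.
Hypothesis bD1 : forall x, 0 <= x <= M -> `|D1 x| <= KD.
Hypothesis bD2 : forall x, 0 <= x <= M -> `|D2 x| <= KD.
Hypothesis sa1 : sqi I a1.
Hypothesis sa2 : sqi I a2.
Hypothesis su1 : sqi I u1.
Hypothesis su2 : sqi I u2.
Hypothesis sr1 : sqi I r1.
Hypothesis sr2 : sqi I r2.
Implicit Types (x d : R).

Let mI : measurable I := measurable_itv _.
Let Ioo : (mu I < +oo)%E := mu_itv_lty 0 M.

Local Notation X := (root n).
Local Notation A1 := (momA n A gamma theta c1 c2 rho1 u1 r1 v1 Pg).
Local Notation A2 := (momA n A gamma theta c1 c2 rho2 u2 r2 v2 Pg).
Local Notation B1 := (momB n A gamma theta c1 c2 rho1 u1 r1 v1 G Pg D1 a1).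
Local Notation B2 := (momB n A gamma theta c1 c2 rho2 u2 r2 v2 G Pg D2 a2).
Local Notation Y1 := (sy n V rho1 r1 v1 w1).
Local Notation Y2 := (sy n V rho2 r2 v2 w2).
Local Notation R1 := (sr n r1).
Local Notation R2 := (sr n r2).
Local Notation U1 := (su n w1).
Local Notation U2 := (su n w2).
Local Notation Vb := (sbound n lo C V Q).
Local Notation fa := (fluxa n A gamma theta c1 c2).
Local Notation fb := (fluxb n A gamma theta c1 c2).

Hypothesis eq1 : forall k (a : R), 0 < a ->
  \int[mu]_(x in I) (A1 x * step k a x + B1 x * lprim a (step k a) x) = 0.
Hypothesis eq2 : forall k (a : R), 0 < a ->
  \int[mu]_(x in I) (A2 x * step k a x + B2 x * lprim a (step k a) x) = 0.

Let dA x : R := A1 x - A2 x.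
Let dB x : R := B1 x - B2 x.
Let w x : R := w1 x - w2 x.
Let dw x : R := du n V rho1 r1 v1 w1 x - du n V rho2 r2 v2 w2 x.

Let iA1 : intg I A1. Proof. exact: (imomA A gamma theta c1 c2 n2 lo0 C0 pf1 w1E G Pg D1 a1). Qed.
Let iA2 : intg I A2. Proof. exact: (imomA A gamma theta c1 c2 n2 lo0 C0 pf2 w2E G Pg D2 a2). Qed.
Let iB1 : intg I B1. Proof. exact: (imomB A gamma theta c1 c2 n2 M0 lo0 C0 pf1 w1E G Pg mD1 bD1 sa1). Qed.
Let iB2 : intg I B2. Proof. exact: (imomB A gamma theta c1 c2 n2 M0 lo0 C0 pf2 w2E G Pg mD2 bD2 sa2). Qed.

Let idA : intg I dA. Proof. exact: intgB. Qed.
Let idB : intg I dB. Proof. exact: intgB. Qed.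

Let dAE : {ae mu, forall x, 0 <= x <= M -> dA x = - \int[mu]_(y in `[x, M]) dB y}.
Proof.
apply: du_bois_reymond => // k a a0 aM.
have d x : is_derive x 1 (lprim a (step k a)) (step k a x).
  apply: lprim_is_derive; first by apply: smooth_continuous; exact: step_smooth.
  by move=> y; exact: step_le0.
have sl : smooth (lprim a (step k a)) := smooth_prim d (@step_smooth R k a).
have [K _ hK] := smooth_bnd 0 M sl.
have i f g : intg I f -> intg I g ->
    intg I (fun x => f x * step k a x + g x * lprim a (step k a) x).
  move=> If Ig; apply: intgD => //.
    apply: (@intgM _ _ _ _ 1) => //; first exact: step_meas.
    by apply: aeW => x _; exact: step_norm.
  apply: (@intgM _ _ _ _ K) => //; first exact: smooth_meas.
  by apply: aeW => x; rewrite /= in_itv/=; exact: hK.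
transitivity (\int[mu]_(x in I) (A1 x * step k a x + B1 x * lprim a (step k a) x) -
  \int[mu]_(x in I) (A2 x * step k a x + B2 x * lprim a (step k a) x)).
  rewrite -RintegralB//; [|exact: i|exact: i].
  by apply: eq_Rintegral => x _; rewrite /dA /dB; ring.
by rewrite eq1// eq2// subrr.
Qed.

Let mw : measurable_fun I w.
Proof. by apply: measurable_funB; [exact: (mut M0 pw1)|exact: (mut M0 pw2)]. Qed.

Let mdw : measurable_fun I dw.
Proof. by apply: measurable_funB; [exact: (mdu M0 pw1)|exact: (mdu M0 pw2)]. Qed.

Let box1 := scaled_box n2 lo0 C0 pf1 w1E.
Let box2 := scaled_box n2 lo0 C0 pf2 w2E.

Let w_bnd : {ae mu, forall x, 0 < x <= M -> `|w x| <= 2%:R * Vb * X x}.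
Proof.
apply: aeS2 (su_bnd_ae n2 lo0 C0 pf1 w1E) (su_bnd_ae n2 lo0 C0 pf2 w2E) => x h1 h2 xM.
rewrite (le_trans (ler_normB _ _))// (le_trans (lerD (h1 xM) (h2 xM)))//.
by rewrite -mulrA mulr_natl mulr2n.
Qed.

Let Vb0 : 0 <= Vb.
Proof.
have [x xM h] := ae_exists M0 w_bnd; have xM' : 0 < x <= M by case/andP: xM => -> /ltW ->.
have := le_trans (normr_ge0 _) (h xM').
by rewrite pmulr_lge0 ?root_pos//; [rewrite pmulr_rge0|case/andP: xM].
Qed.

Let h x : R := dA x * dw x + dB x * w x.

Let hE : {ae mu, forall x, 0 < x <= M -> h x =
  (fa (rho1 x) (R1 x) (Y1 x) (U1 x) - fa (rho2 x) (R2 x) (Y2 x) (U2 x)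
     - Pg * (R1 x ^+ n.-1 - R2 x ^+ n.-1)) * (Y1 x - Y2 x)
  + (fb (rho1 x) (R1 x) (Y1 x) (U1 x) - fb (rho2 x) (R2 x) (Y2 x) (U2 x)
     - Pg * ((n%:R - 1) / (R1 x * rho1 x) - (n%:R - 1) / (R2 x * rho2 x))) * (U1 x - U2 x)
  - (G * X x * ((R1 x ^+ n.-1)^-1 - (R2 x ^+ n.-1)^-1) + (D1 x - D2 x)) * (X x * (U1 x - U2 x))
  - (a1 x - a2 x) * w x}.
Proof.
apply: aeS2 (mom_scaled A gamma theta c1 c2 n2 lo0 C0 pf1 w1E G Pg D1 a1)
  (mom_scaled A gamma theta c1 c2 n2 lo0 C0 pf2 w2E G Pg D2 a2) => x h1 h2 xM.
have [EA1 EB1] := h1 xM; have [EA2 EB2] := h2 xM.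
have X0 : X x != 0 by rewrite gt_eqF// root_pos//; case/andP: xM.
have Xk : X x ^+ n.-1 != 0 by rewrite expf_neq0.
rewrite /h /dA /dB EA1 EA2 EB1 EB2 /w /dw /fluxA /fluxB /su /sy.
move: (fa _ _ _ _) (fa _ _ _ _) (fb _ _ _ _) (fb _ _ _ _) => e1 e2 e3 e4.
move: (du _ _ _ _ _ _ _) (du _ _ _ _ _ _ _) => d1 d2.
move: ((n%:R - 1) / (R1 x * rho1 x)) ((n%:R - 1) / (R2 x * rho2 x)) => g1 g2.
move: ((R1 x ^+ n.-1)^-1) ((R2 x ^+ n.-1)^-1) => k1 k2.
by field; rewrite ?Xk ?X0.
Qed.

Let iAdw : intg I (fun x => dA x * dw x).
Proof.
have [K1 K10 b1] := flux_bnd A gamma theta c1 c2 n2 lo0 C0 pf1 w1E Pg.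
have [K2 K20 b2] := flux_bnd A gamma theta c1 c2 n2 lo0 C0 pf2 w2E Pg.
apply: (@bnd_intg _ _ _ ((K1 + K2) * (Vb + Vb))) => //.
  by apply: measurable_funM => //; exact: intgm idA.
apply: aeS3 (aeI b1 b2) (aeI box1 box2)
  (aeI3 (ae_neq 0)
  (mom_scaled A gamma theta c1 c2 n2 lo0 C0 pf1 w1E G Pg D1 a1)
  (mom_scaled A gamma theta c1 c2 n2 lo0 C0 pf2 w2E G Pg D2 a2)).
move=> x [f1 f2] [bx1 bx2] [xn0 m1 m2]; rewrite /= in_itv/= => xM.
have xM' : 0 < x <= M by case/andP: xM => x0 ->; rewrite lt_def xn0 x0.
have X0 : 0 < X x by rewrite root_pos//; case/andP: xM'.
have Xk : X x ^+ n.-1 != 0 by rewrite expf_neq0// gt_eqF.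
have [e1 _] := m1 xM'; have [e2 _] := m2 xM'.
have -> : dA x * dw x = (fluxA n A gamma theta c1 c2 V rho1 r1 v1 w1 Pg x -
    fluxA n A gamma theta c1 c2 V rho2 r2 v2 w2 Pg x) * (Y1 x - Y2 x).
  rewrite /dA e1 e2 /dw /sy; ring.
have [_ _ y1 _] := bx1 xM'; have [_ _ y2 _] := bx2 xM'.
have [f1a _] := f1 xM'; have [f2a _] := f2 xM'.
by rewrite normrM ler_pM// (le_trans (ler_normB _ _))// lerD.
Qed.

Let iBw : intg I (fun x => dB x * w x).
Proof.
apply: (@intgM _ _ _ _ (2%:R * Vb * X M)) => //.
apply: aeS2 (ae_neq 0) w_bnd => x xn0 hx; rewrite /= in_itv/= => xM.
have xM' : 0 < x <= M by case/andP: xM => x0 ->; rewrite lt_def xn0 x0.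
rewrite (le_trans (hx xM'))// ler_wpM2l ?mulr_ge0//.
by case/andP: (root_le n xM).
Qed.

Let ih : intg I h. Proof. exact: intgD. Qed.

(** [dA] is the primitive of [dB] that vanishes at [M], hence [h] is the derivative
    of [dA w]. This product vanishes at [M], and also at the centre, where
    the velocities are [O(x^(1/n))]. *)
Lemma no_net_work : \int[mu]_(x in I) h x = 0.
Proof.
apply/eqP; rewrite -normr_eq0 -[_ == 0]negbK; apply/negP => /=.
rewrite -normr_gt0 normr_id => e0; set e := `|_| in e0.
have pA := prim_Rint_tail idB; set Ab := (fun x : R => - _) in pA.
have [K K0 hK] := prim_bnd pA.
have e20 : 0 < e / 2%:R by rewrite divr_gt0.
have [d1 d10 hd1] := Rint_small (ltW M0) ih e20.
pose L := K * (2%:R * Vb) + 1.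
have L0 : 0 < L by rewrite ltr_wpDl// !mulr_ge0.
pose d2 := (e / 2%:R / L) ^+ n.
have d20 : 0 < d2 by rewrite exprn_gt0// divr_gt0.
pose d0 := Num.min (Num.min d1 d2) M.
have d00 : 0 < d0 by rewrite !lt_min d10 d20.
have [d /andP[dp dd] wd] := ae_exists d00 w_bnd.
move: dd; rewrite !lt_min => /andP[/andP[dd1 dd2] dM].
have dM' : 0 < d <= M by rewrite dp ltW.
have := hd1 d (ltW dp) (ltW dM) dd1.
have E : \int[mu]_(x in I) h x = \int[mu]_(x in `[0, d]) h x + \int[mu]_(x in `[d, M]) h x.
  by apply: Rint_chasles => //; exact: ltW.
have [p1 [L1 _ hL1]] := pw1 dp; have [p2 [L2 _ hL2]] := pw2 dp.
have pAd : prim d M Ab dB by apply: prim_sub pA => //; exact: ltW.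
have pw := primB p1 p2.
have bw x : d <= x <= M -> `|dw x| <= L1 + L2.
  by move=> xM; rewrite (le_trans (ler_normB _ _))// lerD ?hL1 ?hL2.
have [_ pp] := primM pAd pw bw.
have := pp d M (lexx _) (ltW dM) (lexx _).
have -> : Ab M = 0 by rewrite /Ab Rint_pt oppr0.
rewrite mul0r sub0r.
have sub : `[d, M] `<=` I by apply: subitv => //; exact: ltW.
have -> : \int[mu]_(x in `[d, M]) (dB x * (w1 x - w2 x) + Ab x *
    (du n V rho1 r1 v1 w1 x - du n V rho2 r2 v2 w2 x)) = \int[mu]_(x in `[d, M]) h x.
  apply: ae_eq_Rint => //.
  - apply: measurable_funD; apply: measurable_funM.
    + by apply: measurable_funS (intgm idB).
    + by apply: measurable_funS mw.
    + exact: prim_meas pAd.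
    + by apply: measurable_funS mdw.
  - by apply: measurable_funS (intgm ih).
  - apply: aeS dAE => x hx /sub; rewrite /= in_itv/= => xM.
    by rewrite /h (hx xM) /Ab /dw /w addrC.
move=> E2 h1.
have h2 : `|\int[mu]_(x in `[d, M]) h x| <= e / 2%:R.
  rewrite -E2 normrN normrM.
  have k1 : `|Ab d| <= K by apply: hK; rewrite !ltW.
  apply: (le_trans (ler_pM _ _ k1 (wd dM'))) => //.
  have XL : X d <= e / 2%:R / L.
    have q0 : 0 <= e / 2%:R / L by rewrite ltW// divr_gt0.
    have -> : e / 2%:R / L = ((e / 2%:R / L) ^+ n) `^ n%:R^-1.
      by rewrite -powR_mulrn// -powRrM divff ?powRr1// pnatr_eq0 -lt0n ltnW.
    by apply: ge0_ler_powR; rewrite ?nnegrE ?invr_ge0 ?(ltW dp) ?(ltW d20)// ltW.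
  rewrite mulrA (le_trans (ler_wpM2l _ XL)) ?mulr_ge0//.
  by rewrite mulrA ler_pdivrMr// mulrC ler_wpM2l ?(ltW e20)// /L lerDl.
have : e < e by rewrite {1}/e E (le_lt_trans (ler_normD _ _))// [e]splitr ltr_leD.
by rewrite ltxx.
Qed.

(** Adding [h], which has zero integral, to the integrand makes the inequality
    pointwise. Where the weight of the radii is cut off, on a set of measure at
    most [eps], the square of [R1 - R2] is bounded by a constant. *)
Lemma energy_at (Pmax K m eps : R) :
  energy_bound n A gamma G theta c1 c2 lo hi (rlow C) (rupp C) Vb Pmax (X M) K ->
  0 <= K -> 0 <= m -> 0 < eps -> `|Pg| <= Pmax ->
  (forall x, 0 <= x <= M -> `|D1 x - D2 x| <= m * `|r1 x - r2 x|) ->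
  \int[mu]_(x in I) ((a1 x - a2 x) * (u1 x - u2 x)
    + (rho2 x ^+ 2 * v2 x - rho1 x ^+ 2 * v1 x) * (rho1 x - rho2 x)
    + cutw n eps x * ((r1 x - r2 x) * (u1 x - u2 x))) <=
  K * (1 + m ^+ 2) * (\int[mu]_(x in I) ((u1 x - u2 x) ^+ 2 + (rho1 x - rho2 x) ^+ 2
    + cutw n eps x * (r1 x - r2 x) ^+ 2) + rupp C ^+ 2 * eps).
Proof.
move=> hK K0 m0 eps0 hPg hD.
have kw x : I x -> `|cutw n eps x| <= (X eps ^+ 2)^-1 by move=> _; exact: cutw_bnd.
have mkw : measurable_fun I (cutw n eps) by exact: cutw_meas.
pose S x := (u1 x - u2 x) ^+ 2 + (rho1 x - rho2 x) ^+ 2 + cutw n eps x * (r1 x - r2 x) ^+ 2.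
pose ind x : R := if eps < x then 0 else 1.
have su := sqiB mI su1 su2; have srr := sqiB mI sr1 sr2; have sa := sqiB mI sa1 sa2.
have mrho1 := pf_mrho pf1; have mrho2 := pf_mrho pf2.
have rho_bnd (rho : R -> R) : (forall x, 0 <= x <= M -> lo <= rho x <= hi) ->
    {ae mu, forall x, I x -> `|rho x| <= hi}.
  move=> hr; apply: aeW => x; rewrite /= in_itv/= => /hr /andP[h1 h2].
  by rewrite ger0_norm// (le_trans (ltW lo0)).
have srho1 : sqi I rho1 by apply: (sqi_bnd mI Ioo mrho1 (rho_bnd _ (pf_rho pf1))).
have srho2 : sqi I rho2 by apply: (sqi_bnd mI Ioo mrho2 (rho_bnd _ (pf_rho pf2))).
have srho := sqiB mI srho1 srho2.
have iS : intg I S.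
  apply: intgD => //; first by apply: intgD => //; [case: su|case: srho].
  have := wprod_intg mkw kw srr srr.
  by congr intg; apply/funext => x; rewrite expr2.
have mind : measurable_fun I ind by exact: meas_ind.
have iind : intg I ind.
  apply: (@bnd_intg _ _ _ 1) => //; apply: aeW => x _; rewrite /ind.
  by case: ifP; rewrite ?normr0 ?normr1 ?ler01.
have ind_le : \int[mu]_(x in I) ind x <= eps.
  pose e := Num.min eps M; have e0 : 0 <= e by rewrite le_min !ltW.
  rewrite (@Rint_supp _ I `[0, e]); last 2 first.
  - by apply: subitv => //; rewrite ge_min lexx orbT.
  - move=> x; rewrite /= !in_itv/= => /andP[x0 xM] /negP; rewrite x0/= -ltNge gt_min.
    by rewrite [M < x]ltNge xM orbF /ind => ->.
  apply: (@le_trans _ _ (\int[mu]_(x in `[0, e]) (fun=> 1 : R) x)).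
    apply: ae_le_Rint => //.
    - by apply: intgS iind => //; apply: subitv => //; rewrite ge_min lexx orbT.
    - by apply: intg_cst => //; exact: mu_itv_lty.
    - by apply: aeW => x _; rewrite /ind; case: ifP.
  by rewrite Rint_cst_itv// mul1r subr0 ge_min lexx.
have iL1 : intg I (fun x => (a1 x - a2 x) * (u1 x - u2 x)) by exact: sqi_prod.
have srv (rho v : R -> R) : measurable_fun I rho -> measurable_fun I v ->
    {ae mu, forall x, I x -> `|rho x| <= hi} -> {ae mu, forall x, 0 <= x <= M -> `|v x| <= V} ->
    sqi I (fun x => rho x ^+ 2 * v x).
  move=> mr mv br bv; apply: (@sqi_bnd _ _ _ (hi ^+ 2 * V)) => //.
    by apply: measurable_funM => //; exact: measurable_funX.
  apply: aeS2 br bv => x h1 h2 xI; have xM : 0 <= x <= M by move: xI; rewrite /= in_itv.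
  rewrite normrM ler_pM ?h2// normrX lerXn2r ?nnegrE//; first exact: le_trans (h1 xI).
  exact: h1.
have iL2 : intg I (fun x => (rho2 x ^+ 2 * v2 x - rho1 x ^+ 2 * v1 x) * (rho1 x - rho2 x)).
  apply: sqi_prod => //; apply: sqiB => //; apply: srv => //.
  - exact: pf_mv pf2.
  - exact: rho_bnd (pf_rho pf2).
  - exact: pf_v pf2.
  - exact: pf_mv pf1.
  - exact: rho_bnd (pf_rho pf1).
  - exact: pf_v pf1.
have iL3 : intg I (fun x => cutw n eps x * ((r1 x - r2 x) * (u1 x - u2 x))).
  exact: (wprod_intg mkw kw srr su).
have iL12 := intgD mI iL1 iL2; have iL := intgD mI iL12 iL3.
set L := (fun x => _ + cutw n eps x * _) in iL *.
have -> : \int[mu]_(x in I) L x = \int[mu]_(x in I) (L x + h x).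
  by rewrite [RHS]RintegralD// no_net_work addr0.
have iR : intg I (fun x => (K * (1 + m ^+ 2)) * (S x + rupp C ^+ 2 * ind x)).
  by apply: intgZ => //; apply: intgD => //; exact: intgZ.
have Km : 0 <= K * (1 + m ^+ 2) by rewrite mulr_ge0// addr_ge0// sqr_ge0.
apply: (@le_trans _ _ (\int[mu]_(x in I) ((K * (1 + m ^+ 2)) * (S x + rupp C ^+ 2 * ind x)))); last first.
  rewrite RintegralZl//; last by apply: intgD => //; exact: intgZ.
  rewrite ler_wpM2l// RintegralD//; last exact: intgZ.
  by rewrite lerD2l RintegralZl// ler_wpM2l// sqr_ge0.
apply: ae_le_Rint => //; first exact: intgD.
apply: aeS3 (aeI box1 box2)
  (aeI3 (ae_neq 0) w1E w2E)
  (aeI3 hE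
    (scaled_flux A gamma theta c1 c2 n2 lo0 C0 pf1 w1E)
    (scaled_flux A gamma theta c1 c2 n2 lo0 C0 pf2 w2E)).
move=> x [bx1 bx2] [xn0 e1 e2] [eh ef1 ef2]; rewrite /= in_itv/= => xM.
have xM' : 0 < x <= M by case/andP: xM => x0 ->; rewrite lt_def xn0 x0.
have {}bx1 := bx1 xM'; have {}bx2 := bx2 xM'.
have [ev1 _ _] := ef1 xM'; have [ev2 _ _] := ef2 xM'.
have X0 : 0 < X x by rewrite root_pos//; case/andP: xM'.
have Xn0 : X x != 0 by rewrite gt_eqF.
have Er : X x * (R1 x - R2 x) = r1 x - r2 x by rewrite /sr; field.
have Eu : X x * (U1 x - U2 x) = u1 x - u2 x by rewrite /su (e1 xM) (e2 xM) mulrBr ![X x * _]mulrC !divfK.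
have hDx : `|D1 x - D2 x| <= m * (X x * `|R1 x - R2 x|).
  by rewrite -[X x]gtr0_norm// -normrM Er hD.
have := hK _ _ _ _ _ _ _ _ Pg (X x) m (D1 x - D2 x) bx1 bx2 hPg (root_le n xM) m0 hDx.
rewrite -ev1 -ev2 Eu => hh.
have R12 : (R1 x - R2 x) ^+ 2 <= cutw n eps x * (r1 x - r2 x) ^+ 2 + rupp C ^+ 2 * ind x.
  rewrite -Er exprMn /cutw /ind root_sq; case: ifP => _.
    by rewrite mulKf ?expf_neq0// mulr0 addr0.
  rewrite mul0r add0r mulr1 -[leLHS]real_normK ?num_real//.
  rewrite lerXn2r ?nnegrE// ?(ltW (rupp_gt0 C))//.
  have /andP[p1 p2] := sr_bnd n2 C0 pf1 xM'; have /andP[q1 q2] := sr_bnd n2 C0 pf2 xM'.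
  have l0 := rlow_gt0 C0.
  rewrite ler_norml; apply/andP; split.
    by rewrite lerBrDl (le_trans _ p1)// (le_trans _ (ltW l0))// subr_le0.
  by rewrite lerBlDr (le_trans p2)// lerDl (le_trans _ q1)// ltW.
have R13 : cutw n eps x * ((r1 x - r2 x) * (u1 x - u2 x)) <= `|(R1 x - R2 x) * (U1 x - U2 x)|.
  rewrite -Er -Eu /cutw root_sq; case: ifP => _; last by rewrite mul0r.
  by rewrite mulrACA -expr2 mulKf ?expf_neq0// ler_norm.
have Ew : w x = u1 x - u2 x by rewrite /w e1// e2.
rewrite /L eh// Ew.
apply: le_trans (ler_wpM2l Km (_ : (u1 x - u2 x) ^+ 2 + (rho1 x - rho2 x) ^+ 2 + (R1 x - R2 x) ^+ 2 <= _)).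
  apply: le_trans hh.
  rewrite [(rho1 x - rho2 x) * _]mulrC Eu.
  move: R13.
  move: (cutw n eps x * _) (`|_|) => z1 z2 hz.
  move: (_ * (Y1 x - Y2 x)) (_ * (U1 x - U2 x)) ((_ - rho1 x ^+ 2 * v1 x) * _) => z3 z4 z5.
  move: ((G * X x * _ + _) * _) ((a1 x - a2 x) * _) => z6 z7.
  by rewrite -subr_ge0 (_ : _ - _ = z2 - z1) ?subr_ge0//; ring.
rewrite /S -[leRHS]addrA lerD2l; exact: R12.
Qed.

End TwoProfiles.

(** * Growth of the energy *)

Section Gronwall.
Context {R : realType}.
Local Notation mu := (@lebesgue_measure R).

Lemma deriv0D (f g f' g' : R -> R) : deriv0 f f' -> deriv0 g g' ->
  deriv0 (fun t => f t + g t) (fun t => f' t + g' t).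
Proof.
move=> hf hg t e t0 e0; have e2 : 0 < e / 2%:R by rewrite divr_gt0.
have [d1 d10 h1] := hf t _ t0 e2; have [d2 d20 h2] := hg t _ t0 e2.
exists (Num.min d1 d2); first by rewrite lt_min d10.
move=> s s0 st; rewrite lt_min => /andP[s1 s2].
rewrite (_ : _ - _ = ((f s - f t) / (s - t) - f' t) + ((g s - g t) / (s - t) - g' t)); last by ring.
by rewrite (le_trans (ler_normD _ _))// [e]splitr lerD ?h1 ?h2.
Qed.

(** [ln Z] is a primitive of [Z' / Z] on every [[d, t]] with [d > 0]; then [d] tends
    to [0]. *)
Lemma gronwall (Z Z' k : R -> R) (t B : R) : 0 <= t -> deriv0 Z Z' -> cont0 Z' ->
  (forall s, 0 < Z s) -> (forall s, 0 <= k s) -> intg `[0, t] k ->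
  {ae mu, forall s, 0 <= s -> Z' s <= k s * Z s} ->
  \int[mu]_(s in `[0, t]) k s <= B -> Z t <= expR B * Z 0.
Proof.
move=> t0 dZ cZ' Z0 k0 ik hk hB.
have B0 : 0 <= B.
  by apply: le_trans hB; apply: Rintegral_ge0 => s _.
move: t0; rewrite le_eqVlt => /predU1P[<-|t0].
  by rewrite ler_peMl ?(ltW (Z0 _))// -expR0 ler_expR.
have cZ := deriv0_cont dZ.
have Zn0 s : Z s != 0 by rewrite gt_eqF.
have key d : 0 < d -> d <= t -> Z t <= expR B * Z d.
  move=> d0 dt.
  have cq : {within `[d, t], continuous (fun s => (Z s)^-1 * Z' s)}.
    move=> s; apply: cvgM; last exact: (cont0_within (ltW d0) cZ').
    by apply: cvgV => //; exact: (cont0_within (ltW d0) cZ).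
  have pl : prim d t (fun s => ln (Z s)) (fun s => (Z s)^-1 * Z' s).
    apply: prim_continuous_FTC => // s /andP[ds st].
    have hd := deriv0_is_derive (lt_le_trans d0 ds) dZ.
    have hl := is_derive1_ln (Z0 s).
    exact: is_derive1_comp.
  have [ip Ep] := pl; have := Ep d t (lexx _) dt (lexx _) => E.
  have sub : `[d, t] `<=` `[0, t] by apply: subitv => //; exact: ltW.
  have ikd : intg `[d, t] k by apply: intgS ik.
  have h1 : ln (Z t) - ln (Z d) <= B.
    rewrite E; apply: le_trans hB.
    apply: (@le_trans _ _ (\int[mu]_(s in `[d, t]) k s)).
      apply: ae_le_Rint => //; apply: aeS hk => s h /=; rewrite in_itv/= => /andP[ds st].
      by rewrite ler_pdivrMl// mulrC h// (le_trans (ltW d0)).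
    rewrite (Rint_chasles (ltW d0) dt ik) lerDr.
    by apply: Rintegral_ge0 => s _.
  rewrite -[Z t]lnK ?posrE// -[Z d]lnK ?posrE// -expRD ler_expR.
  by rewrite -lerBlDr.
apply/ler_addgt0Pr => e e0.
have e1 : 0 < e / expR B by rewrite divr_gt0 ?expR_gt0.
have [d d0 hd] := cZ 0 _ (lexx _) e1.
pose d1 := Num.min (d / 2%:R) t.
have d10 : 0 < d1 by rewrite lt_min t0 divr_gt0.
have d1t : d1 <= t by rewrite ge_min lexx orbT.
have d1d : `|d1 - 0| < d.
  by rewrite subr0 gtr0_norm// gt_min gtr_pMr ?invf_lt1 ?ltr1n.
apply: (le_trans (key d1 d10 d1t)).
have := hd d1 (ltW d10) d1d; rewrite ler_norml => /andP[_ h].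
have -> : expR B * Z 0 + e = expR B * (Z 0 + e / expR B).
  by rewrite mulrDr mulrCA divff ?mulr1// gt_eqF ?expR_gt0.
by rewrite ler_wpM2l ?expR_ge0// addrC -lerBlDr.
Qed.

End Gronwall.

Section Stability.
Context {R : realType}.
Local Notation mu := (@lebesgue_measure R).
Variables (n : nat) (A gamma G Poo M theta c1 c2 : R) (rhoi : R -> R) (C eps0 : R).
Local Notation p := (Params n A gamma G Poo M theta c1 c2).
Local Notation I := (`[0, M]%classic : set R).
Local Notation lo := (rhomin p rhoi / 2%:R).
Local Notation hi := (3%:R / 2%:R * rhomax p rhoi).
Local Notation V := (C * eps0).
Local Notation Q := (C * (C * eps0)).
Local Notation Vb := (sbound n lo C V Q).
Variables (F : forcing R) (NF K : R).
Variables (rho01 u01 rho02 u02 : R -> R).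
Variables (rho1 u1 r1 rho2 u2 r2 : R -> R -> R).
Variables (ut1 rt1 rhot1 ut2 rt2 rhot2 : R -> R -> R).
Hypothesis n2 : (2 <= n)%N.
Hypothesis M0 : 0 < M.
Hypothesis C0 : 0 < C.
Hypothesis lo0 : 0 < lo.
Hypothesis adm : admissible_forcing F.
Hypothesis FN : (forcing_norm F <= NF%:E)%E.
Hypothesis sol1 : weak_solution p F rho01 u01 rho1 u1 r1.
Hypothesis sol2 : weak_solution p F rho02 u02 rho2 u2 r2.
Hypothesis bnd1 : solution_bounds p C eps0 rhoi rho1 u1 r1.
Hypothesis bnd2 : solution_bounds p C eps0 rhoi rho2 u2 r2.
Hypothesis hut1 : forall T : R, 0 < T -> C1Lp M T 2%:E u1 ut1.
Hypothesis hut2 : forall T : R, 0 < T -> C1Lp M T 2%:E u2 ut2.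
Hypothesis hrhot1 : forall T : R, 0 < T -> C1Lp M T 2%:E rho1 rhot1.
Hypothesis hrhot2 : forall T : R, 0 < T -> C1Lp M T 2%:E rho2 rhot2.
Hypothesis hrt1 : forall T : R, 0 < T -> C1Lp M T +oo%E r1 rt1.
Hypothesis hrt2 : forall T : R, 0 < T -> C1Lp M T +oo%E r2 rt2.
Local Notation v1 := (vel_div n M u1 r1).
Local Notation v2 := (vel_div n M u2 r2).
Hypothesis mass1 : ae_xt M (fun x t => rhot1 x t + rho1 x t ^+ 2 * v1 x t = 0).
Hypothesis mass2 : ae_xt M (fun x t => rhot2 x t + rho2 x t ^+ 2 * v2 x t = 0).
Hypothesis flow1 : ae_xt M (fun x t => rt1 x t = u1 x t).
Hypothesis flow2 : ae_xt M (fun x t => rt2 x t = u2 x t).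
Hypothesis K0 : 0 <= K.
Hypothesis hK : energy_bound n A gamma G theta c1 c2 lo hi (rlow C) (rupp C) Vb
  (`|Poo| + NF) (root n M) K.
Implicit Types (x t eps : R).

Let mI : measurable I := measurable_itv _.
Let Ioo : (mu I < +oo)%E := mu_itv_lty 0 M.

Lemma forcing_bounds : [/\ 0 <= NF, (normLp half_line +oo (dP F) <= NF%:E)%E &
  (normLp half_line 2%:E (maj2 F) <= NF%:E)%E].
Proof.
have g0 q (g : R -> R) : (0 <= normLp half_line q g)%E by exact: Lnorm_ge0.
have H (a b c d e f : \bar R) : (0 <= a)%E -> (0 <= b)%E -> (0 <= c)%E -> (0 <= d)%E ->
    (0 <= e)%E -> (0 <= f)%E -> (a + b + c + d + e + f <= NF%:E)%E ->
    [/\ (0 <= NF%:E)%E, (c <= NF%:E)%E & (f <= NF%:E)%E].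
  move=> a0 b0 c0 d0 e0 f0 h; split; apply: le_trans h.
  - by rewrite !adde_ge0.
  - apply: (@le_trans _ _ (a + b + c)%E); first by rewrite leeDr// adde_ge0.
    by rewrite -!(addeA (a + b + c)%E) leeDl// !adde_ge0.
  - by rewrite leeDr// !adde_ge0.
by have [|||||| h1 h2 h3] := H _ _ _ _ _ _ _ _ _ _ _ _ FN => //; rewrite ?lee_fin.
Qed.

Lemma maj2_int t : 0 <= t -> intg `[0, t] (fun s => maj2 F s ^+ 2) /\
  \int[mu]_(s in `[0, t]) (maj2 F s ^+ 2) <= NF ^+ 2.
Proof.
move=> t0; have [N0 _ h] := forcing_bounds.
have mh : measurable (half_line : set R) by exact: measurable_itv.
have [_ _ _ _ [_ [mm _]]] := adm.
have [[_ i2] E] := normL2_le mh mm N0 h.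
have sub : `[0, t]%classic `<=` (half_line : set R).
  by move=> s; rewrite /half_line /= !in_itv/= => /andP[->].
split; first exact: intgS i2.
apply: le_trans E; rewrite /Rintegral fine_le//.
- by apply: (@integrable_fin_num _ _ _ mu) => //; exact: intgS i2.
- exact: (@integrable_fin_num _ _ _ mu _ mh _ i2).
- apply: ge0_subset_integral => //.
    by apply/measurable_EFinP; exact: measurable_funX.
  by move=> s _; rewrite lee_fin sqr_ge0.
Qed.

(** The three terms are written as pairings with a bounded weight, the form in
    which they can be differentiated. *)
Definition energy eps t : R :=
  \int[mu]_(x in I) (1 * ((u1 x t - u2 x t) * (u1 x t - u2 x t)))
  + \int[mu]_(x in I) (1 * ((rho1 x t - rho2 x t) * (rho1 x t - rho2 x t)))
  + \int[mu]_(x in I) (cutw n eps x * ((r1 x t - r2 x t) * (r1 x t - r2 x t))).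

Definition denergy eps t : R :=
  \int[mu]_(x in I) (1 * (2%:R * (u1 x t - u2 x t) * (ut1 x t - ut2 x t)))
  + \int[mu]_(x in I) (1 * (2%:R * (rho1 x t - rho2 x t) * (rhot1 x t - rhot2 x t)))
  + \int[mu]_(x in I) (cutw n eps x * (2%:R * (r1 x t - r2 x t) * (rt1 x t - rt2 x t))).

Let np2 := @norm_ok2 R M.
Let npoo := @norm_okoo R M M0.
Let cg2 (f : R -> R) : in_Lp I 2%:E f -> sqi I f. Proof. exact: in_L2_sqi. Qed.
Let cgoo (f : R -> R) : in_Lp I +oo%E f -> sqi I f. Proof. exact: in_Loo_sqi. Qed.

Let paths (g h g' h' : R -> R -> R) :
  [/\ path M g, path M g' & path_deriv M g g'] ->
  [/\ path M h, path M h' & path_deriv M h h'] ->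
  [/\ path M (fun x t => g x t - h x t), path M (fun x t => g' x t - h' x t) &
    path_deriv M (fun x t => g x t - h x t) (fun x t => g' x t - h' x t)].
Proof.
move=> [pg pg' dg] [ph ph' dh]; split; [exact: pathB|exact: pathB|exact: path_derivB].
Qed.

Let pu := paths (C1Lp_path np2 cg2 hut1) (C1Lp_path np2 cg2 hut2).
Let prho := paths (C1Lp_path np2 cg2 hrhot1) (C1Lp_path np2 cg2 hrhot2).
Let pr := paths (C1Lp_path npoo cgoo hrt1) (C1Lp_path npoo cgoo hrt2).

Let m1 : measurable_fun I (fun=> 1 : R). Proof. exact: measurable_cst. Qed.
Let b1 x : I x -> `|1 : R| <= 1. Proof. by rewrite normr1. Qed.

Lemma energy_deriv eps : 0 < eps -> deriv0 (energy eps) (denergy eps) /\ cont0 (denergy eps).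
Proof.
move=> e0; have mk : measurable_fun I (cutw n eps) by exact: cutw_meas.
have bk x : I x -> `|cutw n eps x| <= (root n eps ^+ 2)^-1 by move=> _; exact: cutw_bnd.
have [qu qu' du_] := pu; have [qo qo' do_] := prho; have [qr qr' dr_] := pr.
have cont2 (w : R -> R) (W : R) (g g' : R -> R -> R) : measurable_fun I w -> (forall x, I x -> `|w x| <= W) ->
    path M g -> path M g' ->
    cont0 (fun t => \int[mu]_(x in I) (w x * (2%:R * g x t * g' x t))).
  move=> mw bw pg pg'; have c := cont0M (cont0_cst 2%:R) (path_pair_cont mw bw pg pg').
  move=> t e t0 e0'; have [d d0 hd] := c t e t0 e0'; exists d => // s s0 st.
  have E s' : 0 <= s' -> \int[mu]_(x in I) (w x * (2%:R * g x s' * g' x s')) =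
      2%:R * \int[mu]_(x in I) (w x * (g x s' * g' x s')).
    move=> s'0; rewrite -RintegralZl//; first by apply: eq_Rintegral => x _; ring.
    by apply: (wprod_intg mw bw); [case: (pg _ s'0)|case: (pg' _ s'0)].
  by rewrite !E//; exact: hd.
split.
  apply: deriv0D; first apply: deriv0D.
  - exact: (path_sq_deriv m1 b1 qu qu' du_).
  - exact: (path_sq_deriv m1 b1 qo qo' do_).
  - exact: (path_sq_deriv mk bk qr qr' dr_).
apply: cont0D; first apply: cont0D.
- exact: (cont2 _ _ _ _ m1 b1 qu qu').
- exact: (cont2 _ _ _ _ m1 b1 qo qo').
- exact: (cont2 _ _ _ _ mk bk qr qr').
Qed.

Lemma energy_ge0 eps t : 0 <= energy eps t.
Proof.
by rewrite !addr_ge0//; apply: Rintegral_ge0 => x _; rewrite -expr2 mulr_ge0 ?sqr_ge0 ?cutw_ge0.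
Qed.

(** The equations of mass and of the flow replace the time derivatives of [rho] and
    [r], and [energy_at] applies; the force is Lipschitz in [r] with constant
    [maj2]. *)
Lemma denergy_le eps : 0 < eps -> {ae mu, forall t, 0 <= t ->
  denergy eps t <= 2%:R * K * (1 + maj2 F t ^+ 2) * (energy eps t + rupp C ^+ 2 * eps)}.
Proof.
move=> e0; have mk : measurable_fun I (cutw n eps) by exact: cutw_meas.
have bk x : I x -> `|cutw n eps x| <= (root n eps ^+ 2)^-1 by move=> _; exact: cutw_bnd.
have [qu qu' _] := pu; have [qo qo' _] := prho; have [qr qr' _] := pr.
have [qu1 qu1' _] := C1Lp_path np2 cg2 hut1; have [qu2 qu2' _] := C1Lp_path np2 cg2 hut2.
have [qr1 _ _] := C1Lp_path npoo cgoo hrt1; have [qr2 _ _] := C1Lp_path npoo cgoo hrt2.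
have [_ hdP _] := forcing_bounds.
have mh : measurable (half_line : set R) by exact: measurable_itv.
have aedP := normLoo_ae mh hdP.
have [_ [fx [fr [ft [[cdf _ _ _ hder] hmaj]]]] _ _ _] := adm.
apply: aeS3 (aeI hmaj aedP)
  (aeI mass1 mass2)
  (aeI flow1 flow2).
move=> t [hm hd] [ma1 ma2] [fl1 fl2] t0.
have P1 := sol_profile C0 sol1 bnd1 hut1 t0; have P2 := sol_profile C0 sol2 bnd2 hut2 t0.
have [w1 [w1E pw1 _]] := velocity_version n2 M0 lo0 C0 P1.
have [w2 [w2E pw2 _]] := velocity_version n2 M0 lo0 C0 P2.
have [KD1 hKD1] := sol_df_bnd n2 M0 C0 adm sol1 bnd1 hut1 t.
have [KD2 hKD2] := sol_df_bnd n2 M0 C0 adm sol2 bnd2 hut2 t.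
pose KD := Num.max KD1 KD2.
have tt : 0 <= t <= t by rewrite t0 lexx.
have bD1 x : 0 <= x <= M -> `|df F x (r1 x t) t| <= KD by move=> xM; rewrite le_max hKD1.
have bD2 x : 0 <= x <= M -> `|df F x (r2 x t) t| <= KD by move=> xM; rewrite le_max hKD2 ?orbT.
have hP : `|PGamma p F t| <= `|Poo| + NF.
  rewrite (le_trans (ler_normD _ _))// lerD2l -lee_fin; apply: hd.
  by rewrite /half_line /= in_itv/= t0.
have m0 : 0 <= maj2 F t.
  by have [_ h _] := hm t0 0 0 (lexx _) (lexx _); exact: le_trans h.
have hD x : 0 <= x <= M ->
    `|df F x (r1 x t) t - df F x (r2 x t) t| <= maj2 F t * `|r1 x t - r2 x t|.
  move=> xM; have x0 : 0 <= x by case/andP: xM.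
  apply: (@deriv0_lip _ (fun s => df F x s t) (fun s => fr x s t)).
  - by apply: is_deriv_in_deriv0 => s s0; have [_ h _] := hder x s t x0 s0 t0.
  - by move=> s s0; have [_ h _] := hm t0 x s x0 s0.
  - exact: (pf_r0 P1).
  - exact: (pf_r0 P2).
have := energy_at n2 M0 lo0 C0 P1 P2 w1E w2E pw1 pw2
  (sol_df_meas n2 M0 C0 lo0 adm sol1 bnd1 hut1 t0)
  (sol_df_meas n2 M0 C0 lo0 adm sol2 bnd2 hut2 t0) bD1 bD2
  (proj1 (qu1' t t0)) (proj1 (qu2' t t0)) (proj1 (qu1 t t0)) (proj1 (qu2 t t0))
  (proj1 (qr1 t t0)) (proj1 (qr2 t t0))
  (fun k a a0 => sol_momentum n2 M0 C0 lo0 adm sol1 bnd1 hut1 k a0 t0)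
  (fun k a a0 => sol_momentum n2 M0 C0 lo0 adm sol2 bnd2 hut2 k a0 t0)
  hK K0 m0 e0 hP hD.
have sdu := proj1 (qu t t0); have sdu' := proj1 (qu' t t0).
have sdo := proj1 (qo t t0); have sdo' := proj1 (qo' t t0).
have sdr := proj1 (qr t t0); have sdr' := proj1 (qr' t t0).
have iu := wprod_intg m1 b1 sdu sdu; have io := wprod_intg m1 b1 sdo sdo.
have ir := wprod_intg mk bk sdr sdr.
have iu' := wprod_intg m1 b1 sdu sdu'; have io' := wprod_intg m1 b1 sdo sdo'.
have ir' := wprod_intg mk bk sdr sdr'.
have iuo := intgD mI iu io; have iuo' := intgD mI iu' io'.
have -> : \int[mu]_(x in I) ((u1 x t - u2 x t) ^+ 2 + (rho1 x t - rho2 x t) ^+ 2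
    + cutw n eps x * (r1 x t - r2 x t) ^+ 2) = energy eps t.
  rewrite /energy -RintegralD// -RintegralD//.
  by apply: eq_Rintegral => x _; rewrite !mul1r !expr2.
move=> H.
have -> : denergy eps t = 2%:R * \int[mu]_(x in I) (1 * ((u1 x t - u2 x t) * (ut1 x t - ut2 x t))
    + 1 * ((rho1 x t - rho2 x t) * (rhot1 x t - rhot2 x t))
    + cutw n eps x * ((r1 x t - r2 x t) * (rt1 x t - rt2 x t))).
  rewrite RintegralD// RintegralD// !mulrDr -!RintegralZl//.
  by congr (_ + _ + _); apply: eq_Rintegral => x _; ring.
rewrite (_ : 2%:R * K * _ * _ =
  2%:R * (K * (1 + maj2 F t ^+ 2) * (energy eps t + rupp C ^+ 2 * eps))); last by ring.
rewrite ler_pM2l//.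
apply: le_trans H; rewrite le_eqVlt; apply/orP; left; apply/eqP.
have mrho1 := pf_mrho P1; have mrho2 := pf_mrho P2; have mv1 := pf_mv P1; have mv2 := pf_mv P2.
apply: ae_eq_Rint => //.
- exact: intgm (intgD mI iuo' ir').
- apply: measurable_funD; first apply: measurable_funD.
  + by apply: measurable_funM; [case: sdu'|case: sdu].
  + apply: measurable_funM; last by case: sdo.
    by apply: measurable_funB; apply: measurable_funM => //; exact: measurable_funX.
  + apply: measurable_funM => //; apply: measurable_funM; first by case: sdr.
    by case: sdu.
- apply: aeS3 (aeI (ma1 t0) (ma2 t0)) (fl1 t0) (fl2 t0).
  move=> x [e1 e2] e3 e4; rewrite /= in_itv/= => xM.
  have E1 : rhot1 x t = - (rho1 x t ^+ 2 * v1 x t) by apply/eqP; rewrite -addr_eq0 e1.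
  have E2 : rhot2 x t = - (rho2 x t ^+ 2 * v2 x t) by apply/eqP; rewrite -addr_eq0 e2.
  rewrite E1 E2 (e3 xM) (e4 xM); ring.
Qed.

(** The rate [2 K (1 + maj2^2)] has integral at most [2 K (t + NF^2)] over
    [[0, t]]. *)
Lemma energy_growth eps t : 0 < eps -> 0 <= t ->
  energy eps t <= expR (2%:R * K * (t + NF ^+ 2)) * (energy eps 0 + rupp C ^+ 2 * eps).
Proof.
move=> e0 t0; have [hE hE'] := energy_deriv e0.
have c0 : 0 < rupp C ^+ 2 * eps by rewrite mulr_gt0// exprn_gt0// rupp_gt0.
have [i2 hi2] := maj2_int t0.
have mt : measurable (`[0, t]%classic : set R) by [].
have ltt : (mu `[0%R, t] < +oo)%E := mu_itv_lty 0 t.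
have i1 : intg `[0, t] (fun=> 1 : R) by exact: intg_cst.
have i12 := intgD mt i1 i2.
have KK : 0 <= 2%:R * K by rewrite mulr_ge0.
have dZ : deriv0 (fun s => energy eps s + rupp C ^+ 2 * eps) (denergy eps).
  move=> s e s0 e0'; have [d d0 hd] := hE s e s0 e0'; exists d => // s' s'0 ns ds.
  have -> : energy eps s' + rupp C ^+ 2 * eps - (energy eps s + rupp C ^+ 2 * eps) =
    energy eps s' - energy eps s by ring.
  exact: hd.
have := @gronwall _ (fun s => energy eps s + rupp C ^+ 2 * eps) (denergy eps)
  (fun s => 2%:R * K * (1 + maj2 F s ^+ 2)) t (2%:R * K * (t + NF ^+ 2)) t0 dZ hE'.
move=> g; apply: (le_trans _ (g _ _ _ _ _)); first by rewrite lerDl ltW.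
- by move=> s; rewrite ltr_wpDl// energy_ge0.
- by move=> s; rewrite mulr_ge0// addr_ge0// sqr_ge0.
- exact: intgZ.
- exact: denergy_le.
- rewrite RintegralZl// ler_wpM2l// RintegralD// Rint_cst_itv// mul1r subr0.
  by rewrite lerD2l.
Qed.

Lemma cutw_mono eps eps' x : eps' <= eps -> cutw n eps x <= cutw n eps' x.
Proof.
move=> ee; rewrite /cutw; case: ifP => h; first by rewrite (le_lt_trans ee h).
by case: ifP => // _; exact: powR_ge0.
Qed.

Lemma energy_mono eps eps' t : 0 < eps' -> eps' <= eps -> 0 <= t ->
  energy eps t <= energy eps' t.
Proof.
move=> e0 ee t0; have [qr _ _] := pr; have sdr := proj1 (qr t t0).
have i d : 0 < d -> intg I (fun x => cutw n d x * ((r1 x t - r2 x t) * (r1 x t - r2 x t))).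
  move=> d0; have mk : measurable_fun I (cutw n d) by exact: cutw_meas.
  have bk x : I x -> `|cutw n d x| <= (root n d ^+ 2)^-1 by move=> _; exact: cutw_bnd.
  exact: (wprod_intg mk bk sdr sdr).
rewrite lerD2l; apply: ae_le_Rint; [by []|apply: i|exact: i|].
  exact: lt_le_trans ee.
by apply: aeW => x _; rewrite -expr2 ler_wpM2r ?sqr_ge0// cutw_mono.
Qed.

(** The cut-off weights tend to [x^(-2/n)], also at [x = 0], where that power is
    [0] by convention. *)
Lemma distance2_le t (B : R) : 0 <= t -> (forall eps, 0 < eps -> energy eps t <= B) ->
  (distance2 p (rho1^~ t) (u1^~ t) (r1^~ t) (rho2^~ t) (u2^~ t) (r2^~ t) <= B%:E)%E.
Proof.
move=> t0 hB; have [qu _ _] := pu; have [qo _ _] := prho; have [qr _ _] := pr.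
have sdu := proj1 (qu t t0); have sdo := proj1 (qo t t0); have sdr := proj1 (qr t t0).
pose e_ (k : nat) : R := k.+1%:R^-1.
have e_0 k : 0 < e_ k by rewrite invr_gt0.
pose f (w : R -> R) x : R := (u1 x t - u2 x t) ^+ 2 + (rho1 x t - rho2 x t) ^+ 2
  + w x * (r1 x t - r2 x t) ^+ 2.
have mf w : measurable_fun I w -> measurable_fun I (f w).
  move=> mw; apply: measurable_funD; first apply: measurable_funD.
  - by apply: measurable_funX; case: sdu.
  - by apply: measurable_funX; case: sdo.
  - by apply: measurable_funM => //; apply: measurable_funX; case: sdr.
have f0 w x : 0 <= w x -> 0 <= f w x.
  by move=> w0; rewrite !addr_ge0 ?sqr_ge0// mulr_ge0 ?sqr_ge0.
have if_ k : intg I (f (cutw n (e_ k))) /\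
    \int[mu]_(x in I) f (cutw n (e_ k)) x = energy (e_ k) t.
  have mk : measurable_fun I (cutw n (e_ k)) by exact: cutw_meas.
  have bk x : I x -> `|cutw n (e_ k) x| <= (root n (e_ k) ^+ 2)^-1 by move=> _; exact: cutw_bnd.
  have iu := wprod_intg m1 b1 sdu sdu; have io := wprod_intg m1 b1 sdo sdo.
  have ir := wprod_intg mk bk sdr sdr; have iuo := intgD mI iu io.
  have E x : f (cutw n (e_ k)) x = 1 * ((u1 x t - u2 x t) * (u1 x t - u2 x t))
    + 1 * ((rho1 x t - rho2 x t) * (rho1 x t - rho2 x t))
    + cutw n (e_ k) x * ((r1 x t - r2 x t) * (r1 x t - r2 x t)).
    by rewrite /f !mul1r !expr2.
  split; first by apply: eq_intg (intgD mI iuo ir) => // x _; rewrite -E.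
  by rewrite /energy -RintegralD// -RintegralD//; apply: eq_Rintegral => x _; rewrite E.
have [|||||||_ //] := @intg_le_lim _ I (fun k => f (cutw n (e_ k)))
  (f (fun x => x `^ (- (2%:R / n%:R)))) B => //.
- by apply: mf; exact: measurable_fun_powR.
- by move=> x _; apply: f0; exact: powR_ge0.
- by move=> k; case: (if_ k).
- by move=> k x _; apply: f0; exact: cutw_ge0.
- move=> x; rewrite /= in_itv/= => /andP[x0 xM]; apply: cvg_near_cst.
  move: x0; rewrite le_eqVlt => /predU1P[<-|x0].
    apply: nearW => k; rewrite /f /cutw ltNge (ltW (e_0 k))/= powR0//.
    by rewrite oppr_eq0 mulf_neq0// invr_neq0// pnatr_eq0 -lt0n ltnW.
  exists (Num.truncn x^-1) => // k /= hk; rewrite /f /cutw.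
  suff -> : e_ k < x by [].
  rewrite /e_ -[x]invrK ltf_pV2 ?posrE ?invr_gt0//.
  by apply: lt_le_trans (truncnS_gt _) _; rewrite ler_nat ltnS.
- by move=> k; have [_ ->] := if_ k; exact: hB.
Qed.

(** The solutions take their initial data, the velocity by [sol_initial], and the
    cut-off weight is smaller than the full one. *)
Lemma energy_initial eps : 0 < eps ->
  ((energy eps 0)%:E <= distance2 p rho01 u01 (lag_radius p rho01) rho02 u02 (lag_radius p rho02))%E.
Proof.
move=> e0; have [qu _ _] := pu; have [qo _ _] := prho; have [qr _ _] := pr.
have sdu := proj1 (qu 0 (lexx _)); have sdo := proj1 (qo 0 (lexx _)); have sdr := proj1 (qr 0 (lexx _)).
have mk : measurable_fun I (cutw n eps) by exact: cutw_meas.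
have bk x : I x -> `|cutw n eps x| <= (root n eps ^+ 2)^-1 by move=> _; exact: cutw_bnd.
have iu := wprod_intg m1 b1 sdu sdu; have io := wprod_intg m1 b1 sdo sdo.
have ir := wprod_intg mk bk sdr sdr; have iuo := intgD mI iu io.
have ig := intgD mI iuo ir.
have [drho01 du01] := ws_data sol1; have [drho02 du02] := ws_data sol2.
have L1 := sol_lag n2 C0 sol1 bnd1 hut1.
have L2 := sol_lag n2 C0 sol2 bnd2 hut2.
have U1 := sol_initial n2 M0 C0 lo0 adm sol1 bnd1 hut1.
have U2 := sol_initial n2 M0 C0 lo0 adm sol2 bnd2 hut2.
have W1 := ws_init sol1; have W2 := ws_init sol2.
rewrite /energy -RintegralD// -RintegralD// /Rintegral fineK; last first.
  exact: (@integrable_fin_num _ _ _ mu _ mI _ ig).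
pose g x : R := (u01 x - u02 x) ^+ 2 + (rho01 x - rho02 x) ^+ 2
  + x `^ (- (2%:R / n%:R)) * (r1 x 0 - r2 x 0) ^+ 2.
have mg : measurable_fun I g.
  apply: measurable_funD; first apply: measurable_funD.
  - apply: measurable_funX; apply: measurable_funB; [by case: du01|by case: du02].
  - apply: measurable_funX; apply: measurable_funB; [by case: drho01|by case: drho02].
  - apply: measurable_funM; first exact: measurable_fun_powR.
    by apply: measurable_funX; case: sdr.
have -> : distance2 p rho01 u01 (lag_radius p rho01) rho02 u02 (lag_radius p rho02) =
    (\int[mu]_(x in I) (g x)%:E)%E.
  rewrite /distance2; apply: eq_integral => x; rewrite inE/= in_itv/= => xM.
  by rewrite L1// L2.
apply: ae_ge0_le_integral => //.
- by move=> x _; rewrite lee_fin -!expr2 !mul1r !addr_ge0 ?sqr_ge0// mulr_ge0 ?sqr_ge0 ?cutw_ge0.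
- by apply/measurable_EFinP; exact: intgm ig.
- by move=> x _; rewrite lee_fin /g !addr_ge0 ?sqr_ge0// mulr_ge0 ?sqr_ge0 ?powR_ge0.
- exact/measurable_EFinP.
- apply: aeS2 (aeI U1 U2) (aeI W1 W2).
  move=> x [e1 e2] [e3 e4]; rewrite /= in_itv/= => xM.
  rewrite lee_fin !mul1r -!expr2 /g e1// e2//.
  have [-> _] := e3 xM; have [-> _] := e4 xM.
  by rewrite lerD2l ler_wpM2r ?sqr_ge0// cutw_le.
Qed.

End Stability.

(** * Stability *)

Lemma rhomin_gt0 (R : realType) (p : params R) (rhoi : R -> R) :
  0 < mass p -> stationary p rhoi -> 0 < rhomin p rhoi.
Proof.
move=> M0 st; have [c cI hc] := EVT_min (ltW M0) (stat_cont st).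
have c0 : 0 < rhoi c by apply: (stat_pos st); move: cI; rewrite in_itv.
apply: (lt_le_trans c0); apply: lb_le_inf.
  by exists (rhoi 0); exists 0 => //=; rewrite in_itv/= lexx ltW.
by move=> _ [x xI <-]; apply: hc; move: xI.
Qed.

Theorem theorem1p2 (R : realType) (n : nat)
    (A gamma G Poo M theta c1 c2 : R) (rhoi : R -> R) (C eps0 : R) :
  let p := Params n A gamma G Poo M theta c1 c2 in
  let a : R := alpha p in
  (2 <= n)%N ->
  0 < A -> 1 < gamma -> 0 < G -> 0 < Poo -> 0 < M ->
  (gamma = (2%:R * n%:R - 2%:R) / n%:R /\
     G * n%:R `^ ((2%:R - n%:R) / n%:R) * M `^ (2%:R / n%:R) < 2%:R * A) \/
  (2%:R * n%:R - 2%:R) / n%:R < gamma ->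
  0 <= theta -> 0 < c1 -> 0 < 2%:R * c1 + n%:R * c2 ->
  (2%:R * c1 * a + c2 * (2%:R * n%:R - 2%:R + a)) ^+ 2
    - 4%:R * (2%:R * c1 + c2)
      * (2%:R * c1 * (n%:R - 1) + c2 * (n%:R - 1) * (n%:R - 1 + a)) < 0 ->
  stationary p rhoi ->
  0 < C -> small_constant p C eps0 rhoi ->
  forall N : R, exists C' : R, 0 < C' /\
    forall (F : forcing R) (rho01 u01 rho02 u02 : R -> R)
      (rho1 u1 r1 rho2 u2 r2 : R -> R -> R),
    admissible_forcing F -> (forcing_norm F <= N%:E)%E ->
    weak_solution p F rho01 u01 rho1 u1 r1 ->
    solution_bounds p C eps0 rhoi rho1 u1 r1 ->
    weak_solution p F rho02 u02 rho2 u2 r2 ->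
    solution_bounds p C eps0 rhoi rho2 u2 r2 ->
    forall t : R, 0 <= t ->
    (distance2 p (rho1^~ t) (u1^~ t) (r1^~ t) (rho2^~ t) (u2^~ t) (r2^~ t)
     <= (C' * expR (C' * t))%:E
        * distance2 p rho01 u01 (lag_radius p rho01) rho02 u02 (lag_radius p rho02))%E.
Proof.
move=> p a n2 A0 gamma1 G0 Poo0 M0 _ theta0 c10 c20 _ st C0 _ N.
have lo0 : 0 < rhomin p rhoi / 2%:R by rewrite divr_gt0// rhomin_gt0.
have [K K0 hK] := @energy_pointwise R n A gamma G theta c1 c2 (rhomin p rhoi / 2%:R)
  (3%:R / 2%:R * rhomax p rhoi) (rlow C) (rupp C)
  (sbound n (rhomin p rhoi / 2%:R) C (C * eps0) (C * (C * eps0)))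
  (`|Poo| + N) (root n M) n2 theta0 c10 c20 lo0 (rlow_gt0 C0).
pose C' := expR (2%:R * K * N ^+ 2) + 2%:R * K.
have KK : 0 <= 2%:R * K by rewrite mulr_ge0.
have C'0 : 0 < C' by rewrite ltr_pwDl// expR_gt0.
exists C'; split=> // F rho01 u01 rho02 u02 rho1 u1 r1 rho2 u2 r2 adm FN s1 b1 s2 b2 t t0.
have [ut1 hut1] := ws_u s1; have [ut2 hut2] := ws_u s2.
have [rt1 hrt1 fl1] := ws_r s1; have [rt2 hrt2 fl2] := ws_r s2.
have [rhot1 hrhot1 ma1] := ws_rho s1; have [rhot2 hrhot2 ma2] := ws_rho s2.
have growth := energy_growth n2 M0 C0 lo0 adm FN s1 s2 b1 b2 hut1 hut2 hrhot1 hrhot2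
  hrt1 hrt2 ma1 ma2 fl1 fl2 K0 hK.
have mono := energy_mono n rho1 u1 rho2 u2 M0 hrt1 hrt2.
have dist := distance2_le A gamma G Poo theta c1 c2 n2 M0 hut1 hut2 hrhot1 hrhot2 hrt1 hrt2.
have init := energy_initial n2 M0 C0 lo0 adm s1 s2 b1 b2 hut1 hut2 hrhot1 hrhot2 hrt1 hrt2.
have D0 : (0 <= distance2 p rho01 u01 (lag_radius p rho01) rho02 u02 (lag_radius p rho02))%E.
  apply: integral_ge0 => x _.
  by rewrite lee_fin !addr_ge0 ?sqr_ge0// mulr_ge0 ?powR_ge0 ?sqr_ge0.
move: D0 init; case: (distance2 _ _ _ _ _ _ _) => [D| |] D0 init //; last first.
  by rewrite gt0_muley ?leey// lte_fin mulr_gt0// expR_gt0.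
rewrite lee_fin in D0; rewrite -EFinM.
pose B := expR (2%:R * K * (t + N ^+ 2)).
apply: (@le_trans _ _ (B * D)%:E); last first.
  rewrite lee_fin ler_wpM2r// /B mulrDr expRD mulrC ler_pM ?expR_ge0//.
    by rewrite /C' lerDl.
  by rewrite ler_expR ler_wpM2r// /C' lerDr expR_ge0.
have B0 : 0 < B by exact: expR_gt0.
apply: dist => // eps eps0'; apply/ler_addgt0Pr => e e0.
(* the error due to the cut-off is absorbed by cutting off closer to the centre *)
pose L := B * rupp C ^+ 2; have L0 : 0 < L by rewrite mulr_gt0// exprn_gt0// rupp_gt0.
pose d := Num.min eps (e / L).
have d0 : 0 < d by rewrite lt_min eps0' divr_gt0.
apply: (le_trans (mono eps d t d0 _ t0)); first by rewrite ge_min lexx.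
apply: (le_trans (growth d t d0 t0)); rewrite -/B.
have id := init d d0; rewrite lee_fin in id.
rewrite mulrDr lerD// ?ler_wpM2l// ?(ltW B0)// mulrA -/L mulrC -ler_pdivlMr//.
by rewrite ge_min lexx orbT.
Qed.
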